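(* Let $q=1$. Assume $\max_{j\in[p]}\mathbb{E}[X_j^4]\le M_X^4$ and $\mathbb{E}[Y^2]\le M_Y^2$ with $M_X,M_Y<\infty$. Assume the additive main effect model: $f^*(X_S)=\sum_{j\in S}f_j^*(X_j)$ with $f_j^*:\mathbb{R}\to\mathbb{R}$, $\mathbb{E}[f_j^*(X_j)]=0$, and the covariates $(X_j)_{j\in S}$ mutually independent. For $l\in S$ with $f_l^*(X_l)\ne0$ define the effective signal size $$\mathcal{E}_l=\big|\mathbb{E}[f_l^*(X_l)f_l^*(X_l')|X_l-X_l'|]\big|,$$ where $X'$ is an independent copy of $X$. Then there exists a constant $\bar C>0$ depending only on $M,M_X,M_Y,M_\mu$ (the kernel being fixed) such that the following holds. Suppose that $$\mathcal{E}_l\ge\bar C\cdot\big(\lambda^{1/2}(1+\lambda^{1/2})+\lambda\gamma\big).$$ Run projected gradient descent $\beta^{(k+1)}=\Pi_{\mathcal{B}_M}(\beta^{(k)}-\alpha\nabla\mathcal{J}_\gamma(\beta^{(k)}))$ with initialization $\beta^{(0)}=0$ and stepsize $0<\alpha\le\frac{\lambda^2}{\bar Cp}$, and let $\hat S=\mathrm{supp}(\beta)$, where $\beta$ is any accumulation point of the iterates $\{\beta^{(k)}\}_{k\in\mathbb{N}}$. Then $l\in\hat S$.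
   Context: Model: $(X,Y)\in\mathbb{R}^p\times\mathbb{R}$ with $\mathbb{E}[Y]=0$ and $Y=f^*(X_S)+\xi$, $\mathbb{E}[\xi|X]=0$. The signal set $S\subseteq[p]$ is the unique minimal subset such that $\mathbb{E}[Y|X]=\mathbb{E}[Y|X_S]$ and $X_S$ is independent of $X_{S^c}$. Kernel ($\ell_1$ type): $h(x)=\int_0^\infty e^{-tx}\mu(dt)$ with $\mu$ a finite nonnegative measure on $[0,\infty)$, $\mu((0,\infty))>0$, $\int_0^\infty t^{-1}\mu(dt)<\infty$, and $\mathrm{supp}(\mu)\subseteq[0,M_\mu]$, $M_\mu<\infty$. The kernel is $k(x,x')=h(\|x-x'\|_1)$ on $\mathbb{R}^p$ and $\mathcal{H}$ is its RKHS. The kernel is fixed. Objective: for $\beta\in\mathbb{R}_+^p$, $\beta\odot x=(\beta_ix_i)_i$, and with $\lambda>0$, $\gamma\ge0$, $$\mathcal{J}(\beta)=\min_{f\in\mathcal{H}}\tfrac12\mathbb{E}[(Y-f(\beta\odot X))^2]+\tfrac\lambda2\|f\|_{\mathcal{H}}^2,\qquad\mathcal{J}_\gamma(\beta)=\mathcal{J}(\beta)+\gamma\|\beta\|_1.$$ Gradients are coordinatewise (right derivatives when $\beta_l=0$). $\mathcal{B}_M=\{\beta\in\mathbb{R}_+^p:\|\beta\|_1\le M\}$ with $0<M<\infty$, and $\Pi_{\mathcal{B}_M}$ is the Euclidean projection onto it; $\mathrm{supp}(\beta)=\{j:\beta_j\ne0\}$. *)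

(* Defs.v *)
From HB Require Import structures.
From mathcomp Require Import all_boot all_order all_algebra.
From mathcomp Require Import all_classical all_reals all_analysis.

Set Implicit Arguments.
Unset Strict Implicit.
Unset Printing Implicit Defensive.

Import Order.TTheory GRing.Theory Num.Theory.
Import numFieldNormedType.Exports.

Local Open Scope classical_set_scope.
Local Open Scope ring_scope.

Definition l1norm (R : realType) (p : nat) (x : 'rV[R]_p) : R :=
  \sum_(i < p) `|x 0 i|.

Definition l2norm (R : realType) (p : nat) (x : 'rV[R]_p) : R :=
  Num.sqrt (\sum_(i < p) x 0 i ^+ 2).

Definition hadamard (R : realType) (p : nat) (b x : 'rV[R]_p) : 'rV[R]_p :=
  \row_(i < p) (b 0 i * x 0 i).

Definition vsupp (R : realType) (p : nat) (b : 'rV[R]_p) : {set 'I_p} :=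
  [set j | b 0 j != 0]%SET.

Definition measure_support (R : realType)
    (mu : {measure set (measurableTypeR R) -> \bar R}) : set R :=
  [set x | forall U : set R, open U -> U x -> (0 < mu U)%E].

(* The measure on [0, +oo[ is a Borel measure on R that does not charge
   ]-oo, 0[.  The integrand t^-1 is the extended real inverse, which is +oo at
   t = 0. *)
Record l1_kernel_measure (R : realType)
    (mu : {finite_measure set (measurableTypeR R) -> \bar R}) (Mmu : R) : Prop :=
  L1KernelMeasure {
    kmeas_nonneg : mu `]-oo, 0[%classic = 0%E;
    kmeas_pos : (0 < mu `]0%R, +oo[%classic)%E;
    kmeas_inv : (\int[mu]_(t in `[0%R, +oo[) (t%:E)^-1 < +oo)%E;
    kmeas_supp : measure_support mu `<=` `[0, Mmu]%classic
  }.

Definition laplace (R : realType)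
    (mu : {finite_measure set (measurableTypeR R) -> \bar R}) (x : R) : R :=
  \int[mu]_(t in `[0, +oo[) expR (- (t * x)).

Definition l1_kernel (R : realType)
    (mu : {finite_measure set (measurableTypeR R) -> \bar R}) (p : nat)
    (x y : 'rV[R]_p) : R :=
  laplace mu (l1norm (x - y)).

(* [H], with inner product [ip], is the reproducing kernel Hilbert space of [k];
   [ip] is only meaningful on [H]. *)
Record is_rkhs (R : realType) (E : Type) (k : E -> E -> R)
    (H : set (E -> R)) (ip : (E -> R) -> (E -> R) -> R) : Prop := IsRkhs {
  rkhs_zero : H (fun _ => 0);
  rkhs_lin : forall (a : R) f g, H f -> H g -> H (fun x => a * f x + g x);
  rkhs_ipC : forall f g, H f -> H g -> ip f g = ip g f;
  rkhs_ip_lin : forall (a : R) f g h, H f -> H g -> H h ->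
    ip (fun x => a * f x + g x) h = a * ip f h + ip g h;
  rkhs_ip_ge0 : forall f, H f -> 0 <= ip f f;
  rkhs_ip_eq0 : forall f, H f -> ip f f = 0 -> f = (fun _ => 0);
  rkhs_complete : forall u : nat -> E -> R, (forall n, H (u n)) ->
    (forall e : R, 0 < e -> exists N : nat, forall m n : nat,
       (N <= m)%N -> (N <= n)%N ->
       Num.sqrt (ip (u m \- u n) (u m \- u n)) < e) ->
    exists2 f, H f &
      Num.sqrt (ip (u n \- f) (u n \- f)) @[n --> \oo] --> (0 : R);
  rkhs_kernel : forall x, H (k x);
  rkhs_reproducing : forall f x, H f -> f x = ip f (k x)
}.

Definition covariates (R : realType) d (T : measurableType d) (p : nat)
    (X : 'I_p -> T -> R) (w : T) : 'rV[R]_p :=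
  \row_(j < p) X j w.

Definition penalized_risk (R : realType) d (T : measurableType d)
    (P : probability T R) (p : nat) (X : 'I_p -> T -> R) (Y : T -> R)
    (ip : ('rV[R]_p -> R) -> ('rV[R]_p -> R) -> R) (lambda : R)
    (b : 'rV[R]_p) (f : 'rV[R]_p -> R) : R :=
  2^-1 * fine 'E_P[fun w => (Y w - f (hadamard b (covariates X w))) ^+ 2]
  + lambda / 2 * ip f f.

(* The minimum over [H], written as an infimum so as to be a total function. *)
Definition objective (R : realType) d (T : measurableType d)
    (P : probability T R) (p : nat) (X : 'I_p -> T -> R) (Y : T -> R)
    (H : set ('rV[R]_p -> R))
    (ip : ('rV[R]_p -> R) -> ('rV[R]_p -> R) -> R) (lambda : R)
    (b : 'rV[R]_p) : R :=
  inf [set penalized_risk P X Y ip lambda b f | f in H].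

Definition objective_gamma (R : realType) d (T : measurableType d)
    (P : probability T R) (p : nat) (X : 'I_p -> T -> R) (Y : T -> R)
    (H : set ('rV[R]_p -> R))
    (ip : ('rV[R]_p -> R) -> ('rV[R]_p -> R) -> R) (lambda gamma : R)
    (b : 'rV[R]_p) : R :=
  objective P X Y H ip lambda b + gamma * l1norm b.

(* Partial derivative on the nonnegative orthant: one-sided on its faces. *)
Definition partial_orthant (R : realType) (p : nat) (F : 'rV[R]_p -> R)
    (b : 'rV[R]_p) (l : 'I_p) : R :=
  if b 0 l == 0 then
    lim (t^-1 * (F (b + t *: delta_mx 0 l) - F b) @[t --> (0 : R)^'+])
  else derive1 (fun t : R => F (b + t *: delta_mx 0 l)) 0.

Definition grad_orthant (R : realType) (p : nat) (F : 'rV[R]_p -> R)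
    (b : 'rV[R]_p) : 'rV[R]_p :=
  \row_(l < p) partial_orthant F b l.

Definition l1_ball_orthant (R : realType) (p : nat) (M : R) : set 'rV[R]_p :=
  [set b : 'rV[R]_p | (forall j, 0 <= b 0 j) /\ l1norm b <= M].

Definition is_projection (R : realType) (p : nat) (B : set 'rV[R]_p)
    (v b : 'rV[R]_p) : Prop :=
  B b /\ forall c, B c -> l2norm (v - b) <= l2norm (v - c).

Definition projected_gradient_descent (R : realType) (p : nat)
    (F : 'rV[R]_p -> R) (B : set 'rV[R]_p) (alpha : R)
    (b : nat -> 'rV[R]_p) : Prop :=
  b 0%N = 0 /\
  forall k : nat,
    is_projection B (b k - alpha *: grad_orthant F (b k)) (b k.+1).

(* The sigma-algebra generated by the coordinates X_j, j \in A. *)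
Definition sigma_coords (R : realType) d (T : measurableType d) (p : nat)
    (X : 'I_p -> T -> R) (A : {set 'I_p}) : set (set T) :=
  <<s \bigcup_(j in [set` A]) preimage_set_system setT (X j) measurable >>.

(* [Z] is a version of the conditional expectation of [Y] given the
   sub-sigma-algebra [G]. *)
Record is_condexp (R : realType) d (T : measurableType d)
    (P : probability T R) (G : set (set T)) (Y Z : T -> R) : Prop :=
  IsCondexp {
    condexp_dom : P.-integrable setT (EFin \o Y);
    condexp_int : P.-integrable setT (EFin \o Z);
    condexp_meas : forall B : set R, measurable B -> G (Z @^-1` B);
    condexp_eq : forall A : set T, G A ->
      (\int[P]_(w in A) (Z w)%:E = \int[P]_(w in A) (Y w)%:E)%E
  }.

Definition indep_systems (R : realType) d (T : measurableType d)
    (P : probability T R) (F G : set (set T)) : Prop :=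
  forall A B, F A -> G B -> (P (A `&` B) = P A * P B)%E.

(* E[Y | X] = E[Y | X_A] almost surely, and X_A is independent of X_{A^c}. *)
Definition sufficient_set (R : realType) d (T : measurableType d)
    (P : probability T R) (p : nat) (X : 'I_p -> T -> R) (Y : T -> R)
    (A : {set 'I_p}) : Prop :=
  (exists Z Z' : T -> R,
     [/\ is_condexp P (sigma_coords X [set: 'I_p]%SET) Y Z,
         is_condexp P (sigma_coords X A) Y Z' &
         {ae P, forall w, Z w = Z' w}]) /\
  indep_systems P (sigma_coords X A) (sigma_coords X (~: A)%SET).

Definition minimal_sufficient (R : realType) d (T : measurableType d)
    (P : probability T R) (p : nat) (X : 'I_p -> T -> R) (Y : T -> R)
    (A : {set 'I_p}) : Prop :=
  sufficient_set P X Y A /\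
  forall B : {set 'I_p}, sufficient_set P X Y B -> B \subset A -> B = A.

Definition is_signal_set (R : realType) d (T : measurableType d)
    (P : probability T R) (p : nat) (X : 'I_p -> T -> R) (Y : T -> R)
    (S : {set 'I_p}) : Prop :=
  minimal_sufficient P X Y S /\
  forall B : {set 'I_p}, minimal_sufficient P X Y B -> B = S.

(* X_S as a vector indexed by the elements of S. *)
Definition subcovariates (R : realType) d (T : measurableType d) (p : nat)
    (X : 'I_p -> T -> R) (S : {set 'I_p}) (w : T) : {j | j \in S} -> R :=
  fun j => X (val j) w.

Record regression_model (R : realType) d (T : measurableType d)
    (P : probability T R) (p : nat) (X : 'I_p -> T -> R) (Y xi : T -> R)
    (S : {set 'I_p}) (fstar : ({j | j \in S} -> R) -> R) : Prop :=
  RegressionModel {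
    model_centered : ('E_P[Y] = 0)%E;
    model_eq : {ae P, forall w, Y w = fstar (subcovariates X (S := S) w) + xi w};
    model_noise :
      is_condexp P (sigma_coords X [set: 'I_p]%SET) xi (fun _ => 0);
    model_signal : is_signal_set P X Y S
  }.

(* The product rule over all families of Borel sets; subfamilies of S are
   covered by taking some of the sets to be the whole line. *)
Definition mutually_independent (R : realType) d (T : measurableType d)
    (P : probability T R) (p : nat) (X : 'I_p -> T -> R)
    (S : {set 'I_p}) : Prop :=
  forall B : 'I_p -> set R, (forall j, measurable (B j)) ->
    (P (\bigcap_(j in [set` S]) X j @^-1` B j)
     = \prod_(j in S) P (X j @^-1` B j))%E.

Record additive_main_effect (R : realType) d (T : measurableType d)
    (P : probability T R) (p : nat) (X : 'I_p -> T -> R) (S : {set 'I_p})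
    (fstar : ({j | j \in S} -> R) -> R) (f : 'I_p -> R -> R) : Prop :=
  AdditiveMainEffect {
    additive_eq : {ae P, forall w,
      fstar (subcovariates X (S := S) w) = \sum_(j in S) f j (X j w)};
    additive_meas : forall j, j \in S -> measurable_fun setT (f j);
    additive_int : forall j, j \in S ->
      P.-integrable setT (EFin \o (f j \o X j));
    additive_centered : forall j, j \in S -> ('E_P[f j \o X j] = 0)%E;
    additive_indep : mutually_independent P X S
  }.

(* The independent copy is realised on the product probability space. *)
Definition signal_size (R : realType) d (T : measurableType d)
    (P : probability T R) (p : nat) (X : 'I_p -> T -> R)
    (f : 'I_p -> R -> R) (l : 'I_p) : \bar R :=
  (`| 'E_(P \x P)[fun w : T * T =>
        (f l (X l w.1) * f l (X l w.2) * `|X l w.1 - X l w.2|)%R] |)%E.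

(* Main.v *)
From HB Require Import structures.
Require Import Defs.
From mathcomp Require Import all_boot all_order all_algebra.
From mathcomp Require Import all_classical all_reals all_analysis.
From mathcomp Require Import measurable_realfun ring lra.
Import Order.TTheory GRing.Theory Num.Theory.
Import numFieldNormedType.Exports.
Set Implicit Arguments.
Unset Strict Implicit.
Unset Printing Implicit Defensive.
Local Open Scope classical_set_scope.
Local Open Scope ring_scope.

(** Write [r] for the residual [Y - f (beta X)] of the penalised fit [f] at the scale
    [beta], [N] for the l1 distance of the scaled covariates of two independent
    copies, and [energy r b] for the mean of [r r' h(N)] at the scale [b].

    Duality.  The residual is the optimum of the dual problem, and the dual objective
    depends on the scale only through the energy.  Keeping [r] fixed while the scale
    moves from [b] to [c] bounds the change of the objective on both sides by the
    change of the energy, up to a quadratic term ([objective_lower],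
    [objective_upper]).  Since [h] is smooth with bounded derivatives on the
    half-line, this gives a quadratic expansion of the objective on the whole orthant,
    with an explicit gradient and an explicit curvature ([objective_expansion]).
    Hence the coordinatewise derivatives are those of the expansion, projected
    gradient descent with a short step decreases the objective, and each cluster point
    [beta] is stationary on the ball ([cluster_stationary], [stationary_cluster]).

    The signal.  Suppose that the coordinate [l] of [beta] is zero.  Then
    [r = f_l(X_l) + rho], where [rho] is made of the other coordinates and of noise,
    and the kernel does not see [X_l].  The slope of the energy along [l] is the mean
    of [r r' |X_l - X_l'| psi(N)] with [psi = - h'], and expands into four products of
    means ([Rint_separate]).  The signal term is minus the effective signal size times
    the mean of [psi(N)], because the distance is a conditionally negative kernel
    ([centered_distance_form_le0]); that mean is bounded below on the ball
    ([slope_mean_ge]).  The three terms that involve [rho] are governed by the energy: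
    [h] and [psi] are mixtures of the positive kernels [exp (- t N)] with [t] at most
    [Mmu], so the form of [psi] is at most [Mmu] times that of [h], and
    Cauchy-Schwarz handles the cross terms ([slope_energy_zero_coord]).  The energy of
    the residual is at most [lambda * E Y^2] ([fit_energy_le]), so these terms are of
    order [sqrt lambda].

    The competition.  Stationarity against the vertex [M e_l] of the ball bounds the
    slope along [l] from below by the radial slope [sum_j beta_j slope_j], up to the
    penalty.  The energy is nonnegative along the ray through [beta] and has bounded
    curvature there, so its radial slope is at least of order [- sqrt lambda]
    ([radial_slope_ge]).  A signal above the threshold is incompatible with these two
    bounds ([signal_too_large]), so the coordinate [l] of [beta] is not zero. *)

(** * Real-valued integrals *)

Notation integrableR m f := (m.-integrable setT (EFin \o f)).

Lemma discriminant_le (R : realFieldType) (a b c : R) : 0 <= a ->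
  (forall t, 0 <= c + 2 * t * b + t ^+ 2 * a) -> b ^+ 2 <= c * a.
Proof.
move=> a0 H; have c0 : 0 <= c by have := H 0; lra.
have [ap|an] := ltP 0 a.
  have := H (- (b / a)); have -> : c + 2 * - (b / a) * b + (- (b / a)) ^+ 2 * a =
     (c * a - b ^+ 2) / a by field; rewrite gt_eqF.
  by rewrite pmulr_lge0 ?invr_gt0// subr_ge0.
have -> : a = 0 by apply/le_anti; rewrite an a0.
have [->|b0] := eqVneq b 0; first by rewrite expr0n mulr0.
(* the affine function [c + 2 * t * b] takes the value -1 there *)
have := H (- (c + 1) / (2 * b)).
have -> : c + 2 * (- (c + 1) / (2 * b)) * b + (- (c + 1) / (2 * b)) ^+ 2 * a =
  - 1 + (- (c + 1) / (2 * b)) ^+ 2 * a by field.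
have -> : a = 0 by apply/le_anti; rewrite an a0.
by rewrite mulr0 addr0 oppr_ge0 leNgt ltr01.
Qed.

Section RealIntegral.
Context d (T : measurableType d) (R : realType) (m : {measure set T -> \bar R}).
Implicit Types f g h : T -> R.

Lemma intR_meas f : integrableR m f -> measurable_fun setT f.
Proof. by move=> /measurable_int/measurable_EFinP. Qed.

Lemma intR_ext f g : f =1 g -> integrableR m f -> integrableR m g.
Proof. by move=> /funext ->. Qed.

Lemma intR_le f g : measurable_fun setT f -> (forall x, `|f x| <= g x) ->
  integrableR m g -> integrableR m f.
Proof.
move=> mf fg; apply: le_integrable => //; first exact/measurable_EFinP.
by move=> x _ /=; rewrite lee_fin (le_trans (fg x))// ler_norm.
Qed.

Lemma intRD f g : integrableR m f -> integrableR m g ->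
  integrableR m (fun x => f x + g x).
Proof. by move=> mf mg; apply: (integrableD measurableT mf mg). Qed.

Lemma intRZ (c : R) f : integrableR m f -> integrableR m (fun x => c * f x).
Proof. by move=> mf; apply: (integrableZl measurableT c mf). Qed.

Lemma intRN f : integrableR m f -> integrableR m (fun x => - f x).
Proof. by move=> mf; apply: intR_ext (intRZ (-1) mf) => x; rewrite mulN1r. Qed.

Lemma intRB f g : integrableR m f -> integrableR m g ->
  integrableR m (fun x => f x - g x).
Proof. by move=> mf mg; apply: (intRD mf (intRN mg)). Qed.

Lemma intR_norm f : integrableR m f -> integrableR m (fun x => `|f x|).
Proof. exact: integrable_norm. Qed.

Lemma intR_bounded_mul (C : R) h f : measurable_fun setT h ->
  (forall x, `|h x| <= C) -> integrableR m f -> integrableR m (fun x => h x * f x).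
Proof.
move=> mh hC mf; apply: (@intR_le _ (fun x => C * `|f x|)).
- by apply: measurable_funM => //; exact: intR_meas.
- by move=> x; rewrite normrM ler_wpM2r.
- by apply: intRZ; exact: intR_norm.
Qed.

Lemma intR_sum (I : Type) (s : seq I) (Q : pred I) (F : I -> T -> R) :
  (forall i, Q i -> integrableR m (F i)) ->
  integrableR m (fun x => \sum_(i <- s | Q i) F i x).
Proof.
move=> mF; apply: (eq_integrable measurableT
  (fun x => \sum_(i <- s | Q i) (F i x)%:E)%E).
  by move=> x _; rewrite /= sumEFin.
by apply: integrable_sum => //.
Qed.

Lemma RintD f g : integrableR m f -> integrableR m g ->
  \int[m]_x (f x + g x) = \int[m]_x f x + \int[m]_x g x.
Proof. exact: RintegralD. Qed.

Lemma RintB f g : integrableR m f -> integrableR m g ->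
  \int[m]_x (f x - g x) = \int[m]_x f x - \int[m]_x g x.
Proof. exact: RintegralB. Qed.

Lemma RintZ (c : R) f : integrableR m f ->
  \int[m]_x (c * f x) = c * \int[m]_x f x.
Proof. exact: RintegralZl. Qed.

Lemma Rint_sum (I : Type) (s : seq I) (F : I -> T -> R) :
  (forall i, integrableR m (F i)) ->
  \int[m]_x (\sum_(i <- s) F i x) = \sum_(i <- s) \int[m]_x F i x.
Proof.
move=> mF; elim: s => [|i s IH].
  rewrite big_nil -[RHS](mul0r (fine (m setT))) -Rintegral_cst//.
  by apply: eq_Rintegral => x _; rewrite big_nil.
rewrite big_cons -IH -RintD//; last exact: intR_sum.
by apply: eq_Rintegral => x _; rewrite big_cons.
Qed.

Lemma Rint_eq0 f : (forall x, f x = 0) -> \int[m]_x f x = 0.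
Proof. by move=> /funext ->; rewrite Rintegral_cst// mul0r. Qed.

Lemma Rint_le f g : integrableR m f -> integrableR m g ->
  (forall x, f x <= g x) -> \int[m]_x f x <= \int[m]_x g x.
Proof. by move=> mf mg fg; apply: le_Rintegral. Qed.

Lemma Rint_ge0 f : (forall x, 0 <= f x) -> 0 <= \int[m]_x f x.
Proof. by move=> f0; apply: Rintegral_ge0. Qed.

Lemma Rint_norm_le f g : integrableR m f -> integrableR m g ->
  (forall x, `|f x| <= g x) -> `|\int[m]_x f x| <= \int[m]_x g x.
Proof.
move=> mf mg fg; apply: le_trans (le_normr_Rintegral _ mf) _ => //.
by apply: Rint_le => //; exact: intR_norm.
Qed.

Lemma Rint_ae_eq f g : measurable_fun setT f -> measurable_fun setT g ->
  {ae m, forall x, f x = g x} -> \int[m]_x f x = \int[m]_x g x.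
Proof.
move=> mf mg fg; congr fine; apply: ae_eq_integral => //.
- exact/measurable_EFinP.
- exact/measurable_EFinP.
- by apply: filterS fg => x /= fgx _; rewrite fgx.
Qed.

Lemma EFin_Rint f : integrableR m f ->
  (\int[m]_x f x)%:E = (\int[m]_x (f x)%:E)%E.
Proof. by move=> mf; rewrite fineK//; apply: integrable_fin_num. Qed.

Lemma intR_ge0P f : measurable_fun setT f -> (forall x, 0 <= f x) ->
  (\int[m]_x (f x)%:E < +oo)%E -> integrableR m f.
Proof.
move=> mf f0 foo; apply/integrableP; split; first exact/measurable_EFinP.
apply: le_lt_trans foo; apply: ge0_le_integral => //.
- by apply/measurable_EFinP; exact: measurableT_comp.
- exact/measurable_EFinP.
- by move=> x _; rewrite lee_fin ger0_norm.
Qed.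

(** [2 * |f g| <= f ^ 2 + g ^ 2]. *)
Lemma intR_mul_sq f g : measurable_fun setT f -> measurable_fun setT g ->
  integrableR m (fun x => f x ^+ 2) -> integrableR m (fun x => g x ^+ 2) ->
  integrableR m (fun x => f x * g x).
Proof.
move=> mf mg f2 g2; apply: (@intR_le _ (fun x => f x ^+ 2 + g x ^+ 2)).
- exact: measurable_funM.
- move=> x; rewrite ler_norml; apply/andP; split; nra.
- exact: intRD.
Qed.

Lemma intR_sqB f g : measurable_fun setT f -> measurable_fun setT g ->
  integrableR m (fun x => f x ^+ 2) -> integrableR m (fun x => g x ^+ 2) ->
  integrableR m (fun x => (f x - g x) ^+ 2).
Proof.
move=> mf mg f2 g2; apply: (@intR_le _ (fun x => 2 * (f x ^+ 2 + g x ^+ 2))).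
- by apply: measurable_funX; exact: measurable_funB.
- move=> x; rewrite ger0_norm ?sqr_ge0//.
  by have := sqr_ge0 (f x + g x); rewrite !sqrrD sqrrN; lra.
- by apply: intRZ; exact: intRD.
Qed.

End RealIntegral.

Section FiniteMeasure.
Context d (T : measurableType d) (R : realType).

Lemma intR_cst (m : {finite_measure set T -> \bar R}) (c : R) :
  integrableR m (fun=> c).
Proof.
apply/integrableP; split; first exact: measurable_cst.
rewrite /= integral_cst//= lte_mul_pinfty//.
by rewrite -ge0_fin_numE//; exact: fin_num_measure.
Qed.

Lemma intR_bounded (m : {finite_measure set T -> \bar R}) (C : R) (f : T -> R) :
  measurable_fun setT f -> (forall x, `|f x| <= C) -> integrableR m f.
Proof. by move=> mf fC; apply: (intR_le mf fC); exact: intR_cst. Qed.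

Lemma Rint_cst (P : probability T R) (c : R) : \int[P]_x c = c.
Proof. by rewrite Rintegral_cst//= probability_setT mulr1. Qed.

Lemma intR_sq (m : {finite_measure set T -> \bar R}) (f : T -> R) :
  measurable_fun setT f -> integrableR m (fun x => f x ^+ 2) -> integrableR m f.
Proof.
move=> mf f2; apply: (@intR_le _ _ _ _ _ (fun x => 1 + f x ^+ 2)) => //.
- by move=> x; rewrite ler_norml; apply/andP; split; nra.
- by apply: intRD => //; exact: intR_cst.
Qed.

End FiniteMeasure.

(** * Products of measures and independent copies *)

Section ProductMeasure.
Context d1 d2 (T1 : measurableType d1) (T2 : measurableType d2) (R : realType).
Variables (m1 : {sigma_finite_measure set T1 -> \bar R})
  (m2 : {sigma_finite_measure set T2 -> \bar R}).
Local Notation mm := (m1 \x m2)%E.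

Lemma measurable_slice1 (F : T1 * T2 -> R) (x : T1) :
  measurable_fun setT F -> measurable_fun setT (fun y => F (x, y)).
Proof. by move=> mF; apply: measurableT_comp. Qed.

Lemma measurable_slice2 (F : T1 * T2 -> R) (y : T2) :
  measurable_fun setT F -> measurable_fun setT (fun x => F (x, y)).
Proof. by move=> mF; apply: measurableT_comp. Qed.

Lemma intR_iterated (F : T1 * T2 -> R) (g : T1 -> R) :
  measurable_fun setT F ->
  (forall x, integrableR m2 (fun y => F (x, y))) ->
  integrableR m1 g -> (forall x, \int[m2]_y `|F (x, y)| <= g x) ->
  integrableR mm F.
Proof.
move=> mF iF ig Fg; apply/(@integrable12ltyP _ _ _ _ _ m1 m2 (EFin \o F)).
  exact/measurable_EFinP.
apply: (@le_lt_trans _ _ (\int[m1]_x (g x)%:E)%E); last first.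
  by have := integrable_fin_num measurableT ig; rewrite fin_numE ltey => /andP[].
have mA : measurable_fun setT (fun x => \int[m2]_y `|(F (x, y))%:E|)%E.
  apply: (measurable_fun_fubini_tonelli_F (fun z => `|(F z)%:E|%E)) => //.
  by apply/measurable_EFinP; exact: measurableT_comp.
apply: ge0_le_integral => //.
- by move=> x _; apply: integral_ge0 => y _.
- by apply/measurable_EFinP; exact: intR_meas ig.
- move=> x _; apply: le_trans (_ : (\int[m2]_y `|F (x, y)|)%:E <= _)%E.
    by rewrite EFin_Rint//; exact: intR_norm.
  by rewrite lee_fin.
Qed.

Lemma Rint_Fubini (F : T1 * T2 -> R) :
  (forall x, integrableR m2 (fun y => F (x, y))) -> integrableR mm F ->
  integrableR m1 (fun x => \int[m2]_y F (x, y)) /\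
  \int[mm]_z F z = \int[m1]_x \int[m2]_y F (x, y).
Proof.
move=> iF imF.
have E : EFin \o (fun x => \int[m2]_y F (x, y)) = fubini_F m2 (EFin \o F).
  by apply/funext => x; rewrite /fubini_F /= EFin_Rint.
split; first by rewrite E; exact: integrable_fubini_F.
rewrite {1}/Rintegral -(integral12_prod_meas1 imF) /Rintegral; congr fine.
by apply: eq_integral => x _; rewrite -[LHS]/(fubini_F m2 (EFin \o F) x) -E.
Qed.

Lemma Rint_Fubini_swap (F : T1 * T2 -> R) :
  (forall y, integrableR m1 (fun x => F (x, y))) -> integrableR mm F ->
  \int[mm]_z F z = \int[m2]_y \int[m1]_x F (x, y).
Proof.
move=> iF imF.
have E : EFin \o (fun y => \int[m1]_x F (x, y)) = fubini_G m1 (EFin \o F).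
  by apply/funext => x; rewrite /fubini_G /= EFin_Rint.
rewrite {1}/Rintegral -(integral21_prod_meas1 imF) /Rintegral; congr fine.
by apply: eq_integral => x _; rewrite -[LHS]/(fubini_G m1 (EFin \o F) x) -E.
Qed.

End ProductMeasure.

(** The product measure as a probability: bounded functions of a pair of
    independent copies are then integrable, and constants integrate to themselves. *)
Definition square_prob d (T : measurableType d) (R : realType)
  (P : probability T R) : probability (T * T)%type R := (P \x P)%E.

Section IndependentCopies.
Context d (T : measurableType d) (R : realType) (P : probability T R).
Local Notation PP := (square_prob P).

(** All functions of two independent copies that occur below are dominated by a
    product [g1 x * g2 y] of integrable functions; one set of lemmas then covers
    integrability, both orders of iterated integration and the norm bound. *)
Section Dominated.
Variables (F : T * T -> R) (g1 g2 : T -> R).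
Hypotheses (mF : measurable_fun setT F) (i1 : integrableR P g1)
  (i2 : integrableR P g2) (Fg : forall x y, `|F (x, y)| <= g1 x * g2 y).

Let slice1 x : integrableR P (fun y => F (x, y)).
Proof. by apply: (intR_le (measurable_slice1 x mF) (Fg x)); exact: intRZ. Qed.

Let slice2 y : integrableR P (fun x => F (x, y)).
Proof.
apply: (intR_le (measurable_slice2 y mF) (g := fun x => g2 y * g1 x)).
  by move=> x; rewrite mulrC.
exact: intRZ.
Qed.

Lemma pair_dom_int : integrableR PP F.
Proof.
apply: (@intR_iterated _ _ _ _ _ P P F (fun x => g1 x * \int[P]_y g2 y)) => //.
- by apply: (intR_ext (fun x => mulrC _ _)); exact: intRZ.
- move=> x; rewrite -RintZ//; apply: Rint_le => //; last exact: intRZ.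
  exact: intR_norm.
Qed.

Lemma pair_dom_iter : \int[PP]_z F z = \int[P]_x \int[P]_y F (x, y).
Proof. exact: (Rint_Fubini slice1 pair_dom_int).2. Qed.

Lemma pair_dom_iter_swap : \int[PP]_z F z = \int[P]_y \int[P]_x F (x, y).
Proof. exact: (Rint_Fubini_swap slice2 pair_dom_int). Qed.

Lemma pair_dom_le : `|\int[PP]_z F z| <= \int[P]_x g1 x * \int[P]_y g2 y.
Proof.
rewrite pair_dom_iter mulrC -RintZ//.
apply: Rint_norm_le; [exact: (Rint_Fubini slice1 pair_dom_int).1|exact: intRZ|].
move=> x; rewrite mulrC -RintZ//; apply: Rint_norm_le; [exact: slice1|exact: intRZ|].
exact: Fg.
Qed.

End Dominated.

Lemma Rint_pair_prod (f g : T -> R) : integrableR P f -> integrableR P g ->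
  integrableR PP (fun z => f z.1 * g z.2) /\
  \int[PP]_z (f z.1 * g z.2) = \int[P]_x f x * \int[P]_x g x.
Proof.
move=> iF ig.
have mF : measurable_fun setT (fun z : T * T => f z.1 * g z.2).
  apply: measurable_funM.
  - exact: (measurableT_comp (intR_meas iF) measurable_fst).
  - exact: (measurableT_comp (intR_meas ig) measurable_snd).
have dom x y : `|f (x, y).1 * g (x, y).2| <= `|f x| * `|g y| by rewrite normrM.
have [n1 n2] := (intR_norm iF, intR_norm ig).
split; first exact: (pair_dom_int mF n1 n2 dom).
rewrite (pair_dom_iter mF n1 n2 dom).
rewrite [RHS]mulrC -RintZ//; apply: eq_Rintegral => x _ /=.
by rewrite RintZ// mulrC.
Qed.

Lemma Rint_pair_swap (F : T * T -> R) (g1 g2 : T -> R) :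
  measurable_fun setT F -> integrableR P g1 -> integrableR P g2 ->
  (forall x y, `|F (x, y)| <= g1 x * g2 y) ->
  \int[PP]_z F (z.2, z.1) = \int[PP]_z F z.
Proof.
move=> mF i1 i2 dom.
have mF' : measurable_fun setT (fun z : T * T => F (z.2, z.1)).
  by apply: (measurableT_comp mF); apply: measurable_fun_pair.
have dom' x y : `|F ((x, y).2, (x, y).1)| <= g2 x * g1 y by rewrite mulrC dom.
by rewrite (pair_dom_iter mF i1 i2 dom) (pair_dom_iter_swap mF' i2 i1 dom').
Qed.

End IndependentCopies.

(** * Positive kernels *)

Section PositiveKernels.
Context d (T : measurableType d) (R : realType) (P : probability T R).
Local Notation PP := (square_prob P).

(** Positivity is tested on integrable functions, which are the signed measures
    [g dP] that occur as residuals; boundedness makes the form finite. *)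
Definition psd_kernel (K : T * T -> R) : Prop :=
  [/\ measurable_fun setT K, exists C, forall z, `|K z| <= C &
      forall g, integrableR P g -> 0 <= \int[PP]_z (g z.1 * g z.2 * K z)].

Lemma intR_quadratic (K : T * T -> R) (C : R) (g h : T -> R) :
  measurable_fun setT K -> (forall z, `|K z| <= C) ->
  integrableR P g -> integrableR P h ->
  integrableR PP (fun z => g z.1 * h z.2 * K z).
Proof.
move=> mK KC ig ih; apply: (intR_ext (fun z => mulrC _ _)).
by apply: (intR_bounded_mul mK KC); have [] := Rint_pair_prod ig ih.
Qed.

Lemma psd_kernel1 : psd_kernel (fun=> 1).
Proof.
split; [exact: measurable_cst|by exists 1 => z; rewrite normr1|].
move=> g ig; have [_ E] := Rint_pair_prod ig ig.
under eq_Rintegral do rewrite mulr1.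
by rewrite E -expr2 sqr_ge0.
Qed.

Lemma psd_kernel_scale (f : T -> R) (C : R) (K : T * T -> R) :
  measurable_fun setT f -> (forall x, `|f x| <= C) -> psd_kernel K ->
  psd_kernel (fun z => f z.1 * f z.2 * K z).
Proof.
move=> mf fC [mK [B KB] K0]; split.
- apply: measurable_funM => //; apply: measurable_funM.
  + exact: (measurableT_comp mf measurable_fst).
  + exact: (measurableT_comp mf measurable_snd).
- exists (C * C * B) => z; rewrite !normrM.
  by rewrite ler_pM ?mulr_ge0// ler_pM.
- move=> g ig.
  have := K0 _ (intR_bounded_mul mf fC ig).
  by congr (_ <= _); apply: eq_Rintegral => z _; ring.
Qed.

(** A superposition of positive kernels is positive: Fubini exchanges the
    quadratic form with the mixing measure. *)
Lemma psd_kernel_mixture dV (V : measurableType dV)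
    (nu : {sigma_finite_measure set V -> \bar R})
    (kappa : (T * T) * V -> R) (C : R) :
  measurable_fun setT kappa -> (forall z v, 0 <= kappa (z, v)) ->
  (forall v, psd_kernel (fun z => kappa (z, v))) ->
  (forall z, integrableR nu (fun v => kappa (z, v))) ->
  (forall z, \int[nu]_v kappa (z, v) <= C) ->
  psd_kernel (fun z => \int[nu]_v kappa (z, v)).
Proof.
move=> mk k0 kpsd ik kC.
have K0 z : 0 <= \int[nu]_v kappa (z, v) by apply: Rint_ge0.
split.
- apply: measurableT_comp => //.
  apply: (measurable_fun_fubini_tonelli_F (EFin \o kappa)).
  + exact/measurable_EFinP.
  + by move=> [z v]; rewrite /= lee_fin.
- by exists C => z; rewrite ger0_norm.
move=> g ig.
pose G (z : T * T) := g z.1 * g z.2.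
have [iG _] : integrableR PP G /\ _ := Rint_pair_prod ig ig.
pose F (y : (T * T) * V) := G y.1 * kappa y.
have mF : measurable_fun setT F.
  apply: measurable_funM => //.
  exact: (measurableT_comp (intR_meas iG) measurable_fst).
have sF z : integrableR nu (fun v => F (z, v)) := intRZ (G z) (ik z).
have iF : integrableR (PP \x nu)%E F.
  have iCG : integrableR PP (fun z => C * `|G z|) := intRZ C (intR_norm iG).
  refine (@intR_iterated _ _ _ _ _ PP nu F _ mF sF iCG _).
  move=> z; under eq_Rintegral do rewrite /F /= normrM (ger0_norm (k0 _ _)).
  by rewrite RintZ// mulrC ler_wpM2r.
have [_ E1] := Rint_Fubini sF iF.
have -> : \int[PP]_z (g z.1 * g z.2 * \int[nu]_v kappa (z, v)) =
          \int[PP]_z \int[nu]_v F (z, v).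
  by apply: eq_Rintegral => z _; rewrite -RintZ.
rewrite -E1 (Rint_Fubini_swap _ iF); last first.
  by move=> v; have [mkv [B kB] _] := kpsd v; exact: (intR_quadratic mkv kB ig ig).
by apply: Rint_ge0 => v; have [_ _] := kpsd v; exact.
Qed.

(** Positivity gives the Cauchy-Schwarz inequality, in the form tested against
    the constant function. *)
Lemma psd_kernel_CS (K : T * T -> R) (g : T -> R) : psd_kernel K ->
  (forall z, K (z.2, z.1) = K z) -> integrableR P g ->
  (\int[PP]_z (g z.1 * K z)) ^+ 2 <=
  \int[PP]_z K z * \int[PP]_z (g z.1 * g z.2 * K z).
Proof.
move=> [mK [C KC] K0] Ksym ig.
have i1 : integrableR P (fun=> 1 : R) := intR_cst P 1.
have igg := intR_quadratic mK KC ig ig.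
have ig1 : integrableR PP (fun z => g z.1 * K z).
  by apply: intR_ext (intR_quadratic mK KC ig i1) => z; rewrite mulr1.
have i1g : integrableR PP (fun z => g z.2 * K z).
  by apply: intR_ext (intR_quadratic mK KC i1 ig) => z; rewrite mul1r.
have i11 : integrableR PP K.
  by apply: intR_ext (intR_quadratic mK KC i1 i1) => z; rewrite !mul1r.
have Eg : \int[PP]_z (g z.2 * K z) = \int[PP]_z (g z.1 * K z).
  rewrite -(@Rint_pair_swap _ _ _ P (fun z => g z.1 * K z) (fun x => C * `|g x|)
    (fun=> 1)).
  - by apply: eq_Rintegral => z _; rewrite Ksym.
  - exact: intR_meas ig1.
  - by apply: intRZ; exact: intR_norm.
  - exact: intR_cst.
  - by move=> x y /=; rewrite normrM mulr1 mulrC ler_wpM2r.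
set A := \int[PP]_z K z; set B := \int[PP]_z (g z.1 * K z).
set D := \int[PP]_z _.
rewrite [leRHS]mulrC; apply: discriminant_le => [|t].
  have := K0 _ i1; congr (_ <= _).
  by apply: eq_Rintegral => z _; rewrite !mul1r.
have ih : integrableR P (fun x => g x + t * 1) by apply: intRD => //; exact: intRZ.
have := K0 _ ih; congr (_ <= _).
transitivity (\int[PP]_z ((g z.1 * g z.2 * K z + t * (g z.1 * K z)) +
   (t * (g z.2 * K z) + t ^+ 2 * K z))).
  by apply: eq_Rintegral => z _; ring.
rewrite RintD; [|by apply: intRD => //; apply: intRZ|by apply: intRD; apply: intRZ].
rewrite RintD ?RintD ?RintZ//; try exact: intRZ.
by rewrite Eg -/A -/B -/D; ring.
Qed.

End PositiveKernels.

Section LaplacianKernel.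
Context (R : realType).

(** The feature map of the Laplacian kernel: two cut-offs hold together exactly on
    [`]0, expR (2 * min x y)]], whose length cancels the prefactors up to
    [expR (- `|x - y|)]. *)
Definition exp_cut (x v : R) : R := expR (- x) * \1_`]0, expR (2 * x)] v.

Lemma exp_cut_ge0 x v : 0 <= exp_cut x v.
Proof. by rewrite mulr_ge0// expR_ge0. Qed.

Lemma exp_cutM x y v : exp_cut x v * exp_cut y v =
  expR (- (x + y)) * \1_`]0, expR (2 * Num.min x y)] v.
Proof.
rewrite /exp_cut mulrACA -expRD opprD; congr (_ * _).
rewrite -[RHS]/(\1__ v) !indicE -natrM mulnb; congr (_%:R); congr nat_of_bool.
rewrite !mem_setE !in_itv/= -/(in_mem _ _).
have [v0|v0] /= := boolP (0 < v); last by [].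
have [xy|yx] := leP x y.
- rewrite andb_idr// => /le_trans; apply; rewrite ler_expR; lra.
- rewrite andb_idl// => /le_trans; apply; rewrite ler_expR; lra.
Qed.

Lemma exp_cut_integral x y :
  integrableR (@lebesgue_measure R) (fun v => exp_cut x v * exp_cut y v) /\
  \int[@lebesgue_measure R]_v (exp_cut x v * exp_cut y v) = expR (- `|x - y|).
Proof.
have iI : integrableR (@lebesgue_measure R) \1_`]0, expR (2 * Num.min x y)].
  exact: integrable_indic_itv.
split; first by under eq_fun do rewrite exp_cutM; exact: intRZ.
under eq_Rintegral do rewrite exp_cutM.
set e := expR (2 * _).
have E : @lebesgue_measure R `]0%R, e]%classic = e%:E.
  by rewrite lebesgue_measure_itv/= lte_fin expR_gt0 sube0.
rewrite RintZ// /Rintegral integral_indic// setIT [X in fine X]E /= -expRD.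
congr expR.
by have [xy|yx] := leP x y; [rewrite ler0_norm|rewrite ger0_norm]; lra.
Qed.

Lemma measurable_exp_cut d' (U : measurableType d') (a b : U -> R) :
  measurable_fun setT a -> measurable_fun setT b ->
  measurable_fun setT (fun u => exp_cut (a u) (b u)).
Proof.
move=> ma mb; apply: measurable_funM.
  by apply: measurableT_comp => //; apply: measurableT_comp.
have -> : (fun u => \1_`]0, expR (2 * a u)] (b u) : R) =
  \1_[set u | (0 < b u) && (b u <= expR (2 * a u))].
  by apply/funext => z; rewrite !indicE; congr (_%:R); congr nat_of_bool;
    apply/idP/idP; rewrite !inE /= in_itv.
apply: measurable_indic.
have mc : measurable_fun setT (fun u => (0 < b u) && (b u <= expR (2 * a u))).
  apply: measurable_and; first exact: measurable_fun_ltr.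
  apply: measurable_fun_ler => //; apply: measurableT_comp => //.
  exact: measurable_funM.
by have := mc measurableT [set true] I; rewrite setTI.
Qed.

Lemma exp_cut_bound x v : 0 < v -> exp_cut x v <= (Num.sqrt v)^-1.
Proof.
move=> v0; rewrite /exp_cut indicE; have [|_] := boolP (v \in _); last first.
  by rewrite mulr0 invr_ge0 sqrtr_ge0.
rewrite mem_setE /= in_itv/= v0/= => ve; rewrite mulr1 expRN.
rewrite lef_pV2 ?posrE ?expR_gt0 ?sqrtr_gt0//.
rewrite -[leRHS]ger0_norm ?expR_ge0// -sqrtr_sqr ler_wsqrtr//.
by rewrite -expRM_natl.
Qed.

Context d (T : measurableType d) (P : probability T R).

(** Multiplying a nonnegative positive kernel by a Laplacian one: in the mixture
    over [v], the factors [exp_cut (f x) v] only rescale the test functions. *)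
Lemma psd_kernel_exp (f : T -> R) (K : T * T -> R) :
  measurable_fun setT f -> psd_kernel P K -> (forall z, 0 <= K z) ->
  psd_kernel P (fun z => expR (- `|f z.1 - f z.2|) * K z).
Proof.
move=> mf Kpsd K0; have [mK [C KC] _] := Kpsd.
pose kappa (y : (T * T) * measurableTypeR R) :=
  exp_cut (f y.1.1) y.2 * exp_cut (f y.1.2) y.2 * K y.1.
have E z : integrableR (@lebesgue_measure R) (fun v => kappa (z, v)) /\
   \int[@lebesgue_measure R]_v kappa (z, v) = expR (- `|f z.1 - f z.2|) * K z.
  have [i e] := exp_cut_integral (f z.1) (f z.2).
  rewrite -e mulrC -RintZ//; split.
    by apply: intR_ext (intRZ (K z) i) => v; rewrite mulrC.
  by apply: eq_Rintegral => v _; rewrite mulrC.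
have -> : (fun z => expR (- `|f z.1 - f z.2|) * K z) =
    (fun z => \int[@lebesgue_measure R]_v kappa (z, v)).
  by apply/funext => z; have [_ ->] := E z.
apply: (@psd_kernel_mixture _ _ _ _ _ _ _ _ C).
- have m1 : measurable_fun setT (fun y : (T * T) * measurableTypeR R => f y.1.1).
    apply: (measurableT_comp mf).
    exact: (measurableT_comp measurable_fst measurable_fst).
  have m2 : measurable_fun setT (fun y : (T * T) * measurableTypeR R => f y.1.2).
    apply: (measurableT_comp mf).
    exact: (measurableT_comp measurable_snd measurable_fst).
  have m3 : measurable_fun setT (fun y : (T * T) * measurableTypeR R => K y.1).
    exact: (measurableT_comp mK measurable_fst).
  have mv : measurable_fun setT (fun y : (T * T) * measurableTypeR R => y.2).
    exact: measurable_snd.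
  apply: measurable_funM m3.
  exact: measurable_funM (measurable_exp_cut m1 mv) (measurable_exp_cut m2 mv).
- by move=> z v; rewrite /kappa !mulr_ge0 ?exp_cut_ge0.
(* the feature vanishes for [v <= 0] and is bounded by [(sqrt v)^-1] otherwise *)
- move=> v; have [v0|v0] := leP v 0.
    have -> : (fun z => kappa (z, v)) = (fun z => 0 * 0 * K z).
      apply/funext => z; rewrite /kappa /exp_cut /= !indicE !memNset ?mulr0//=.
        by rewrite in_itv/= ltNge v0.
      by rewrite in_itv/= ltNge v0.
    by apply: (@psd_kernel_scale _ _ _ P (fun=> 0) 0) => //; move=> ?; rewrite normr0.
  apply: (@psd_kernel_scale _ _ _ P (fun x => exp_cut (f x) v) (Num.sqrt v)^-1) => //.
  + exact: measurable_exp_cut.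
  + by move=> x; rewrite ger0_norm ?exp_cut_ge0// exp_cut_bound.
- by move=> z; have [] := E z.
- move=> z; have [_ ->] := E z.
  rewrite -[leRHS]mul1r ler_pM ?expR_ge0// ?expR_le1 ?oppr_le0//.
  by apply: le_trans (KC z); exact: ler_norm.
Qed.

Lemma psd_kernel_laplacian p (f : 'I_p -> T -> R) :
  (forall i, measurable_fun setT (f i)) ->
  psd_kernel P (fun z => expR (- \sum_(i < p) `|f i z.1 - f i z.2|)).
Proof.
move=> mf.
have -> : (fun z => expR (- \sum_(i < p) `|f i z.1 - f i z.2|)) =
    (fun z => \prod_(i <- enum 'I_p) expR (- `|f i z.1 - f i z.2|)).
  by apply/funext => z; rewrite big_enum/= -expR_sum sumrN.
elim: (enum 'I_p) => [|i s IH].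
  by under eq_fun do rewrite big_nil; exact: psd_kernel1.
under eq_fun do rewrite big_cons.
by apply: psd_kernel_exp => // z; apply: prodr_ge0 => j _; exact: expR_ge0.
Qed.

End LaplacianKernel.

(** * Continuous functions of vectors and orthogonality *)

Section ContinuousOfVector.
Context d (T : measurableType d) (R : realType) (p : nat).

Definition l1_continuous (f : 'rV[R]_p -> R) : Prop :=
  forall x (e : R), 0 < e -> exists2 r, 0 < r &
    forall y, l1norm (y - x) < r -> `|f y - f x| < e.

Lemma measurable_floor_fiber (z : T -> R) (k : int) : measurable_fun setT z ->
  measurable [set w | Num.floor (z w) = k].
Proof.
move=> mz.
have mc : measurable_fun setT (fun w => (k%:~R <= z w) && (z w < (k + 1)%:~R)).
  apply: measurable_and; first exact: measurable_fun_ler.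
  exact: measurable_fun_ltr.
have := mc measurableT [set true] I; rewrite setTI; congr measurable.
apply/seteqP; split => w /=; first exact: Num.Theory.floor_def.
by move=> <-; exact: Num.Theory.floor_itv.
Qed.

(** Rounding the coordinates to a grid makes the vector countably valued, and each
    of its values is taken on a measurable cell; the rounded compositions converge
    as the grid is refined. *)
Lemma measurable_l1_continuous_comp (f : 'rV[R]_p -> R) (z : 'I_p -> T -> R) :
  l1_continuous f -> (forall j, measurable_fun setT (z j)) ->
  measurable_fun setT (fun w => f (\row_j z j w)).
Proof.
move=> cf mz.
pose grid (n : nat) (v : {ffun 'I_p -> int}) : 'rV[R]_p :=
  \row_j ((v j)%:~R / n.+1%:R).
pose cell n w : {ffun 'I_p -> int} := [ffun j => Num.floor (n.+1%:R * z j w)].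
apply: (@measurable_fun_cvg _ _ _ _ (fun n w => f (grid n (cell n w)))).
  move=> n _ B mB; rewrite setTI.
  rewrite (_ : _ @^-1` B = \bigcup_(v in [set: {ffun 'I_p -> int}])
      [set w | cell n w = v /\ B (f (grid n v))]); last first.
    by apply/seteqP; split => [w Bw|w [v _ [<-]]//]; exists (cell n w).
  apply: countable_bigcupT_measurable => // v.
  have [Bv|nBv] := pselect (B (f (grid n v))); last first.
    rewrite (_ : [set w | _] = set0) //; last by apply/seteqP; split => w // -[].
  rewrite (_ : [set w | _] = \bigcap_(j in [set: 'I_p])
      [set w | Num.floor (n.+1%:R * z j w) = v j]); last first.
    apply/seteqP; split => [w [<- _] j _|w cw]; first by rewrite /= ffunE.
    by split => //; apply/ffunP => j; rewrite ffunE; exact: cw.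
  apply: fin_bigcap_measurable => [|j _]; first exact: finite_finset.
  by apply: measurable_floor_fiber; exact: measurable_funM.
move=> w _; apply/cvgrPdist_lt => e e0.
have [r r0 fr] := cf (\row_j z j w) e e0.
have r1 : 0 < r / (p%:R + 1) by rewrite divr_gt0// ltr_wpDl.
have /cvgrPdist_lt/(_ _ r1) := @cvg_harmonic R; apply: filterS => n; rewrite /harmonic sub0r normrN => hn.
rewrite distrC; apply: fr.
have {}hn : n.+1%:R^-1 < r / (p%:R + 1) by rewrite (le_lt_trans (ler_norm _) hn).
apply: (@le_lt_trans _ _ (\sum_(j < p) n.+1%:R^-1)).
  apply: ler_sum => j _; rewrite !mxE /cell ffunE.
  have /andP[lo hi] := Num.Theory.floor_itv (n.+1%:R * z j w).
  have n0 : 0 < n.+1%:R :> R by [].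
  set k := (Num.floor _)%:~R in lo hi *.
  have hi' : n.+1%:R * z j w < k + 1 by rewrite intrD in hi.
  rewrite ler0_norm; last by rewrite subr_le0 ler_pdivrMr// mulrC.
  rewrite opprB lerBlDr -[X in X + _]mul1r -mulrDl ler_pdivlMr// mulrC addrC; exact: ltW.
rewrite sumr_const card_ord -[_ *+ p]mulr_natl.
apply: (@le_lt_trans _ _ ((p%:R + 1) * n.+1%:R^-1)); last first.
  by rewrite mulrC -ltr_pdivlMr// ltr_wpDl.
by rewrite ler_wpM2r ?invr_ge0// lerDl.
Qed.

End ContinuousOfVector.

Section Orthogonality.
Context d (T : measurableType d) (R : realType) (P : probability T R).

(** The layer-cake identity [z = int_0^oo 1{v <= z} dv] reduces integration
    against [Z] to integration over its upper level sets. *)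
Lemma Rint_layer_cake0 (eta Z : T -> R) : measurable_fun setT Z ->
  integrableR P eta -> integrableR P (fun w => eta w * Z w) ->
  (forall v, 0 < v -> \int[P]_w (eta w * \1_[set w | v <= Z w] w) = 0) ->
  \int[P]_w (eta w * Num.max (Z w) 0) = 0.
Proof.
move=> mZ ie ieZ lev.
pose F (y : T * measurableTypeR R) : R :=
  eta y.1 * \1_[set y : T * measurableTypeR R | (0 < y.2) && (y.2 <= Z y.1)] y.
have mS : measurable [set y : T * measurableTypeR R | (0 < y.2) && (y.2 <= Z y.1)].
  have mc : measurable_fun setT
     (fun y : T * measurableTypeR R => (0 < y.2) && (y.2 <= Z y.1)).
    apply: measurable_and; first by apply: measurable_fun_ltr; [|exact: measurable_snd].
    apply: measurable_fun_ler; first exact: measurable_snd.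
    exact: (measurableT_comp mZ measurable_fst).
  by have := mc measurableT [set true] I; rewrite setTI.
have mF : measurable_fun setT F.
  apply: measurable_funM; last exact: measurable_indic.
  exact: (measurableT_comp (intR_meas ie) measurable_fst).
have FE w v : F (w, v) = eta w * \1_`]0, Num.max (Z w) 0] v.
  rewrite /F !indicE; congr (_ * _%:R); congr nat_of_bool.
  apply/idP/idP; rewrite !inE /= in_itv /= le_max; first by move=> /andP[-> ->].
  by move=> /andP[v0 /orP[->|]]; [rewrite v0|rewrite leNgt v0].
have iI w : integrableR (@lebesgue_measure R) \1_`]0, Num.max (Z w) 0].
  exact: integrable_indic_itv.
have EI w : \int[@lebesgue_measure R]_v \1_`]0, Num.max (Z w) 0] v = Num.max (Z w) 0.
  have E : @lebesgue_measure R `]0%R, Num.max (Z w) 0]%classic = (Num.max (Z w) 0)%:E.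
    rewrite lebesgue_measure_itv/= lte_fin sube0; case: ltP => //.
    by move=> h; congr EFin; apply/le_anti; rewrite h le_max lexx orbT.
  by rewrite /Rintegral integral_indic// setIT [X in fine X]E.
have sF w : integrableR (@lebesgue_measure R) (fun v => F (w, v)).
  by apply: intR_ext (intRZ (eta w) (iI w)) => v; rewrite FE.
have iF : integrableR (P \x @lebesgue_measure R)%E F.
  refine (@intR_iterated _ _ _ _ _ P (@lebesgue_measure R) F _ mF sF
    (intR_norm ieZ) _) => w.
  under eq_Rintegral do rewrite FE normrM [`|\1__ _|]ger0_norm//.
  rewrite RintZ// EI normrM ler_wpM2l//.
  by rewrite ge_max ler_norm normr_ge0.
have [_ E1] := Rint_Fubini sF iF.
transitivity (\int[P]_w \int[@lebesgue_measure R]_v F (w, v)).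
  apply: eq_Rintegral => w _; under [RHS]eq_Rintegral do rewrite FE.
  by rewrite RintZ// EI.
rewrite -E1 (Rint_Fubini_swap _ iF); last first.
  move=> v; apply: intR_le (intR_norm ie); first exact: measurable_slice2.
  move=> w; rewrite FE normrM -[leRHS]mulr1 ler_wpM2l// indicE.
  by case: (_ \in _); rewrite ?normr0 ?normr1.
apply: Rint_eq0 => v; have [v0|v0] := ltP 0 v; last first.
  by apply: Rint_eq0 => w; rewrite /F indicE memNset ?mulr0//= ltNge v0.
rewrite -[RHS](lev v v0); apply: eq_Rintegral => w _.
rewrite /F !indicE; congr (_ * _%:R); congr nat_of_bool.
by apply/idP/idP; rewrite !inE /= v0.
Qed.

(** The positive and the negative part of [Z] are treated by the layer-cake
    identity; [eta * Z] is only assumed integrable, so [Z] may be unbounded. *)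
Lemma Rint_orthogonal (eta Z : T -> R) : measurable_fun setT Z ->
  integrableR P eta -> integrableR P (fun w => eta w * Z w) ->
  (forall C : set R, measurable C -> \int[P]_w (eta w * \1_(Z @^-1` C) w) = 0) ->
  \int[P]_w (eta w * Z w) = 0.
Proof.
move=> mZ ie ieZ lev.
have ieZm (W : T -> R) : measurable_fun setT W -> (forall w, `|W w| <= `|Z w|) ->
    integrableR P (fun w => eta w * W w).
  move=> mW WZ; apply: (intR_le _ _ (intR_norm ieZ)).
    by apply: measurable_funM => //; exact: intR_meas ie.
  by move=> w; rewrite !normrM ler_wpM2l.
have mN : measurable_fun setT (fun w => - Z w) by exact: measurableT_comp.
have E w : eta w * Z w =
    eta w * Num.max (Z w) 0 - eta w * Num.max (- Z w) 0.
  rewrite -mulrBr; congr (_ * _).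
  by case: (leP (Z w) 0) => h; case: (leP (- Z w) 0) => h'; lra.
under eq_Rintegral do rewrite E.
rewrite RintB.
- rewrite !Rint_layer_cake0 ?subr0//.
  + by apply: intR_ext (intRN ieZ) => w; rewrite mulrN.
  + move=> v v0; have := lev `]-oo, - v]%classic.
    move=> /(_ (measurable_itv _)) <-.
    apply: eq_Rintegral => w _; rewrite !indicE; congr (_ * _%:R); congr nat_of_bool.
    by apply/idP/idP; rewrite !inE /= in_itv /= lerNr.
  + move=> v v0; have := lev `[v, +oo[%classic.
    move=> /(_ (measurable_itv _)) <-.
    apply: eq_Rintegral => w _; rewrite !indicE; congr (_ * _%:R); congr nat_of_bool.
    by apply/idP/idP; rewrite !inE /= in_itv /= andbT.
- apply: ieZm; first exact: measurable_maxr.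
  by move=> w; rewrite ger0_norm ?le_max ?lexx ?orbT// ge_max ler_norm/=.
- apply: ieZm; first exact: measurable_maxr.
  move=> w; rewrite ger0_norm ?le_max ?lexx ?orbT// ge_max -normrN ler_norm/=.
  by [].
Qed.

End Orthogonality.

(** * Laplace transforms of measures on the half-line *)

Section MeasureSupport.
Context (R : realType) (mu : {measure set (measurableTypeR R) -> \bar R}).

(** The complement of the support is covered by the countably many null
    intervals with rational end points. *)
Lemma negligible_support_compl : mu.-negligible (~` measure_support mu).
Proof.
pose F (n : nat) : set (measurableTypeR R) := if unpickle n is Some qr then
  (if pselect (mu.-negligible `](ratr (qr : rat * rat).1 : R), ratr qr.2[%classic)
   then `](ratr qr.1 : R), ratr qr.2[%classic else set0) else set0.
apply: (negligibleS (A := \bigcup_n F n)); last first.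
  apply: negligible_bigcup => n; rewrite /F; case: unpickle => [qr|].
    by case: pselect => b //=; exact: negligible_set0.
  exact: negligible_set0.
move=> x /= /existsNP[U] /not_implyP[oU] /not_implyP[Ux /negP].
rewrite -leNgt => U0.
have {}U0 : mu U = 0%E by apply/le_anti; rewrite U0 measure_ge0.
have [e /= e0 eU] : \forall r \near 0^'+, `]x - r, x + r[ `<=` U.
  exact: open_itvoo_subset.
have e20 : 0 < e / 2 by rewrite divr_gt0.
have {}eU : `]x - e / 2, x + e / 2[ `<=` U.
  apply: eU => //=; rewrite sub0r normrN gtr0_norm//; lra.
have /rat_in_itvoo[q /itvP qx] : x - e / 2 < x by lra.
have /rat_in_itvoo[r /itvP xr] : x < x + e / 2 by lra.
exists (pickle (q, r)); first exact: I.
rewrite /F pickleK.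
case: pselect => [b|]; first by rewrite /= in_itv/= qx xr.
case; exists U; split => //; first exact: open_measurable.
move=> y /=; rewrite in_itv/= => /andP[qy yr]; apply: eU; rewrite /= in_itv/=.
by rewrite (lt_trans _ qy) ?qx// (lt_trans yr)// xr.
Qed.

End MeasureSupport.

Section ExpTaylor.
Context (R : realType).

(** The second derivative of [expR (- x)] is at most 1 on the half-line; the proof
    rests on [1 + x <= expR x] at [a - b] and at [b - a]. *)
Lemma expRN_taylor2 (a b : R) : 0 <= a -> 0 <= b ->
  `|expR (- a) - expR (- b) + expR (- b) * (a - b)| <= (a - b) ^+ 2.
Proof.
move=> a0 b0.
have eb : expR (- b) <= 1 by rewrite expR_le1 oppr_le0.
have ea : expR (- a) <= 1 by rewrite expR_le1 oppr_le0.
have [eb0 ea0] := (expR_gt0 (- b), expR_gt0 (- a)).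
have E : expR (- a) = expR (- b) * expR (- (a - b)).
  by rewrite -expRD; congr expR; lra.
have E' : expR (- b) = expR (- a) * expR (a - b).
  by rewrite -expRD; congr expR; lra.
have l1 := expR_ge1Dx (- (a - b)).
have l2 := expR_ge1Dx (a - b).
have g1 := expR_gt0 (- (a - b)).
have inv : expR (a - b) * expR (- (a - b)) = 1 by rewrite expRxMexpNx_1.
rewrite ger0_norm; last by rewrite E; nra.
have [ab|/ltW ba] := leP b a.
- rewrite E.
  have : expR (- (a - b)) * (1 + (a - b)) <= 1.
    by have := ler_wpM2r (ltW g1) l2; rewrite inv mulrC.
  set x := a - b in l1 l2 g1 inv *; have x0 : 0 <= x by rewrite /x subr_ge0.
  set y := expR (- x) => xy.
  have key : y - 1 + x <= x ^+ 2.
    have : (y - 1 + x) * (1 + x) <= x ^+ 2 by nra.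
    have : 0 <= y - 1 + x by rewrite -/y in l1; lra.
    nra.
  have : 0 <= y - 1 + x by rewrite -/y in l1; lra.
  nra.
- rewrite E'.
  set x := a - b in l1 l2 g1 inv *; have x0 : x <= 0 by rewrite /x subr_le0.
  set y := expR x in l2 *.
  have y0 : 0 < y by exact: expR_gt0.
  have key : 1 - y + y * x <= x ^+ 2 by nra.
  have [|] := leP 0 (1 - y + y * x); nra.
Qed.

Lemma expRN_lip (a b : R) : 0 <= a -> 0 <= b ->
  `|expR (- a) - expR (- b)| <= `|a - b|.
Proof.
wlog ab : a b / a <= b.
  move=> h a0 b0; have [|/ltW] := leP a b => ab; first exact: h.
  by rewrite distrC [leRHS]distrC; exact: h.
move=> a0 b0.
rewrite ger0_norm ?subr_ge0 ?ler_expR ?lerN2// ler0_norm ?subr_le0//.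
have ea : expR (- a) <= 1 by rewrite expR_le1 oppr_le0.
have E : expR (- b) = expR (- a) * expR (- (b - a)).
  by rewrite -expRD; congr expR; lra.
have := expR_ge1Dx (- (b - a)); have := expR_gt0 (- a); rewrite E; nra.
Qed.

End ExpTaylor.

Section LaplaceTransform.
Context (R : realType) (mu : {finite_measure set (measurableTypeR R) -> \bar R})
  (Mmu : R).
Hypothesis hk : l1_kernel_measure mu Mmu.

Definition mass : R := fine (mu setT).

(** Minus the derivative of [laplace mu]. *)
Definition laplace_slope (u : R) : R :=
  \int[mu]_t (\1_`[0, Mmu] t * t * expR (- (t * u))).

Lemma mass_ge0 : 0 <= mass. Proof. exact: fine_ge0. Qed.

(** The measure lives on [0, Mmu]: integrals are written with the cut-off
    [\1_`[0, Mmu]], under which [t] and the exponential are bounded. *)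
Lemma support_ae : {ae mu, forall t, t \in `[0, Mmu]%classic}.
Proof.
apply: negligibleS (negligible_support_compl mu) => t /=; apply: contra_not.
by move=> /(kmeas_supp hk) h; rewrite inE.
Qed.

(** The measure charges the open half-line, hence a point of its support is
    positive. *)
Lemma Mmu_gt0 : 0 < Mmu.
Proof.
rewrite ltNge; apply/negP => M0; have := kmeas_pos hk; rewrite lt0e => /andP[/eqP + _].
apply; apply: measure_negligible => //.
apply: negligibleS support_ae => t /=; rewrite in_itv/= andbT => t0.
rewrite inE /= in_itv/= => /andP[_ tM].
by have := lt_le_trans t0 (le_trans tM M0); rewrite ltxx.
Qed.

Lemma cut_range t : \1_`[0, Mmu] t * t = \1_`[0, Mmu] t * Num.min `|t| Mmu :> R.
Proof.
rewrite indicE; have [|] := boolP (_ \in _); last by rewrite !mul0r.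
rewrite inE /= in_itv/= => /andP[t0 tM]; rewrite !mul1r ger0_norm//.
by case: leP tM.
Qed.

Lemma measurable_cut (w : R -> R) (u : R) : measurable_fun setT w ->
  measurable_fun setT (fun t : measurableTypeR R =>
    \1_`[0, Mmu] t * w t * expR (- (t * u))).
Proof.
move=> mw; apply: measurable_funM.
  by apply: measurable_funM => //; apply: measurable_indic.
apply: measurableT_comp => //; apply: measurableT_comp => //.
exact: measurable_funM.
Qed.

Lemma cut_le (w : R -> R) (C u t : R) : 0 <= u -> 0 <= C ->
  (forall t, 0 <= t -> t <= Mmu -> `|w t| <= C) ->
  `|\1_`[0, Mmu] t * w t * expR (- (t * u))| <= C.
Proof.
move=> u0 C0 wC; rewrite indicE; have [|] := boolP (_ \in _); last first.
  by rewrite !mul0r normr0.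
rewrite inE /= in_itv/= => /andP[t0 tM]; rewrite mul1r normrM -[C]mulr1.
by rewrite ler_pM// ?wC// ger0_norm ?expR_ge0// expR_le1 oppr_le0 mulr_ge0.
Qed.

Lemma cut_int (w : R -> R) (C u : R) : measurable_fun setT w -> 0 <= u -> 0 <= C ->
  (forall t, 0 <= t -> t <= Mmu -> `|w t| <= C) ->
  integrableR mu (fun t => \1_`[0, Mmu] t * w t * expR (- (t * u))).
Proof.
move=> mw u0 C0 wC; apply: (@intR_bounded _ _ _ mu C).
  exact: measurable_cut.
by move=> t; exact: cut_le.
Qed.

Lemma cut_Rint_le (w : R -> R) (C u : R) : measurable_fun setT w -> 0 <= u -> 0 <= C ->
  (forall t, 0 <= t -> t <= Mmu -> `|w t| <= C) ->
  \int[mu]_t (\1_`[0, Mmu] t * w t * expR (- (t * u))) <= C * mass.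
Proof.
move=> mw u0 C0 wC; rewrite /mass -Rintegral_cst//.
apply: Rint_le; [exact: cut_int wC|exact: intR_cst|].
by move=> t; apply: le_trans (ler_norm _) (cut_le _ _ _ _).
Qed.

Lemma laplaceE u : 0 <= u ->
  laplace mu u = \int[mu]_t (\1_`[0, Mmu] t * 1 * expR (- (t * u))).
Proof.
move=> u0; rewrite /laplace Rintegral_mkcond; apply: Rint_ae_eq.
- apply/(measurable_restrictT _ _).1 => //; apply: measurable_funTS.
  apply: measurableT_comp => //; apply: measurableT_comp => //.
  exact: measurable_funM.
- by apply: measurable_cut.
- apply: (@filterS _ _ (ae_filter_ringOfSetsType mu) _ _ _ support_ae) => t tM; rewrite patchE indicE tM mulr1 mul1r.
  rewrite ifT// inE /=; move: tM; rewrite inE /= !in_itv/= andbT.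
  by case/andP.
Qed.

Lemma laplace_int u : 0 <= u ->
  integrableR mu (fun t => \1_`[0, Mmu] t * 1 * expR (- (t * u))).
Proof. by move=> u0; apply: (@cut_int (fun=> 1) 1) => // t _ _; rewrite normr1. Qed.

Lemma slope_int u : 0 <= u ->
  integrableR mu (fun t => \1_`[0, Mmu] t * t * expR (- (t * u))).
Proof.
move=> u0; apply: (@cut_int id Mmu) => //; first exact: (ltW Mmu_gt0).
by move=> t t0 tM; rewrite ger0_norm.
Qed.

Lemma laplace_ge0 u : 0 <= u -> 0 <= laplace mu u.
Proof.
by move=> u0; rewrite laplaceE//; apply: Rint_ge0 => t; rewrite !mulr_ge0// expR_ge0.
Qed.

Lemma laplace_le u : 0 <= u -> laplace mu u <= mass.
Proof.
move=> u0; rewrite laplaceE// -[mass]mul1r.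
by apply: cut_Rint_le => // t _ _; rewrite normr1.
Qed.

Lemma slope_ge0 u : 0 <= laplace_slope u.
Proof.
apply: Rint_ge0 => t; rewrite cut_range !mulr_ge0// ?expR_ge0//.
by rewrite le_min normr_ge0 ltW ?Mmu_gt0.
Qed.

Lemma slope_le u : 0 <= u -> laplace_slope u <= Mmu * mass.
Proof.
move=> u0; apply: (@cut_Rint_le id) => //; first exact: (ltW Mmu_gt0).
by move=> t t0 tM; rewrite ger0_norm.
Qed.

Lemma slope_decr u v : 0 <= u -> u <= v -> laplace_slope v <= laplace_slope u.
Proof.
move=> u0 uv; apply: Rint_le; [exact/slope_int/(le_trans u0)|exact: slope_int|].
move=> t; rewrite indicE; have [|] := boolP (_ \in _); last by rewrite !mul0r.
rewrite inE /= in_itv/= => /andP[t0 tM]; rewrite mul1r ler_wpM2l// ler_expR lerN2.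
exact: ler_wpM2l.
Qed.

Lemma laplace_taylor u v : 0 <= u -> 0 <= v ->
  `|laplace mu u - laplace mu v + laplace_slope v * (u - v)|
  <= Mmu ^+ 2 * mass * (u - v) ^+ 2.
Proof.
move=> u0 v0; rewrite !laplaceE// mulrC -RintZ; last exact: slope_int.
rewrite -RintB; [|exact: laplace_int|exact: laplace_int].
rewrite -RintD; [|by apply: intRB; exact: laplace_int|by apply: intRZ; exact: slope_int].
rewrite mulrAC -Rintegral_cst//.
apply: Rint_norm_le.
- apply: intRD; first by apply: intRB; exact: laplace_int.
  by apply: intRZ; exact: slope_int.
- exact: intR_cst.
move=> t; rewrite indicE; have [|_] := boolP (_ \in _); last first.
  by rewrite !mul0r subr0 mulr0 addr0 normr0 mulr_ge0// sqr_ge0.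
rewrite inE /= in_itv/= => /andP[t0 tM]; rewrite !mul1r.
have := expRN_taylor2 (mulr_ge0 t0 u0) (mulr_ge0 t0 v0); rewrite -mulrBr.
have -> : (u - v) * (t * expR (- (t * v))) = expR (- (t * v)) * (t * (u - v)) by ring.
move=> /le_trans; apply; rewrite exprMn ler_wpM2r ?sqr_ge0//.
by rewrite ler_pXn2r// nnegrE// (le_trans t0 tM).
Qed.

Lemma laplace_lip u v : 0 <= u -> 0 <= v ->
  `|laplace mu u - laplace mu v| <= Mmu * mass * `|u - v|.
Proof.
move=> u0 v0; rewrite !laplaceE// -RintB; [|exact: laplace_int|exact: laplace_int].
rewrite mulrAC -Rintegral_cst//.
apply: Rint_norm_le; [|exact: intR_cst|].
  by apply: intRB; exact: laplace_int.
move=> t; rewrite indicE; have [|_] := boolP (_ \in _); last first.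
  by rewrite !mul0r subr0 normr0 mulr_ge0// ltW ?Mmu_gt0.
rewrite inE /= in_itv/= => /andP[t0 tM]; rewrite !mul1r.
have := expRN_lip (mulr_ge0 t0 u0) (mulr_ge0 t0 v0); rewrite -mulrBr.
by move=> /le_trans; apply; rewrite normrM ger0_norm// ler_wpM2r.
Qed.

Lemma slope_lip u v : 0 <= u -> 0 <= v ->
  `|laplace_slope u - laplace_slope v| <= Mmu ^+ 2 * mass * `|u - v|.
Proof.
move=> u0 v0; rewrite /laplace_slope -RintB; [|exact: slope_int|exact: slope_int].
rewrite mulrAC -Rintegral_cst//.
apply: Rint_norm_le; [|exact: intR_cst|].
  by apply: intRB; exact: slope_int.
move=> t; rewrite indicE; have [|_] := boolP (_ \in _); last first.
  by rewrite !mul0r subr0 normr0 mulr_ge0// sqr_ge0.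
rewrite inE /= in_itv/= => /andP[t0 tM]; rewrite !mul1r -mulrBr normrM ger0_norm//.
have := expRN_lip (mulr_ge0 t0 u0) (mulr_ge0 t0 v0); rewrite -mulrBr normrM ger0_norm//.
move=> h; rewrite expr2 -mulrA ler_pM//.
by apply: (le_trans h); rewrite ler_wpM2r.
Qed.

(** A vanishing slope would confine the measure to the origin. *)
Lemma slope_gt0 u : 0 <= u -> 0 < laplace_slope u.
Proof.
move=> u0; rewrite lt_neqAle slope_ge0 andbT; apply/negP => /eqP E.
have : (\int[mu]_t `|(\1_`[0, Mmu] t * t * expR (- (t * u)))%:E| = 0)%E.
  under eq_integral.
    move=> t _; rewrite gee0_abs; last first.
      by rewrite lee_fin cut_range !mulr_ge0// ?expR_ge0// le_min normr_ge0 ltW ?Mmu_gt0.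
    over.
  by rewrite -EFin_Rint ?(slope_int u0)// -[X in X%:E]/(laplace_slope u) -E.
move/(ae_eq_integral_abs mu measurableT _).1 => h.
have {}h : {ae mu, forall t, \1_`[0, Mmu] t * t * expR (- (t * u)) = 0}.
  have mf := intR_meas (slope_int u0).
  by apply: filterS (h _) => [t /(_ I)[]//|]; exact/measurable_EFinP.
have := kmeas_pos hk; rewrite lt0e => /andP[/eqP + _]; apply.
apply: measure_negligible => //.
have n1 : mu.-negligible (~` [set t | \1_`[0, Mmu] t * t * expR (- (t * u)) = 0]) := h.
have n2 : mu.-negligible (~` [set t | t \in `[0, Mmu]%classic]) := support_ae.
apply: negligibleS (negligibleU n1 n2) => t /=; rewrite in_itv/= andbT => t0.
have [tM|] := boolP (t \in `[0, Mmu]%classic); last by right; apply/negP.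
left => /eqP; rewrite indicE tM mul1r.
by rewrite mulf_eq0 gt_eqF//= gt_eqF// expR_gt0.
Qed.

Context d (T : measurableType d) (P : probability T R) (p : nat).

(** Each [expR (- t * N)] is a product of one-dimensional Laplacian kernels;
    superposing them over [t] with a nonnegative weight keeps positivity. *)
Lemma psd_kernel_weighted_laplace (w : R -> R) (C : R) (f : 'I_p -> T -> R) :
  measurable_fun setT w -> 0 <= C ->
  (forall t, 0 <= t -> t <= Mmu -> 0 <= w t <= C) ->
  (forall i, measurable_fun setT (f i)) ->
  psd_kernel P (fun z => \int[mu]_t
    (\1_`[0, Mmu] t * w t * expR (- (t * \sum_(i < p) `|f i z.1 - f i z.2|)))).
Proof.
move=> mw C0 wC mf.
pose N (z : T * T) := \sum_(i < p) `|f i z.1 - f i z.2|.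
have mN : measurable_fun setT N.
  apply: measurable_sum => i; apply: measurableT_comp => //.
  apply: measurable_funB.
  - exact: (measurableT_comp (mf i) measurable_fst).
  - exact: (measurableT_comp (mf i) measurable_snd).
have N0 z : 0 <= N z by apply: sumr_ge0.
have wC' t : 0 <= t -> t <= Mmu -> `|w t| <= C.
  by move=> t0 tM; have /andP[w0 w1] := wC t t0 tM; rewrite ger0_norm.
have cw0 t : 0 <= \1_`[0, Mmu] t * w t :> R.
  rewrite indicE; have [|] := boolP (_ \in _); last by rewrite mul0r.
  by rewrite inE /= in_itv/= mul1r => /andP[t0 tM]; have /andP[] := wC t t0 tM.
pose kappa (y : (T * T) * measurableTypeR R) :=
  \1_`[0, Mmu] y.2 * w y.2 * expR (- (y.2 * N y.1)).
apply: (@psd_kernel_mixture _ _ _ P _ _ mu kappa (C * mass)).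
- have m1 : measurable_fun setT (fun y : (T * T) * measurableTypeR R => N y.1).
    exact: (measurableT_comp mN measurable_fst).
  have m2 : measurable_fun setT (fun y : (T * T) * measurableTypeR R => y.2 : R).
    exact: measurable_snd.
  have m3 : measurable_fun setT (fun t : measurableTypeR R => \1_`[0, Mmu] t * w t).
    by apply: measurable_funM => //; exact: measurable_indic.
  apply: measurable_funM; first exact: (measurableT_comp m3 measurable_snd).
  by apply: measurableT_comp => //; apply: measurableT_comp => //; exact: measurable_funM.
- by move=> z t; rewrite /kappa mulr_ge0 ?expR_ge0.
- move=> t; have [t0|t0] := leP 0 t; last first.
    have -> : (fun z => kappa (z, t)) = (fun z => 0 * 0 * 1).
      apply/funext => z; rewrite /kappa /= indicE memNset ?mul0r//=.
      by rewrite in_itv/= leNgt t0.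
    by apply: (@psd_kernel_scale _ _ _ P (fun=> 0) 0);
      [|move=> ?; rewrite normr0|exact: psd_kernel1].
  pose s := Num.sqrt (\1_`[0, Mmu] t * w t).
  have -> : (fun z => kappa (z, t)) =
      (fun z => s * s * expR (- \sum_(i < p) `|t * f i z.1 - t * f i z.2|)).
    apply/funext => z; rewrite /kappa /= -expr2 sqr_sqrtr//; congr (_ * expR (- _)).
    by rewrite mulr_sumr; apply: eq_bigr => i _; rewrite -mulrBr normrM ger0_norm.
  apply: (@psd_kernel_scale _ _ _ P (fun=> s) `|s|) => //.
  apply: (@psd_kernel_laplacian _ _ _ P p (fun i w => t * f i w)) => i.
  exact: measurable_funM.
- by move=> z; exact: (cut_int mw (N0 z) C0 wC').
- by move=> z; exact: (cut_Rint_le mw (N0 z) C0 wC').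
Qed.

End LaplaceTransform.

(** * Reproducing kernel Hilbert spaces *)

Section HilbertSpace.
Context (R : realType) (E : Type) (k : E -> E -> R) (H : set (E -> R))
  (ip : (E -> R) -> (E -> R) -> R).
Hypothesis rk : is_rkhs k H ip.

Lemma rkhsZ (s : R) f : H f -> H (fun x => s * f x).
Proof.
move=> Hf; have := rkhs_lin rk s Hf (rkhs_zero rk); congr H.
by apply/funext => x; rewrite addr0.
Qed.

Lemma rkhsD f g : H f -> H g -> H (fun x => f x + g x).
Proof.
move=> Hf Hg; have := rkhs_lin rk 1 Hf Hg; congr H.
by apply/funext => x; rewrite mul1r.
Qed.

Lemma rkhsB f g : H f -> H g -> H (fun x => f x - g x).
Proof.
move=> Hf Hg; have := rkhs_lin rk (-1) Hg Hf; congr H.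
by apply/funext => x; rewrite mulN1r addrC.
Qed.

Definition linear_on (L : (E -> R) -> R) : Prop :=
  forall s f g, H f -> H g -> L (fun x => s * f x + g x) = s * L f + L g.

Lemma linear_onD L f g : linear_on L -> H f -> H g ->
  L (fun x => f x + g x) = L f + L g.
Proof.
move=> lL Hf Hg; rewrite -[X in _ = X + _]mul1r -lL//.
by congr L; apply/funext => x; rewrite mul1r.
Qed.

Lemma linear_onB L f g : linear_on L -> H f -> H g ->
  L (fun x => f x - g x) = L f - L g.
Proof.
move=> lL Hf Hg; rewrite addrC -mulN1r -lL//.
by congr L; apply/funext => x; rewrite mulN1r addrC.
Qed.

Lemma linear_onZ L s f : linear_on L -> H f -> L (fun x => s * f x) = s * L f.
Proof.
move=> lL Hf.
have L0 : L (fun=> 0) = 0.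
  transitivity (L (fun x => f x - f x)); last by rewrite linear_onB// subrr.
  by congr L; apply/funext => x; rewrite subrr.
have := lL s f (fun=> 0) Hf (rkhs_zero rk); rewrite L0 addr0 => <-.
by congr L; apply/funext => x; rewrite addr0.
Qed.

(** Both the inner product and the quadratic part of the penalised risk are
    instances. *)
Record sym_form (a : (E -> R) -> (E -> R) -> R) : Prop := SymForm {
  formC : forall f g, H f -> H g -> a f g = a g f;
  form_lin : forall g, H g -> linear_on (a^~ g);
  form_ge0 : forall f, H f -> 0 <= a f f }.

Lemma rkhs_form : sym_form ip.
Proof.
split; [exact: (rkhs_ipC rk)|by move=> g Hg s f f' Hf Hf'; exact: (rkhs_ip_lin rk)|].
exact: (rkhs_ip_ge0 rk).
Qed.

Section Form.
Variable a : (E -> R) -> (E -> R) -> R.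
Hypothesis fa : sym_form a.

Lemma form_linr f : H f -> linear_on (a f).
Proof.
move=> Hf s g h Hg Hh; rewrite formC//; last exact: (rkhs_lin rk).
by rewrite form_lin// formC// [a h f]formC.
Qed.

Lemma form_expand f g t : H f -> H g ->
  a (fun x => f x + t * g x) (fun x => f x + t * g x) =
  a f f + 2 * t * a f g + t ^+ 2 * a g g.
Proof.
move=> Hf Hg; have HZ := rkhsZ t Hg; have HD := rkhsD Hf HZ.
rewrite (linear_onD (form_lin fa HD))// (linear_onZ _ (form_lin fa HD))//.
rewrite !(linear_onD (form_linr _))// !(linear_onZ _ (form_linr _))//.
by rewrite [a g f]formC//; ring.
Qed.

Lemma form_CS f g : H f -> H g -> a f g ^+ 2 <= a f f * a g g.
Proof.
move=> Hf Hg; apply: discriminant_le; first exact: form_ge0.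
by move=> t; rewrite -form_expand//; apply: form_ge0 => //; apply: rkhsD => //; exact: rkhsZ.
Qed.

(** The minimiser of [a f f - 2 L f]: a minimising sequence is Cauchy by the
    parallelogram identity, and its limit satisfies the normal equations. *)
Theorem lax_milgram (c C B : R) (L : (E -> R) -> R) :
  0 < c -> 0 <= B -> linear_on L ->
  (forall f, H f -> c * ip f f <= a f f <= C * ip f f) ->
  (forall f, H f -> L f ^+ 2 <= B * ip f f) ->
  exists2 f, H f & forall g, H g -> a f g = L g.
Proof.
move=> c0 B0 lL cC LB.
pose Q f := a f f - 2 * L f.
have Qlow f : H f -> - (B / c) <= Q f.
  move=> Hf; have /andP[ca _] := cC f Hf.
  have h0 := form_ge0 fa Hf.
  have K0 : 0 <= B / c by rewrite divr_ge0// ltW.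
  have : L f ^+ 2 <= B / c * a f f.
    apply: le_trans (LB f Hf) _; rewrite -mulrA ler_wpM2l//.
    by rewrite ler_pdivlMl.
  rewrite /Q; set K := B / c in K0 *; set A := a f f in h0 *; set x := L f => h.
  rewrite leNgt; apply/negP => h2.
  have h3 : 0 < 2 * x - (A + K) by lra.
  have h4 : 0 < 2 * x + (A + K) by lra.
  have := mulr_gt0 h3 h4; have := sqr_ge0 (A - K); nra.
pose I := inf [set Q f | f in H].
have hI : has_inf [set Q f | f in H].
  split; first by exists (Q (fun=> 0)), (fun=> 0) => //; exact: (rkhs_zero rk).
  by exists (- (B / c)) => _ [f Hf <-]; exact: Qlow.
have Ilow f : H f -> I <= Q f.
  by move=> Hf; apply: ge_inf; [exact: hI.2|exists f].
have /choice[u Hu] (n : nat) : exists f, H f /\ Q f < I + n.+1%:R^-1.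
  have e0 : 0 < n.+1%:R^-1 :> R by rewrite invr_gt0.
  have [_ [f Hf <-] fI] := inf_adherent e0 hI.
  by exists f.
(* the midpoint of two almost minimisers is no better than the infimum *)
have para m n : c * ip (u m \- u n) (u m \- u n) <= 2 * (m.+1%:R^-1 + n.+1%:R^-1).
  have [[Hm Qm] [Hn Qn]] := (Hu m, Hu n).
  have Hd := rkhsB Hm Hn.
  have /andP[ca _] := cC _ Hd; apply: (le_trans ca).
  have E1 := form_expand (- 1) Hm Hn.
  have E2 := form_expand 1 Hm Hn.
  have -> : a (u m \- u n) (u m \- u n) =
      a (fun x => u m x + -1 * u n x) (fun x => u m x + -1 * u n x).
    by congr a; apply/funext => x; rewrite /= mulN1r.
  have Hs : H (fun x => u m x + 1 * u n x) by apply: rkhsD => //; exact: rkhsZ.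
  have := Ilow _ (rkhsZ 2^-1 Hs); rewrite /Q (linear_onZ _ lL)// linear_onD//; last exact: rkhsZ.
  rewrite (linear_onZ _ lL)// (linear_onZ _ (form_lin fa _)) ?(linear_onZ _ (form_linr _))//;
    last exact: rkhsZ.
  rewrite {}E1 {}E2; rewrite /Q in Qm Qn.
  move: (a (u m) (u m)) (a (u m) (u n)) (a (u n) (u n)) (L (u m)) (L (u n))
    (_ ^-1) (n.+1%:R^-1) Qm Qn => A X D l1 l2 e1 e2 Qm Qn h; lra.
have cauchy (e : R) : 0 < e -> exists N, forall m n, (N <= m)%N -> (N <= n)%N ->
    Num.sqrt (ip (u m \- u n) (u m \- u n)) < e.
  move=> e0.
  have e1 : 0 < c * e ^+ 2 / 4 by rewrite divr_gt0// mulr_gt0// exprn_gt0.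
  have /cvgrPdist_lt/(_ _ e1)[N _ hN] := @cvg_harmonic R.
  exists N => m n Nm Nn.
  have := hN m Nm; have := hN n Nn; rewrite /harmonic /= !sub0r !normrN.
  rewrite !ger0_norm ?invr_ge0// => h1 h2.
  rewrite -[ltRHS]ger0_norm ?(ltW e0)// -sqrtr_sqr ltr_sqrt ?exprn_gt0//.
  rewrite -(ltr_pM2l c0); apply: (le_lt_trans (para m n)).
  move: (n.+1%:R^-1) (m.+1%:R^-1) h1 h2 => x y h1 h2; lra.
have [f Hf uf] := rkhs_complete rk (fun n => (Hu n).1) cauchy.
exists f => // g Hg.
have A0 := form_ge0 fa Hg.
(* [t |-> Q (u n + t g)] stays above the infimum, so its discriminant is small *)
have res n : (a (u n) g - L g) ^+ 2 <= n.+1%:R^-1 * a g g.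
  have [Hn Qn] := Hu n.
  apply: discriminant_le => // t.
  have := Ilow _ (rkhsD Hn (rkhsZ t Hg)).
  rewrite /Q form_expand// linear_onD//; last exact: rkhsZ.
  rewrite (linear_onZ _ lL)//; rewrite /Q in Qn.
  by move: (n.+1%:R^-1) Qn => e1 Qn h; lra.
have close n : (a (u n) g - a f g) ^+ 2 <= C * ip (u n \- f) (u n \- f) * a g g.
  have [Hn _] := Hu n; have Hd := rkhsB Hn Hf.
  rewrite -(linear_onB (form_lin fa Hg))//; apply: le_trans (form_CS Hd Hg) _.
  by rewrite ler_wpM2r//; have /andP[] := cC _ Hd.
apply/eqP; rewrite -subr_eq0 -sqrf_eq0; apply/eqP/le_anti; rewrite sqr_ge0 andbT.
apply/ler_addgt0Pr => e e0; rewrite add0r.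
pose D := 2 * (1 + `|C|) * (1 + a g g).
have D0 : 0 < D by rewrite !mulr_gt0// ltr_wpDr.
have eD : 0 < e / D by rewrite divr_gt0.
have /cvgrPdist_lt/(_ _ eD) h1 := @cvg_harmonic R.
have seD : 0 < Num.sqrt (e / D) by rewrite sqrtr_gt0.
move/cvgrPdist_lt/(_ _ seD) : uf => h2.
have [N [n1 n2]] := filter_ex (filterI h1 h2).
move: n1 n2; rewrite /harmonic /= !sub0r !normrN !ger0_norm ?invr_ge0 ?sqrtr_ge0//.
have HN := rkhsB (Hu N).1 Hf.
rewrite ltr_sqrt// => n1 n2.
have r := res N; have q := close N.
have i0 : 0 <= ip (u N \- f) (u N \- f) := rkhs_ip_ge0 rk HN.
have q' : (a (u N) g - a f g) ^+ 2 <= `|C| * (e / D) * a g g.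
  apply: le_trans q _; rewrite ler_wpM2r//.
  apply: le_trans (_ : `|C| * ip (u N \- f) (u N \- f) <= _).
    by rewrite ler_wpM2r// ler_norm.
  by rewrite ler_wpM2l// ltW.
have r' : (a (u N) g - L g) ^+ 2 <= (e / D) * a g g.
  by apply: le_trans r _; rewrite ler_wpM2r// ltW.
have -> : a f g - L g = (a (u N) g - L g) - (a (u N) g - a f g) by ring.
apply: (@le_trans _ _ (2 * (e / D * a g g + `|C| * (e / D) * a g g))).
  by have := sqr_ge0 ((a (u N) g - L g) + (a (u N) g - a f g)); nra.
have -> : 2 * (e / D * a g g + `|C| * (e / D) * a g g) =
  e / D * (2 * (1 + `|C|) * a g g) by ring.
rewrite mulrAC ler_pdivrMr// ler_wpM2l ?(ltW e0)//.
by rewrite /D ler_wpM2l ?mulr_ge0 ?addr_ge0// lerDr.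
Qed.

End Form.

Lemma riesz (B : R) (L : (E -> R) -> R) : 0 <= B -> linear_on L ->
  (forall f, H f -> L f ^+ 2 <= B * ip f f) ->
  exists2 f, H f & forall g, H g -> ip f g = L g.
Proof.
move=> B0 lL LB; apply: (@lax_milgram ip rkhs_form 1 1 B) => //.
by move=> f Hf; rewrite mul1r lexx.
Qed.

Lemma rkhs_eval_sq f x : H f -> f x ^+ 2 <= k x x * ip f f.
Proof.
move=> Hf; rewrite (rkhs_reproducing rk x Hf) mulrC.
rewrite [k x x](rkhs_reproducing rk x (rkhs_kernel rk x)).
by apply: (form_CS rkhs_form) => //; exact: (rkhs_kernel rk).
Qed.

(** Cauchy-Schwarz against [k x - k y]; with a Lipschitz kernel it makes the
    functions of the space continuous. *)
Lemma rkhs_eval_diff_sq f x y : H f ->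
  (f x - f y) ^+ 2 <= (k x x - k x y - k y x + k y y) * ip f f.
Proof.
move=> Hf; have [Hx Hy] := (rkhs_kernel rk x, rkhs_kernel rk y).
have Hd := rkhsB Hx Hy.
rewrite (rkhs_reproducing rk x Hf) (rkhs_reproducing rk y Hf).
rewrite -(linear_onB (form_linr rkhs_form Hf) Hx Hy) mulrC.
have -> : k x x - k x y - k y x + k y y = ip (fun z => k x z - k y z) (fun z => k x z - k y z).
  rewrite (linear_onB (form_lin rkhs_form Hd) Hx Hy).
  rewrite !(linear_onB (form_linr rkhs_form _) Hx Hy)//.
  rewrite -!(rkhs_reproducing rk)//; ring.
exact: (form_CS rkhs_form).
Qed.

End HilbertSpace.

(** * Projected gradient descent *)

Section ProjectedGradient.
Context (R : realType) (p : nat).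
Implicit Types x y z b c : 'rV[R]_p.

Definition dot x y : R := \sum_(i < p) x 0 i * y 0 i.

Lemma dotC x y : dot x y = dot y x.
Proof. by apply: eq_bigr => i _; rewrite mulrC. Qed.

Lemma dotDl x y z : dot (x + y) z = dot x z + dot y z.
Proof. by rewrite -big_split; apply: eq_bigr => i _; rewrite mxE mulrDl. Qed.

Lemma dotZl (s : R) x z : dot (s *: x) z = s * dot x z.
Proof. by rewrite /dot mulr_sumr; apply: eq_bigr => i _; rewrite mxE mulrA. Qed.

Lemma dotNl x z : dot (- x) z = - dot x z.
Proof. by rewrite -scaleN1r dotZl mulN1r. Qed.

Lemma dotBl x y z : dot (x - y) z = dot x z - dot y z.
Proof. by rewrite dotDl dotNl. Qed.

Lemma dotDr x y z : dot z (x + y) = dot z x + dot z y.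
Proof. by rewrite dotC dotDl !(dotC z). Qed.

Lemma dotZr (s : R) x z : dot z (s *: x) = s * dot z x.
Proof. by rewrite dotC dotZl dotC. Qed.

Lemma dotNr x z : dot z (- x) = - dot z x.
Proof. by rewrite dotC dotNl dotC. Qed.

Lemma dotBr x y z : dot z (x - y) = dot z x - dot z y.
Proof. by rewrite dotDr dotNr. Qed.

Definition dotE := (dotDl, dotDr, dotBl, dotBr, dotNl, dotNr, dotZl, dotZr).

Lemma dot_ge0 x : 0 <= dot x x.
Proof. by apply: sumr_ge0 => i _; rewrite -expr2 sqr_ge0. Qed.

Lemma l2norm_sq x : l2norm x ^+ 2 = dot x x.
Proof.
rewrite sqr_sqrtr; first by apply: eq_bigr => i _; rewrite expr2.
by apply: sumr_ge0 => i _; exact: sqr_ge0.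
Qed.

Lemma l2norm_ge0 x : 0 <= l2norm x. Proof. exact: sqrtr_ge0. Qed.

Lemma dot_CS x y : `|dot x y| <= l2norm x * l2norm y.
Proof.
rewrite -(@ler_pXn2r _ 2%N) ?nnegrE ?mulr_ge0 ?l2norm_ge0//.
rewrite exprMn !l2norm_sq real_normK ?num_real//.
apply: discriminant_le => [|t]; first exact: dot_ge0.
have -> : dot x x + 2 * t * dot x y + t ^+ 2 * dot y y = dot (x + t *: y) (x + t *: y).
  by rewrite !dotE (dotC y x); ring.
exact: dot_ge0.
Qed.

Lemma l1norm_ge0 x : 0 <= l1norm x. Proof. exact: sumr_ge0. Qed.

Lemma coord_le_l1norm x i : `|x 0 i| <= l1norm x.
Proof. by rewrite /l1norm (bigD1 i)//= lerDl sumr_ge0. Qed.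

Lemma l2norm_le_l1norm x : l2norm x <= l1norm x.
Proof.
have l10 : 0 <= l1norm x by apply: sumr_ge0.
rewrite -(@ler_pXn2r _ 2%N) ?nnegrE ?l2norm_ge0// l2norm_sq expr2.
rewrite [X in _ <= X * _]/l1norm mulr_suml; apply: ler_sum => i _.
by rewrite (le_trans (ler_norm _))// normrM ler_wpM2l// coord_le_l1norm.
Qed.

Lemma l1norm_sq_le x : l1norm x ^+ 2 <= p%:R * dot x x.
Proof.
pose s : 'rV[R]_p := \row_i `|x 0 i|; pose o : 'rV[R]_p := \row_i 1.
have -> : l1norm x = dot o s by apply: eq_bigr => i _; rewrite !mxE mul1r.
have -> : dot x x = dot s s.
  by apply: eq_bigr => i _; rewrite !mxE -normrM ger0_norm// -expr2 sqr_ge0.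
have -> : p%:R = dot o o.
  by rewrite /dot (eq_bigr (fun=> 1)) => [|i _]; rewrite ?sumr_const ?card_ord// !mxE mul1r.
rewrite -real_normK ?num_real// -!l2norm_sq -exprMn.
by rewrite ler_pXn2r ?nnegrE ?mulr_ge0 ?l2norm_ge0// dot_CS.
Qed.

Lemma ball_convex (M t : R) b c : 0 <= t <= 1 ->
  l1_ball_orthant M b -> l1_ball_orthant M c ->
  l1_ball_orthant M (b + t *: (c - b)).
Proof.
move=> /andP[t0 t1] [b0 bM] [c0 cM].
have E i : (b + t *: (c - b)) 0 i = (1 - t) * b 0 i + t * c 0 i by rewrite !mxE; ring.
have t1' : 0 <= 1 - t by rewrite subr_ge0.
split=> [j|]; first by rewrite E addr_ge0 ?mulr_ge0.
have -> : l1norm (b + t *: (c - b)) = (1 - t) * l1norm b + t * l1norm c.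
  rewrite /l1norm !mulr_sumr -big_split; apply: eq_bigr => i _; rewrite E.
  by rewrite !ger0_norm ?addr_ge0 ?mulr_ge0.
nra.
Qed.

Lemma ball_diam (M : R) b c : l1_ball_orthant M b -> l1_ball_orthant M c ->
  l2norm (b - c) <= 2 * M.
Proof.
move=> [_ bM] [_ cM]; apply: le_trans (l2norm_le_l1norm _) _.
have : l1norm (b - c) <= l1norm b + l1norm c.
  by rewrite /l1norm -big_split; apply: ler_sum => i _; rewrite !mxE ler_normB.
lra.
Qed.

(** Moving from the projection [b] towards a point [c] of the convex set cannot
    bring [v] closer. *)
Lemma projection_dot (M : R) v b c : is_projection (l1_ball_orthant M) v b ->
  l1_ball_orthant M c -> dot (v - b) (c - b) <= 0.
Proof.
move=> [Bb Pb] Bc; rewrite leNgt; apply/negP => g0.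
have D0 := dot_ge0 (c - b).
set g := dot (v - b) (c - b) in g0; set D := dot (c - b) (c - b) in D0.
(* a step so short that the linear gain beats the quadratic loss *)
pose t := Num.min 1 (g / (1 + D)).
have q0 : 0 < g / (1 + D) by rewrite divr_gt0// ltr_wpDr.
have t0 : 0 < t by rewrite lt_min ltr01.
have t1 : t <= 1 by rewrite ge_min lexx.
have tg : t * (1 + D) <= g by rewrite -ler_pdivlMr ?ge_min ?lexx ?orbT// ltr_wpDr.
have t01 : 0 <= t <= 1 by rewrite ltW.
have := Pb _ (ball_convex t01 Bb Bc).
rewrite -(@ler_pXn2r _ 2%N) ?nnegrE ?l2norm_ge0// !l2norm_sq.
have -> : v - (b + t *: (c - b)) = (v - b) - t *: (c - b) by rewrite opprD addrA.
have -> : dot ((v - b) - t *: (c - b)) ((v - b) - t *: (c - b)) =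
  dot (v - b) (v - b) - 2 * t * g + t ^+ 2 * D.
  rewrite /g /D; move: (v - b) (c - b) (t) => x y s.
  by rewrite !dotE (dotC y x); ring.
nra.
Qed.

Section Descent.
Variables (M L alpha : R) (F : 'rV[R]_p -> R) (G : 'rV[R]_p -> 'rV[R]_p).
Local Notation B := (l1_ball_orthant M).
Hypotheses (M0 : 0 < M) (L0 : 0 <= L) (alpha0 : 0 < alpha) (alphaL : 2 * (alpha * L) <= 1).
Hypothesis F0 : forall b, B b -> 0 <= F b.
Hypothesis FG : forall b c, B b -> B c ->
  `|F c - F b - dot (G b) (c - b)| <= L * dot (c - b) (c - b).
Variable b : nat -> 'rV[R]_p.
Hypothesis b0 : b 0 = 0.
Hypothesis bS : forall k, is_projection B (b k - alpha *: G (b k)) (b k.+1).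

Lemma iterate_in_ball k : B (b k).
Proof.
case: k => [|k]; last by have [] := bS k.
rewrite b0; split => [j|]; first by rewrite mxE.
by rewrite /l1norm big1 ?ltW// => i _; rewrite mxE normr0.
Qed.

(** The variational inequality at the new iterate against the old one, inserted in
    the quadratic expansion; half of the quadratic term survives because
    [2 * alpha * L <= 1]. *)
Lemma descent_step k :
  dot (b k.+1 - b k) (b k.+1 - b k) <= 2 * alpha * (F (b k) - F (b k.+1)).
Proof.
have := projection_dot (bS k) (iterate_in_ball k).
have := FG (iterate_in_ball k) (iterate_in_ball k.+1).
have [d Ed] : exists d, d = b k.+1 - b k by exists (b k.+1 - b k).
have -> : b k - alpha *: G (b k) - b k.+1 = - d - alpha *: G (b k).
  by rewrite Ed opprB addrAC.
have -> : b k - b k.+1 = - d by rewrite Ed opprB.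
rewrite -Ed.
rewrite ler_norml => /andP[_ h1]; rewrite !dotE => h2.
have d0 := dot_ge0 d; set D := dot d d in h1 h2 d0 *.
set g := dot (G (b k)) d in h1 h2.
have h3 : D + alpha * g <= 0 by lra.
have : alpha * (F (b k.+1) - F (b k) - g) <= alpha * (L * D) by rewrite ler_pM2l.
have := ler_wpM2r d0 alphaL; lra.
Qed.

Lemma F_nonincr k n : (k <= n)%N -> F (b n) <= F (b k).
Proof.
elim: n => [|n IH]; first by rewrite leqn0 => /eqP ->.
rewrite leq_eqVlt => /predU1P[->//|]; rewrite ltnS => /IH; apply: le_trans.
have := descent_step n; have := dot_ge0 (b n.+1 - b n) => h1 h2.
have := le_trans h1 h2; rewrite pmulr_rge0 ?mulr_gt0//; lra.
Qed.

Lemma F_drop_small (e : R) : 0 < e -> exists N, forall k, (N <= k)%N ->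
  F (b k) - F (b k.+1) < e.
Proof.
move=> e0; pose S := [set F (b k) | k in [set: nat]].
have hS : has_inf S.
  split; first by exists (F (b 0)), 0%N.
  by exists 0 => _ [k _ <-]; exact/F0/iterate_in_ball.
have [_ [N _ <-] hN] := inf_adherent e0 hS.
exists N => k Nk; have := F_nonincr Nk.
have : inf S <= F (b k.+1) by apply: ge_inf; [exact: hS.2|exists k.+1].
lra.
Qed.

Variable beta : 'rV[R]_p.
Hypothesis cb : cluster (b @ \oo) beta.

Lemma cluster_close (e : R) N : 0 < e -> exists2 k, (N <= k)%N & l2norm (b k - beta) < e.
Proof.
move=> e0; have e1 : 0 < e / (p%:R + 1) by rewrite divr_gt0// ltr_wpDl.
have A : (b @ \oo) [set b k | k in [set k | (N <= k)%N]].
  by exists N => // k Nk; exists k.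
have [_ [[k Nk <-] bk]] := cb A (nbhsx_ballx beta _ e1).
exists k => //; apply: le_lt_trans (l2norm_le_l1norm _) _.
apply: (@le_lt_trans _ _ (\sum_(i < p) (e / (p%:R + 1)))).
  apply: ler_sum => i _; rewrite ltW//.
  have := bk; rewrite /ball /= /mx_ball => -[_ /(_ 0 i)].
  by rewrite /ball /= distrC !mxE.
rewrite sumr_const card_ord -[_ *+ p]mulr_natr -mulrA gtr_pMr// mulrC ltr_pdivrMr ?mul1r ?ltrDl//.
Qed.

Lemma cluster_in_ball : B beta.
Proof.
have clo (e : R) : 0 < e -> exists2 c, B c & forall i, `|c 0 i - beta 0 i| < e.
  move=> e0; have [k _ hk] := cluster_close 0 e0; exists (b k); first exact: iterate_in_ball.
  move=> i; apply: le_lt_trans hk.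
  rewrite -(@ler_pXn2r _ 2%N) ?nnegrE ?l2norm_ge0// l2norm_sq /dot (bigD1 i)//= !mxE.
  rewrite real_normK ?num_real// expr2 lerDl sumr_ge0// => j _.
  by rewrite -expr2 sqr_ge0.
split=> [j|].
  apply/ler_addgt0Pr => e e0; have [c [c0 _] /(_ j)] := clo e e0.
  rewrite ltr_norml => /andP[_]; have := c0 j; lra.
apply/ler_addgt0Pr => e e0.
have e1 : 0 < e / (p%:R + 1) by rewrite divr_gt0// ltr_wpDl.
have [c [_ cM] hc] := clo _ e1.
apply: (@le_trans _ _ (l1norm c + \sum_(i < p) (e / (p%:R + 1)))).
  rewrite /l1norm -big_split; apply: ler_sum => i _; rewrite /=.
  have := ler_distD (c 0 i) (beta 0 i) 0; rewrite !subr0 => /le_trans; apply.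
  by rewrite [leLHS]addrC lerD2l distrC ltW.
apply: lerD => //; rewrite sumr_const card_ord -[_ *+ p]mulr_natr -mulrA ger_pMr//.
by rewrite mulrC ler_pdivrMr ?mul1r ?lerDl// ltr_wpDl.
Qed.

(** The optimality of a late iterate close to [beta] passes to [beta]: the
    gradients at the two points are compared through the values of [F] at a common
    third point, using the quadratic expansion at both, which takes the place of
    continuity of the gradient. *)
Theorem cluster_stationary c : B c -> 0 <= dot (G beta) (c - beta).
Proof.
move=> Bc; have Bb := cluster_in_ball.
set g := dot (G beta) (c - beta).
pose D := 2 * M; have D0 : 0 < D by rewrite mulr_gt0.
pose K := 4 * L + l2norm (G beta) + alpha^-1 * D + 1.
have ai : 0 < alpha^-1 by rewrite invr_gt0.
have K0 : 0 < K.
  rewrite /K ltr_wpDl// addr_ge0 ?mulr_ge0 ?(ltW ai) ?(ltW M0)//.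
  by rewrite addr_ge0 ?mulr_ge0 ?l2norm_ge0.
(* [eta] is the length of the step from the iterate towards [c]; [e] bounds the
   distance from the iterate to [beta] and the decrease of [F] still to come *)
have main (eta e : R) : 0 < eta <= 1 -> 0 < e <= 1 ->
    - (3 * L * D ^+ 2 * eta ^+ 2) - K * e <= eta * g.
  move=> /andP[eta0 eta1] /andP[e0 e1].
  have e2 : 0 < e ^+ 2 by rewrite exprn_gt0.
  have e2' : 0 < Num.min e (e ^+ 2 / (2 * alpha)).
    by rewrite lt_min e0 divr_gt0 ?mulr_gt0.
  have [N hN] := F_drop_small e2'.
  have [k Nk hk] := cluster_close N e0.
  have {hN} hd := hN k Nk.
  have Bk := iterate_in_ball k; have Bk1 := iterate_in_ball k.+1.
  have e01 : 0 <= eta <= 1 by rewrite (ltW eta0).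
  have Bx := ball_convex e01 Bk Bc.
  set x := b k + eta *: (c - b k) in Bx.
  have [d Ed] : exists d, d = b k.+1 - b k by exists (b k.+1 - b k).
  have [ee Eee] : exists ee, ee = b k - beta by exists (b k - beta).
  have drop : F (b k) - F (b k.+1) < e.
    by apply: lt_le_trans hd _; rewrite ge_min lexx.
  have dle : dot d d <= e ^+ 2.
    have := descent_step k; rewrite -Ed => /le_trans; apply.
    have : F (b k) - F (b k.+1) <= e ^+ 2 / (2 * alpha).
      by apply: (le_trans (ltW hd)); rewrite ge_min lexx orbT.
    by rewrite ler_pdivlMr ?mulr_gt0// mulrC.
  have dn : l2norm d <= e.
    by rewrite -(@ler_pXn2r _ 2%N) ?nnegrE ?l2norm_ge0 ?(ltW e0)// l2norm_sq.
  have sq y z : B y -> B z -> dot (y - z) (y - z) <= D ^+ 2.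
    move=> By Bz; rewrite -l2norm_sq ler_pXn2r ?nnegrE ?l2norm_ge0 ?(ltW D0)//.
    exact: ball_diam.
  have een : dot ee ee <= e ^+ 2.
    rewrite -l2norm_sq ler_pXn2r ?nnegrE ?l2norm_ge0 ?(ltW e0)// ltW//.
    by rewrite Eee.
  (* the expansion at the iterate, in the direction of [c] *)
  have h1 := FG Bk Bx.
  have xk : x - b k = eta *: (c - b k) by rewrite /x addrAC subrr add0r.
  rewrite xk dotZr dotZl dotZr ler_norml in h1; have {h1}/andP[h1 _] := h1.
  have h2 := FG Bk Bk1; rewrite -Ed ler_norml in h2; have {h2}/andP[_ h2] := h2.
  have h3 := projection_dot (bS k) Bc.
  have h4 : dot d (c - b k.+1) <= e * D.
    apply: le_trans (ler_norm _) _; apply: le_trans (dot_CS _ _) _.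
    by apply: ler_pM; rewrite ?l2norm_ge0//; exact: ball_diam.
  have h3' : - (alpha^-1 * (e * D)) <= dot (G (b k)) (c - b k.+1).
    have : dot (- d - alpha *: G (b k)) (c - b k.+1) <= 0.
      by move: h3; congr (dot _ _ <= 0); rewrite Ed opprB addrAC.
    rewrite dotBl dotNl dotZl => h5.
    rewrite lerNl ler_pdivlMl//; lra.
  have split_c : dot (G (b k)) (c - b k) = dot (G (b k)) (c - b k.+1) + dot (G (b k)) d.
    by rewrite -dotDr Ed addrA subrK.
  (* the expansion at [beta], at the iterate and at the common third point *)
  have h6 := FG Bb Bk; rewrite -Eee ler_norml in h6; have {h6}/andP[h6 _] := h6.
  have h7 := FG Bb Bx; rewrite ler_norml in h7; have {h7}/andP[_ h7] := h7.
  have xb : x - beta = (1 - eta) *: ee + eta *: (c - beta).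
    by apply/rowP => i; rewrite /x Eee !mxE; ring.
  rewrite xb [dot (G beta) _]dotDr !dotZr -/g in h7.
  have h8 : dot ((1 - eta) *: ee + eta *: (c - beta)) ((1 - eta) *: ee + eta *: (c - beta))
      <= 2 * e ^+ 2 + 2 * eta ^+ 2 * D ^+ 2.
    have h10 := sq _ _ Bc Bb.
    move: (c - beta) h10 => y h10.
    have h9 := dot_ge0 ((1 - eta) *: ee - eta *: y).
    move: h9; rewrite !dotE (dotC _ ee).
    have ee0 := dot_ge0 ee.
    have : (1 - eta) * ((1 - eta) * dot ee ee) <= e ^+ 2.
      have o0 : 0 <= 1 - eta by lra.
      have o1 : 1 - eta <= 1 by lra.
      apply: le_trans een; rewrite mulrA -[leRHS]mul1r ler_wpM2r//.
      by rewrite -[leRHS]mul1r ler_pM.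
    have : eta * (eta * dot y y) <= eta ^+ 2 * D ^+ 2.
      by rewrite mulrA -expr2 ler_wpM2l// sqr_ge0.
    lra.
  have h11 : `|dot (G beta) ee| <= l2norm (G beta) * e.
    by apply: le_trans (dot_CS _ _) _; rewrite ler_wpM2l ?l2norm_ge0// Eee ltW.
  rewrite ler_norml in h11; have {h11}/andP[h11 h12] := h11.
  have ee1 : e ^+ 2 <= e by rewrite expr2 ger_pMl.
  have h13 : L * dot ee ee <= L * e by rewrite ler_wpM2l//; exact: le_trans een ee1.
  have h14 : L * dot d d <= L * e by rewrite ler_wpM2l//; exact: le_trans dle ee1.
  have h15 := ler_wpM2l L0 h8.
  have h16 : L * (eta * (eta * dot (c - b k) (c - b k))) <= L * (eta ^+ 2 * D ^+ 2).
    rewrite ler_wpM2l// mulrA -expr2 ler_wpM2l ?sqr_ge0//; exact: sq.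
  have h17 : eta * (- (alpha^-1 * (e * D)) - (e + L * e)) <= eta * dot (G (b k)) (c - b k).
    by rewrite ler_pM2l// split_c; lra.
  have h18 : - (alpha^-1 * (e * D) + (e + L * e)) <=
      eta * (- (alpha^-1 * (e * D)) - (e + L * e)).
    have X0 : 0 <= alpha^-1 * (e * D) + (e + L * e).
      by rewrite !addr_ge0 ?mulr_ge0 ?(ltW ai) ?(ltW e0) ?(ltW M0).
    have := ler_wpM2r X0 eta1; lra.
  have h19 : - (l2norm (G beta) * e) <= eta * dot (G beta) ee.
    have X0 : 0 <= l2norm (G beta) * e by rewrite mulr_ge0 ?l2norm_ge0// ltW.
    have := ler_wpM2r X0 eta1; have := ler_wpM2l (ltW eta0) h11; lra.
  have h20 : L * e ^+ 2 <= L * e by rewrite ler_wpM2l.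
  rewrite /K; move: h19 h7 h15; lra.
have {}main (eta : R) : 0 < eta <= 1 -> - (3 * L * D ^+ 2 * eta) <= g.
  move=> he; have /andP[e0 e1] := he.
  rewrite -(ler_pM2l e0).
  apply/ler_addgt0Pr => t t0.
  pose e := Num.min 1 (t / K).
  have ee : 0 < e <= 1 by rewrite lt_min ltr01 divr_gt0//= ge_min lexx.
  have eK : K * e <= t by rewrite mulrC -ler_pdivlMr// ge_min lexx orbT.
  have := main eta e he ee; lra.
rewrite leNgt; apply/negP => g0.
pose C := 3 * L * D ^+ 2; have C0 : 0 <= C by rewrite mulr_ge0 ?sqr_ge0// mulr_ge0.
pose eta := Num.min 1 (- g / (2 * (C + 1))).
have q0 : 0 < - g / (2 * (C + 1)) by rewrite divr_gt0 ?oppr_gt0// mulr_gt0// ltr_wpDl.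
have he : 0 < eta <= 1 by rewrite lt_min ltr01 q0 ge_min lexx.
have := main eta he; rewrite -/C.
have : eta * (2 * (C + 1)) <= - g.
  by rewrite -ler_pdivlMr ?ge_min ?lexx ?orbT// mulr_gt0// ltr_wpDl.
have /andP[e0 _] := he; nra.
Qed.

End Descent.
End ProjectedGradient.

(** * Derivatives on the orthant *)

Section OrthantDerivative.
Context (R : realType) (p : nat).
Implicit Types b c : 'rV[R]_p.

Definition orthant b : Prop := forall j, 0 <= b 0 j.

(** Along the coordinate [l] the expansion stays inside the orthant, for steps of
    both signs off the face and for nonnegative steps on it. *)
Lemma partial_orthant_expansion (F : 'rV[R]_p -> R) b (D : 'rV[R]_p) (K : R) l :
  orthant b ->
  (forall c, orthant c -> `|F c - F b - dot D (c - b)| <= K * l1norm (c - b) ^+ 2) ->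
  partial_orthant F b l = D 0 l.
Proof.
move=> b0 FD.
have step (t : R) : 0 <= b 0 l + t -> t != 0 ->
    `|D 0 l - t^-1 * (F (b + t *: delta_mx 0 l) - F b)| <= (`|K| + 1) * `|t|.
  move=> bt t0; pose c := b + t *: delta_mx 0 l.
  have cb : c - b = t *: delta_mx 0 l by rewrite /c addrAC subrr add0r.
  have c0 : orthant c.
    move=> j; rewrite !mxE eqxx /=; have [->|_] := eqVneq j l; first by rewrite mulr1.
    by rewrite mulr0 addr0.
  have := FD c c0; rewrite cb.
  have -> : dot D (t *: delta_mx 0 l) = t * D 0 l.
    rewrite dotZr /dot (bigD1 l)//= mxE !eqxx mulr1 big1 ?addr0// => j jl.
    by rewrite mxE eqxx (negbTE jl) mulr0.
  have -> : l1norm (t *: delta_mx 0 l : 'rV[R]_p) = `|t|.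
    rewrite /l1norm (bigD1 l)//= !mxE !eqxx mulr1 big1 ?addr0// => j jl.
    by rewrite !mxE eqxx (negbTE jl) mulr0 normr0.
  move=> h; have t1 : 0 < `|t| by rewrite normr_gt0.
  rewrite -(ler_pM2l t1) -normrM mulrBr mulrA divff// mul1r distrC.
  have -> : `|t| * ((`|K| + 1) * `|t|) = (`|K| + 1) * `|t| ^+ 2 by ring.
  apply: (le_trans h).
  by apply: ler_wpM2r; rewrite ?sqr_ge0// (le_trans (ler_norm _))// lerDl.
have K1 : 0 < `|K| + 1 by rewrite ltr_wpDl.
rewrite /partial_orthant; case: ifPn => [/eqP bl|bl].
  apply: cvg_lim => //; apply/cvgrPdist_lt => e e0; near=> t.
  have t0 : 0 < t by near: t; exact: nbhs_right_gt.
  apply: le_lt_trans (step t _ _) _; [by rewrite bl add0r ltW|by rewrite gt_eqF|].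
  rewrite (gtr0_norm t0) mulrC -ltr_pdivlMr//.
  by near: t; apply: nbhs_right_lt; rewrite divr_gt0.
have bl0 : 0 < b 0 l by rewrite lt_neqAle eq_sym bl b0.
rewrite /derive1; apply: cvg_lim => //; apply/cvgrPdist_lt => e e0; near=> t.
rewrite addr0 scale0r addr0.
have tb : `|t| < Num.min (b 0 l) (e / (`|K| + 1)).
  near: t; apply: dnbhs0_lt; rewrite lt_min bl0 divr_gt0//.
move: tb; rewrite lt_min => /andP[tb te].
apply: le_lt_trans (step t _ _) _.
- by have := ler_norm (- t); rewrite normrN; lra.
- by near: t; exact: nbhs_dnbhs_neq.
- by rewrite mulrC -ltr_pdivlMr.
Unshelve. all: by end_near. Qed.

End OrthantDerivative.

(** The arithmetic that turns the two-sided dual bound, the expansion of the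
    energy and the bound on the gap into an expansion of the objective. *)
Lemma sandwich_expansion (R : realFieldType) (la eb ec g Q dJ K1 K2 n : R) :
  0 < la -> 0 <= K2 -> Q <= K2 * n ^+ 2 ->
  dJ <= (eb - ec) / (2 * la) + Q / (2 * la ^+ 2) ->
  (eb - ec) / (2 * la) <= dJ ->
  `|ec - eb + g| <= 2 * K1 * n ^+ 2 ->
  `|dJ - g / (2 * la)| <= (K1 / la + K2 / 2 / la ^+ 2) * n ^+ 2.
Proof.
move=> l0 K0 hQ hu hl; rewrite ler_norml => /andP[h1 h2].
have i0 : 0 <= (2 * la)^-1 by rewrite invr_ge0 mulr_ge0// ltW.
have j0 : 0 <= (2 * la ^+ 2)^-1 by rewrite invr_ge0 mulr_ge0// sqr_ge0.
have E1 : K1 / la * n ^+ 2 = 2 * K1 * n ^+ 2 / (2 * la) by field; rewrite gt_eqF.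
have E2 : K2 / 2 / la ^+ 2 * n ^+ 2 = K2 * n ^+ 2 / (2 * la ^+ 2).
  by field; rewrite gt_eqF.
rewrite [leRHS]mulrDl {}E1 {}E2.
have q1 := ler_wpM2r j0 hQ.
have q0 := mulr_ge0 (mulr_ge0 K0 (sqr_ge0 n)) j0.
have a1 := ler_wpM2r i0 h1; have a2 := ler_wpM2r i0 h2.
move: (2 * la)^-1 (2 * la ^+ 2)^-1 hu hl q1 q0 a1 a2 => i j hu hl q1 q0 a1 a2.
by clear i0 j0; rewrite ler_norml; apply/andP; split; lra.
Qed.

(** * Kernels of scaled covariates *)

Section Objective.
Context (R : realType) (mu : {finite_measure set (measurableTypeR R) -> \bar R})
  (Mmu : R) (hk : l1_kernel_measure mu Mmu).
Context d (T : measurableType d) (P : probability T R) (p : nat)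
  (X : 'I_p -> T -> R) (Y : T -> R).
Hypotheses (mX : forall j, measurable_fun setT (X j)) (mY : measurable_fun setT Y)
  (iY2 : integrableR P (fun w => Y w ^+ 2)).
Context (H : set ('rV[R]_p -> R)) (ip : ('rV[R]_p -> R) -> ('rV[R]_p -> R) -> R)
  (lambda : R).
Hypotheses (rk : is_rkhs (@l1_kernel R mu p) H ip) (lambda0 : 0 < lambda).
Local Notation PP := (square_prob P).
Local Notation mass := (mass mu).
Implicit Types (b c : 'rV[R]_p) (f g : 'rV[R]_p -> R) (r : T -> R).

Definition scaled b w : 'rV[R]_p := hadamard b (covariates X w).

Definition pair_dist b (z : T * T) : R :=
  \sum_(j < p) `|b 0 j * X j z.1 - b 0 j * X j z.2|.

Lemma l1norm_scaledB b x y : l1norm (scaled b x - scaled b y) = pair_dist b (x, y).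
Proof. by apply: eq_bigr => j _; rewrite !mxE. Qed.

Lemma pair_dist_ge0 b z : 0 <= pair_dist b z. Proof. exact: sumr_ge0. Qed.

Lemma pair_distC b z : pair_dist b (z.2, z.1) = pair_dist b z.
Proof. by apply: eq_bigr => j _; rewrite distrC. Qed.

Lemma kernel_scaled b x y :
  l1_kernel mu (scaled b x) (scaled b y) = laplace mu (pair_dist b (x, y)).
Proof. by rewrite /l1_kernel l1norm_scaledB. Qed.

Lemma psd_kernel_cut b (u : R -> R) (C : R) : measurable_fun setT u -> 0 <= C ->
  (forall t, 0 <= t -> t <= Mmu -> 0 <= u t <= C) ->
  psd_kernel P (fun z => \int[mu]_t
    (\1_`[0, Mmu] t * u t * expR (- (t * pair_dist b z)))).
Proof.
move=> mu' C0 uC.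
have mf j : measurable_fun setT (fun w => b 0 j * X j w) by exact: measurable_funM.
exact: (psd_kernel_weighted_laplace mu P mu' C0 uC mf).
Qed.

Lemma psd_kernel_laplace b : psd_kernel P (fun z => laplace mu (pair_dist b z)).
Proof.
have := @psd_kernel_cut b (fun=> 1) 1 (measurable_cst _) ler01.
have <- : (fun z => laplace mu (pair_dist b z)) = (fun z => \int[mu]_t
    (\1_`[0, Mmu] t * 1 * expR (- (t * pair_dist b z)))).
  by apply/funext => z; rewrite (laplaceE hk) ?pair_dist_ge0.
by apply => t _ _; rewrite ler01 lexx.
Qed.

Lemma psd_kernel_slope b :
  psd_kernel P (fun z => laplace_slope mu Mmu (pair_dist b z)).
Proof.
apply: (@psd_kernel_cut b id Mmu) => //; first exact: (ltW (Mmu_gt0 hk)).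
by move=> t -> ->.
Qed.

(** The mixing measure lives on [0, Mmu], so the slope kernel is dominated by
    [Mmu] times the kernel, in the order of positive kernels. *)
Lemma psd_kernel_slope_dom b : psd_kernel P (fun z =>
  Mmu * laplace mu (pair_dist b z) - laplace_slope mu Mmu (pair_dist b z)).
Proof.
have := @psd_kernel_cut b (fun t => Mmu - t) Mmu _ (ltW (Mmu_gt0 hk)).
have <- : (fun z => Mmu * laplace mu (pair_dist b z) -
    laplace_slope mu Mmu (pair_dist b z)) = (fun z => \int[mu]_t
    (\1_`[0, Mmu] t * (Mmu - t) * expR (- (t * pair_dist b z)))).
  apply/funext => z; have N0 := pair_dist_ge0 b z.
  rewrite (laplaceE hk)// -RintZ; last exact: laplace_int.
  rewrite -RintB; [|exact/intRZ/laplace_int|exact: (slope_int hk)].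
  by apply: eq_Rintegral => t _; ring.
apply; first exact: measurable_funB.
by move=> t t0 tM; rewrite subr_ge0 tM lerBlDr lerDl.
Qed.

Lemma laplace_pair_bound b z : `|laplace mu (pair_dist b z)| <= mass.
Proof.
have N0 := pair_dist_ge0 b z.
by rewrite ger0_norm ?(laplace_ge0 hk)// (laplace_le hk).
Qed.

Lemma slope_pair_bound b z :
  `|laplace_slope mu Mmu (pair_dist b z)| <= Mmu * mass.
Proof.
have N0 := pair_dist_ge0 b z.
by rewrite ger0_norm ?(slope_ge0 hk)// (slope_le hk).
Qed.

(** * Functions of the Hilbert space evaluated at the covariates *)

Lemma rkhs_bound f x : H f -> `|f x| <= Num.sqrt (mass * ip f f).
Proof.
move=> Hf; rewrite -sqrtr_sqr ler_wsqrtr//.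
apply: le_trans (rkhs_eval_sq rk x Hf) _.
rewrite ler_wpM2r ?(rkhs_ip_ge0 rk)// /l1_kernel (laplace_le hk)//.
by apply: sumr_ge0.
Qed.

Lemma rkhs_l1_continuous f : H f -> l1_continuous f.
Proof.
move=> Hf x e e0.
have i0 := rkhs_ip_ge0 rk Hf.
pose A := 2 * (Mmu * mass) * ip f f + 1.
have A0 : 0 < A.
  by rewrite /A ltr_wpDl// !mulr_ge0 ?(mass_ge0 mu) ?(ltW (Mmu_gt0 hk)).
exists (e ^+ 2 / A) => [|y yx]; first by rewrite divr_gt0 ?exprn_gt0.
have N0 (u : 'rV[R]_p) : 0 <= l1norm u by apply: sumr_ge0.
have NC : l1norm (x - y) = l1norm (y - x).
  by apply: eq_bigr => j _; rewrite !mxE distrC.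
rewrite -(@ltr_pXn2r _ 2%N) ?nnegrE ?(ltW e0)// real_normK ?num_real//.
apply: le_lt_trans (rkhs_eval_diff_sq rk y x Hf) _.
have k0 u : l1_kernel mu u u = laplace mu 0.
  by congr laplace; rewrite /l1norm big1// => j _; rewrite !mxE subrr normr0.
have kC : l1_kernel mu x y = l1_kernel mu y x by congr laplace.
rewrite !k0 kC /l1_kernel.
have := laplace_lip hk (lexx 0) (N0 (y - x)).
rewrite sub0r normrN (ger0_norm (N0 _)) => /(le_trans (ler_norm _)) h1.
have {}yx : l1norm (y - x) * A < e ^+ 2 by rewrite -ltr_pdivlMr.
apply: le_lt_trans yx; rewrite /A.
suff real (m v0 v1 n i : R) : 0 <= i -> 0 <= n -> v1 - v0 <= m * n ->
    (v1 - v0 - v0 + v1) * i <= n * (2 * m * i + 1) by exact: real.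
by clear h1 k0 kC; move=> i1 n0 h; have := ler_wpM2r i1 h; lra.
Qed.

Lemma measurable_scaled f b : H f -> measurable_fun setT (fun w => f (scaled b w)).
Proof.
move=> Hf.
have -> : (fun w => f (scaled b w)) = (fun w => f (\row_j (b 0 j * X j w))).
  by apply/funext => w; congr f; apply/rowP => j; rewrite !mxE.
apply: measurable_l1_continuous_comp; first exact: rkhs_l1_continuous.
by move=> j; exact: measurable_funM.
Qed.

Lemma intR_scaled_mul f b r : H f -> integrableR P r ->
  integrableR P (fun w => r w * f (scaled b w)).
Proof.
move=> Hf ir; apply: (intR_ext (fun w => mulrC _ _)).
apply: (intR_bounded_mul _ _ ir); first exact: measurable_scaled.
by move=> w; exact: rkhs_bound.
Qed.

Lemma intR_scaled f b : H f -> integrableR P (fun w => f (scaled b w)).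
Proof.
by move=> Hf; apply: (@intR_bounded _ _ _ P _ _ (measurable_scaled b Hf)) => w;
exact: rkhs_bound.
Qed.

Lemma intR_scaled_sq f b : H f -> integrableR P (fun w => f (scaled b w) ^+ 2).
Proof. by move=> Hf; apply: intR_scaled_mul => //; exact: intR_scaled. Qed.

Definition evaluation b r f : R := \int[P]_w (r w * f (scaled b w)).

Lemma evaluation_linear b r : integrableR P r -> linear_on H (evaluation b r).
Proof.
move=> ir s f g Hf Hg; rewrite /evaluation -RintZ; last exact: intR_scaled_mul.
rewrite -RintD; [|exact/intRZ/intR_scaled_mul|exact: intR_scaled_mul].
by apply: eq_Rintegral => w _; ring.
Qed.

Lemma evaluation_bounded b r f : integrableR P r -> H f ->
  evaluation b r f ^+ 2 <= (\int[P]_w `|r w|) ^+ 2 * mass * ip f f.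
Proof.
move=> ir Hf; rewrite -mulrA -[X in _ <= _ * X]sqr_sqrtr; last first.
  by rewrite mulr_ge0 ?(mass_ge0 mu) ?(rkhs_ip_ge0 rk).
rewrite -exprMn -real_normK ?num_real//.
have A0 : 0 <= \int[P]_w `|r w| by apply: Rint_ge0.
rewrite ler_pXn2r ?nnegrE ?mulr_ge0 ?sqrtr_ge0//.
rewrite mulrC -RintZ; last exact: intR_norm.
apply: Rint_norm_le; [exact: intR_scaled_mul|exact/intRZ/intR_norm|].
by move=> w; rewrite normrM mulrC ler_wpM2r// rkhs_bound.
Qed.

(** The embedding of the signed measure [r dP] pushed forward by [scaled b]. *)
Definition embeds b r (m : 'rV[R]_p -> R) : Prop :=
  H m /\ forall g, H g -> ip m g = evaluation b r g.

Lemma embedding_exists b r : integrableR P r -> exists m, embeds b r m.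
Proof.
move=> ir; have [|f Hf fL] := riesz rk _ (evaluation_linear b ir)
  (fun f Hf => evaluation_bounded b ir Hf).
  by rewrite mulr_ge0 ?sqr_ge0 ?(mass_ge0 mu).
by exists f.
Qed.

(** The squared norm of the embedding of [r] (lemma [embeds_energy]).  The scale
    enters it only through the kernel, which is what makes it differentiable. *)
Definition energy r b : R :=
  \int[PP]_z (r z.1 * r z.2 * laplace mu (pair_dist b z)).

Lemma embedsE b r m : embeds b r m ->
  forall x, m x = \int[P]_w (r w * l1_kernel mu x (scaled b w)).
Proof.
move=> [Hm mE] x; rewrite (rkhs_reproducing rk x Hm) mE//.
exact: (rkhs_kernel rk).
Qed.

Lemma embeds_scaled b r m : embeds b r m -> forall w,
  m (scaled b w) = \int[P]_w' (r w' * laplace mu (pair_dist b (w, w'))).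
Proof.
move=> em w; rewrite (embedsE em); apply: eq_Rintegral => w' _.
by rewrite kernel_scaled.
Qed.

Lemma embeds_energy b r m : integrableR P r -> embeds b r m ->
  ip m m = energy r b /\ evaluation b r m = energy r b.
Proof.
move=> ir em; have [Hm mE] := em.
suff E : evaluation b r m = energy r b by rewrite mE.
have [mK [C KC] _] := psd_kernel_laplace b.
have mF := measurable_funM (intR_meas (Rint_pair_prod ir ir).1) mK.
rewrite /energy (@pair_dom_iter _ _ _ P _ (fun x => C * `|r x|) (fun x => `|r x|) mF).
- apply: eq_Rintegral => w _; rewrite (embedsE em).
  rewrite -RintZ; last first.
    have [mK1 [C1 KC1] _] := psd_kernel_laplace b.
    apply: (intR_ext (fun w => mulrC _ _)).
    apply: (intR_bounded_mul _ _ ir (C := C)).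
      under eq_fun do rewrite kernel_scaled; exact: (measurable_slice1 w mK).
    by move=> w'; rewrite kernel_scaled.
  by apply: eq_Rintegral => w' _; rewrite kernel_scaled mulrA.
- exact/intRZ/intR_norm.
- exact: intR_norm.
- by move=> x y /=; rewrite !normrM mulrC mulrA ler_wpM2r// ler_wpM2r.
Qed.

Lemma energy_ge0 r b : integrableR P r -> 0 <= energy r b.
Proof. by move=> ir; have [_ _] := psd_kernel_laplace b; exact. Qed.

(** * The penalised least-squares fit and duality *)

Definition residual b f w : R := Y w - f (scaled b w).

(** The normal equations of the penalised least-squares problem. *)
Definition is_fit b f : Prop :=
  H f /\ forall g, H g -> evaluation b (residual b f) g = lambda * ip f g.

Let iY : integrableR P Y. Proof. exact: intR_sq. Qed.

Lemma residual_meas b f : H f -> measurable_fun setT (residual b f).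
Proof. by move=> Hf; apply: measurable_funB => //; exact: measurable_scaled. Qed.

Lemma residual_int b f : H f -> integrableR P (residual b f).
Proof. by move=> Hf; apply: intRB => //; exact: intR_scaled. Qed.

Lemma residual_sq_int b f : H f -> integrableR P (fun w => residual b f w ^+ 2).
Proof.
by move=> Hf; apply: intR_sqB => //; [exact: measurable_scaled|exact: intR_scaled_sq].
Qed.

(** The penalised risk is a quadratic with the coercive form
    [E (f g) + lambda <f, g>]. *)
Lemma fit_exists b : exists f, is_fit b f.
Proof.
pose a f g := \int[P]_w (f (scaled b w) * g (scaled b w)) + lambda * ip f g.
have fa : sym_form H a.
  split=> [f g Hf Hg|g Hg s f h Hf Hh|f Hf].
  - rewrite /a (rkhs_ipC rk Hf Hg); congr (_ + _).
    by apply: eq_Rintegral => w _; rewrite mulrC.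
  - rewrite /a (rkhs_ip_lin rk)//.
    transitivity (s * (\int[P]_w (f (scaled b w) * g (scaled b w))) +
        \int[P]_w (h (scaled b w) * g (scaled b w)) +
        lambda * (s * ip f g + ip h g)); last by ring.
    congr (_ + _); rewrite -RintZ; last by apply: intR_scaled_mul => //; exact: intR_scaled.
    rewrite -RintD; last 2 first.
      by apply/intRZ/intR_scaled_mul => //; exact: intR_scaled.
      by apply/intR_scaled_mul => //; exact: intR_scaled.
    by apply: eq_Rintegral => w _; ring.
  - rewrite addr_ge0 ?mulr_ge0 ?(ltW lambda0) ?(rkhs_ip_ge0 rk)//.
    by apply: Rint_ge0 => w; rewrite -expr2 sqr_ge0.
have [|||||f Hf fE] := lax_milgram rk fa (c := lambda) (C := mass + lambda)
   (B := (\int[P]_w `|Y w|) ^+ 2 * mass) (L := evaluation b Y).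
- exact: lambda0.
- by rewrite mulr_ge0 ?sqr_ge0 ?(mass_ge0 mu).
- exact: evaluation_linear.
- move=> f Hf; have i0 := rkhs_ip_ge0 rk Hf.
  rewrite /a lerDr mulrDl lerD2r; apply/andP; split.
    by apply: Rint_ge0 => w; rewrite -expr2 sqr_ge0.
  rewrite -[leRHS](Rint_cst P); apply: Rint_le.
  + by apply: intR_scaled_mul => //; exact: intR_scaled.
  + exact: intR_cst.
  + move=> w; rewrite -expr2 -[leRHS]sqr_sqrtr ?mulr_ge0 ?(mass_ge0 mu)//.
    by rewrite -real_normK ?num_real// ler_pXn2r ?nnegrE ?sqrtr_ge0// rkhs_bound.
- by move=> f Hf; exact: evaluation_bounded.
exists f; split => // g Hg; have := fE g Hg; rewrite /a /evaluation => E.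
have -> : \int[P]_w (residual b f w * g (scaled b w)) =
   \int[P]_w (Y w * g (scaled b w)) - \int[P]_w (f (scaled b w) * g (scaled b w)).
  rewrite -RintB; [|exact: intR_scaled_mul|by apply: intR_scaled_mul => //; exact: intR_scaled].
  by apply: eq_Rintegral => w _; rewrite /residual mulrBl.
by rewrite -E addrAC subrr add0r.
Qed.

Lemma risk_E b f : penalized_risk P X Y ip lambda b f =
  2^-1 * \int[P]_w (residual b f w ^+ 2) + lambda / 2 * ip f f.
Proof. by rewrite /penalized_risk unlock. Qed.

Lemma risk_ge0 b f : H f -> 0 <= penalized_risk P X Y ip lambda b f.
Proof.
move=> Hf; rewrite risk_E addr_ge0 ?mulr_ge0 ?invr_ge0 ?(ltW lambda0) ?(rkhs_ip_ge0 rk)//.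
by apply: Rint_ge0 => w; exact: sqr_ge0.
Qed.

Local Notation J := (objective P X Y H ip lambda).

Lemma objective_le_risk b f : H f -> J b <= penalized_risk P X Y ip lambda b f.
Proof.
move=> Hf; apply: ge_inf; last by exists f.
by exists 0 => _ [g Hg <-]; exact: risk_ge0.
Qed.

Lemma objective_ge b (x : R) :
  (forall f, H f -> x <= penalized_risk P X Y ip lambda b f) -> x <= J b.
Proof.
move=> h; apply: lb_le_inf => [|_ [f Hf <-]]; last exact: h.
by exists (penalized_risk P X Y ip lambda b (fun=> 0)), (fun=> 0) => //; exact: (rkhs_zero rk).
Qed.

Lemma objective_ge0 b : 0 <= J b.
Proof. by apply: objective_ge => f; exact: risk_ge0. Qed.

(** The dual of the penalised least-squares problem: Young's inequality for the
    loss, with [r] as dual variable, and for the penalty, with the embedding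
    of [r]. *)
Lemma weak_duality b r : measurable_fun setT r -> integrableR P (fun w => r w ^+ 2) ->
  \int[P]_w (r w * Y w) - 2^-1 * (\int[P]_w r w ^+ 2) - energy r b / (2 * lambda) <= J b.
Proof.
move=> mr ir2; apply: objective_ge => f Hf; rewrite risk_E.
have ir := intR_sq mr ir2.
have [m em] := embedding_exists b ir; have [Hm mE] := em.
have [Em _] := embeds_energy ir em.
have irY : integrableR P (fun w => r w * Y w) by exact: intR_mul_sq.
have irf : integrableR P (fun w => r w * f (scaled b w)) by exact: intR_scaled_mul.
have h1 : \int[P]_w (r w * Y w) - evaluation b r f - 2^-1 * \int[P]_w r w ^+ 2
    <= 2^-1 * \int[P]_w (residual b f w ^+ 2).
  rewrite /evaluation -RintB// -!RintZ//; last exact: residual_sq_int.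
  rewrite -RintB//; [|exact: intRB|exact: intRZ].
  apply: Rint_le; [apply: intRB; [exact: intRB|exact: intRZ]|exact/intRZ/residual_sq_int|].
  move=> w; rewrite /residual; have := sqr_ge0 (Y w - f (scaled b w) - r w); nra.
have h2 : evaluation b r f - energy r b / (2 * lambda) <= lambda / 2 * ip f f.
  rewrite -mE// -Em.
  have := rkhs_ip_ge0 rk (rkhsD rk Hm (rkhsZ rk (- lambda) Hf)).
  rewrite (form_expand rk (rkhs_form rk))// => h.
  have -> : ip m f - ip m m / (2 * lambda) = (2 * lambda * ip m f - ip m m) / (2 * lambda).
    by field; rewrite gt_eqF.
  rewrite ler_pdivrMr ?mulr_gt0//.
  have -> : lambda / 2 * ip f f * (2 * lambda) = lambda ^+ 2 * ip f f by field.
  lra.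
lra.
Qed.

Section Fit.
Variables (b : 'rV[R]_p) (f : 'rV[R]_p -> R).
Hypothesis fitf : is_fit b f.
Local Notation r := (residual b f).

Let Hf : H f. Proof. by case: fitf. Qed.
Let ir : integrableR P r. Proof. exact: residual_int. Qed.
Let ir2 : integrableR P (fun w => r w ^+ 2). Proof. exact: residual_sq_int. Qed.
Let mr : measurable_fun setT r. Proof. exact: residual_meas. Qed.

(** The normal equations identify [lambda * f] with the embedding of its own
    residual, so the residual is the dual optimum. *)
Lemma fit_embeds : embeds b r (fun x => lambda * f x).
Proof.
split; first exact: (rkhsZ rk).
move=> g Hg; rewrite (linear_onZ rk _ (form_lin (rkhs_form rk) Hg) Hf).
by have [_ ->] := fitf.
Qed.

Lemma fit_energy : energy r b = lambda ^+ 2 * ip f f.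
Proof.
have [<- _] := embeds_energy ir fit_embeds.
have HZ := rkhsZ rk lambda Hf.
rewrite (linear_onZ rk _ (form_lin (rkhs_form rk) HZ) Hf).
by rewrite (linear_onZ rk _ (form_linr rk (rkhs_form rk) Hf) Hf) mulrA -expr2.
Qed.

Lemma fit_cross : \int[P]_w (r w * Y w) = \int[P]_w r w ^+ 2 + energy r b / lambda.
Proof.
have -> : energy r b / lambda = evaluation b r f.
  by have [_ ->] := fitf => //; rewrite fit_energy; field; rewrite gt_eqF.
rewrite -RintD//; last exact: intR_scaled_mul.
by apply: eq_Rintegral => w _; rewrite /residual; ring.
Qed.

Lemma objective_fit : J b = 2^-1 * (\int[P]_w r w ^+ 2) + energy r b / (2 * lambda).
Proof.
have l0 : lambda != 0 by rewrite gt_eqF.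
apply/le_anti/andP; split.
  apply: le_trans (objective_le_risk b Hf) _; rewrite risk_E fit_energy.
  by have -> : lambda ^+ 2 * ip f f / (2 * lambda) = lambda / 2 * ip f f by field.
apply: le_trans (weak_duality b mr ir2); rewrite fit_cross.
have -> : energy r b / lambda = 2 * (energy r b / (2 * lambda)) by field.
lra.
Qed.

Lemma objective_le_Y : J b <= 2^-1 * \int[P]_w Y w ^+ 2.
Proof.
apply: le_trans (objective_le_risk b (rkhs_zero rk)) _; rewrite risk_E.
have -> : ip (fun=> 0) (fun=> 0) = 0.
  have H0 := rkhs_zero rk.
  rewrite -[RHS](mul0r (ip (fun=> 0) (fun=> 0))).
  rewrite -(linear_onZ rk 0 (form_lin (rkhs_form rk) H0) H0).
  by congr ip; apply/funext => x; rewrite mulr0.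
rewrite mulr0 addr0 ler_wpM2l ?invr_ge0//.
rewrite le_eqVlt; apply/orP; left; apply/eqP; apply: eq_Rintegral => w _.
by rewrite /residual subr0.
Qed.

Lemma residual_sq_le : \int[P]_w r w ^+ 2 <= \int[P]_w Y w ^+ 2.
Proof.
have := objective_le_Y; rewrite objective_fit.
have : 0 <= energy r b / (2 * lambda).
  by rewrite divr_ge0 ?energy_ge0// mulr_ge0// ltW.
lra.
Qed.

Lemma fit_energy_le : energy r b <= lambda * \int[P]_w Y w ^+ 2.
Proof.
have := objective_le_Y; rewrite objective_fit.
have : 0 <= \int[P]_w r w ^+ 2 by apply: Rint_ge0 => w; exact: sqr_ge0.
move=> h1 h2; have : energy r b / (2 * lambda) <= 2^-1 * \int[P]_w Y w ^+ 2 by lra.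
by rewrite ler_pdivrMr ?mulr_gt0// => h3; lra.
Qed.

(** Moving the scale from [b] to [c] while keeping the dual variable [r] fixed
    bounds the objective on both sides to first order: from below by weak
    duality, from above by the primal function that [r] induces at [c]. *)
Lemma objective_lower c :
  (energy r b - energy r c) / (2 * lambda) <= J c - J b.
Proof.
have := weak_duality c mr ir2; rewrite fit_cross objective_fit.
have l0 : lambda != 0 by rewrite gt_eqF.
move: (energy r b) (energy r c) (\int[P]_w r w ^+ 2) (J c) => Eb Ec A Jc.
have -> : Eb / lambda = 2 * (Eb / (2 * lambda)) by field.
rewrite mulrBl; lra.
Qed.

Lemma objective_upper c m : embeds c r m ->
  J c - J b <= (energy r b - energy r c) / (2 * lambda) +
    (\int[P]_w (lambda * f (scaled b w) - m (scaled c w)) ^+ 2) / (2 * lambda ^+ 2).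
Proof.
move=> em; have [Hm mE] := em; have l0 : lambda != 0 by rewrite gt_eqF.
have := objective_le_risk c (rkhsZ rk lambda^-1 Hm); rewrite risk_E objective_fit.
pose D w := lambda * f (scaled b w) - m (scaled c w).
have [mf mm] := (measurable_scaled b Hf, measurable_scaled c Hm).
have iD2 : integrableR P (fun w => D w ^+ 2).
  apply: intR_sqB; [exact: measurable_funM|exact: mm| |exact: intR_scaled_sq].
  by apply: intR_ext (intRZ (lambda ^+ 2) (intR_scaled_sq b Hf)) => w; rewrite exprMn.
have irf := intR_scaled_mul b Hf ir; have irm := intR_scaled_mul c Hm ir.
have irD : integrableR P (fun w => r w * D w).
  by apply: intR_ext (intRB (intRZ lambda irf) irm) => w; rewrite /D; ring.
have [Em Ev] := embeds_energy ir em.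
have [_ Ef] := embeds_energy ir fit_embeds.
have ErD : \int[P]_w (r w * D w) = energy r b - energy r c.
  rewrite -Ef -Ev /evaluation -RintB//.
    by apply: eq_Rintegral => w _; rewrite /D; ring.
  by apply: intR_ext (intRZ lambda irf) => w; ring.
have -> : \int[P]_w residual c (fun x => lambda^-1 * m x) w ^+ 2 =
   \int[P]_w r w ^+ 2 + 2 / lambda * (energy r b - energy r c) +
   (lambda ^+ 2)^-1 * \int[P]_w (D w ^+ 2).
  have i1 := intRZ (2 / lambda) irD; have i2 := intRZ (lambda ^+ 2)^-1 iD2.
  rewrite -ErD -(RintZ _ irD) -(RintZ _ iD2) -(RintD ir2 i1).
  rewrite -(RintD (intRD ir2 i1) i2).
  by apply: eq_Rintegral => w _; rewrite /residual /D; field.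
have -> : ip (fun x => lambda^-1 * m x) (fun x => lambda^-1 * m x) =
    lambda^-1 * (lambda^-1 * energy r c).
  rewrite -Em; have HZ := rkhsZ rk lambda^-1 Hm.
  rewrite (linear_onZ rk _ (form_lin (rkhs_form rk) HZ) Hm).
  by rewrite (linear_onZ rk _ (form_linr rk (rkhs_form rk) Hm) Hm).
rewrite -/D; move: (energy r b) (energy r c) (J c) => Eb Ec Jc.
move: (\int[P]_w r w ^+ 2) (\int[P]_w D w ^+ 2) => A Q h.
rewrite [X in _ <= X](_ : _ =
  2^-1 * (A + 2 / lambda * (Eb - Ec) + (lambda ^+ 2)^-1 * Q) +
  lambda / 2 * (lambda^-1 * (lambda^-1 * Ec)) -
  (2^-1 * A + Eb / (2 * lambda))); last by field.
by rewrite lerD2r.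
Qed.

End Fit.

(** * First-order expansion of the objective in the scales *)

Variables (A4 BY : R).
Hypotheses (iX4 : forall j, integrableR P (fun w => X j w ^+ 4))
  (EX4 : forall j, \int[P]_w X j w ^+ 4 <= A4)
  (EY2 : \int[P]_w Y w ^+ 2 <= BY).

(** A common dominating weight: both |x - y| and |x - y|^2 are controlled by
    products of [envelope]s, which separate the two independent copies. *)
Definition envelope j w : R := 1 + X j w ^+ 2.

Definition envelope_bound : R := 2 + 2 * A4.
Definition weight_bound : R := (BY + envelope_bound) / 2.

Lemma envelope_ge1 j w : 1 <= envelope j w.
Proof. by rewrite lerDl sqr_ge0. Qed.

Lemma envelope_ge0 j w : 0 <= envelope j w.
Proof. exact: le_trans ler01 (envelope_ge1 j w). Qed.

Lemma envelope_meas j : measurable_fun setT (envelope j).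
Proof. by apply: measurable_funD => //; exact: measurable_funX. Qed.

Lemma envelope_sq_le j w : envelope j w ^+ 2 <= 2 + 2 * X j w ^+ 4.
Proof.
have -> : X j w ^+ 4 = (X j w ^+ 2) ^+ 2 by rewrite -exprM.
by rewrite /envelope; have := sqr_ge0 (1 - X j w ^+ 2); nra.
Qed.

Lemma envelope_sq_int j : integrableR P (fun w => envelope j w ^+ 2).
Proof.
apply: (@intR_le _ _ _ _ _ (fun w => 2 + 2 * X j w ^+ 4)).
- by apply: measurable_funX; exact: envelope_meas.
- by move=> w; rewrite ger0_norm ?sqr_ge0// envelope_sq_le.
- by apply: intRD; [exact: intR_cst|exact: intRZ].
Qed.

Lemma envelope_sq_Rint j : \int[P]_w envelope j w ^+ 2 <= envelope_bound.
Proof.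
apply: (@le_trans _ _ (\int[P]_w (2 + 2 * X j w ^+ 4))).
  apply: Rint_le; [exact: envelope_sq_int| |exact: envelope_sq_le].
  by apply: intRD; [exact: intR_cst|exact: intRZ].
rewrite RintD; [|exact: intR_cst|exact: intRZ].
by rewrite Rint_cst RintZ// lerD2l ler_wpM2l.
Qed.

Lemma envelope_int j : integrableR P (envelope j).
Proof. exact: intR_sq (envelope_meas j) (envelope_sq_int j). Qed.

Lemma envelope_bound_ge0 : (0 < p)%N -> 0 <= envelope_bound.
Proof.
move=> p0; apply: le_trans (envelope_sq_Rint (Ordinal p0)).
by apply: Rint_ge0 => w; exact: sqr_ge0.
Qed.

Lemma X_diff_le j x y : `|X j x - X j y| <= envelope j x * envelope j y.
Proof.
rewrite /envelope; move: (X j x) (X j y) => s t.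
have := sqr_ge0 (`|s| - 1); have := sqr_ge0 (`|t| - 1); rewrite !sqrrB1 !real_normK ?num_real//.
have := ler_normB s t; have := mulr_ge0 (sqr_ge0 s) (sqr_ge0 t); nra.
Qed.

Lemma X_diff_sq_le j x y : `|X j x - X j y| ^+ 2 <= 2 * (envelope j x * envelope j y).
Proof.
rewrite /envelope real_normK ?num_real//; move: (X j x) (X j y) => s t.
have := sqr_ge0 (s + t); have := mulr_ge0 (sqr_ge0 s) (sqr_ge0 t); nra.
Qed.

Section Weights.
Variable r : T -> R.
Hypotheses (mr : measurable_fun setT r) (ir2 : integrableR P (fun w => r w ^+ 2)).

Lemma weight_int j : integrableR P (fun w => `|r w| * envelope j w).
Proof.
apply: intR_mul_sq; [exact: measurableT_comp|exact: envelope_meas| |exact: envelope_sq_int].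
by apply: intR_ext ir2 => w; rewrite real_normK ?num_real.
Qed.

Lemma weight_Rint_le j : \int[P]_w r w ^+ 2 <= BY ->
  \int[P]_w (`|r w| * envelope j w) <= weight_bound.
Proof.
move=> rB; apply: (@le_trans _ _ (\int[P]_w (2^-1 * (r w ^+ 2 + envelope j w ^+ 2)))).
  apply: Rint_le; first exact: weight_int.
    by apply/intRZ/intRD => //; exact: envelope_sq_int.
  move=> w; have := sqr_ge0 (`|r w| - envelope j w).
  rewrite sqrrB real_normK ?num_real//; lra.
rewrite RintZ; last by apply: intRD => //; exact: envelope_sq_int.
rewrite RintD//; last exact: envelope_sq_int.
rewrite /weight_bound mulrC ler_wpM2r ?invr_ge0// lerD//.
exact: envelope_sq_Rint.
Qed.

End Weights.

Lemma weighted_sq_le (a x : 'I_p -> R) : (forall j, 0 <= a j) ->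
  (\sum_j a j * x j) ^+ 2 <= (\sum_j a j) * \sum_j a j * x j ^+ 2.
Proof.
move=> a0; rewrite mulrC; apply: discriminant_le => [|t]; first exact: sumr_ge0.
have -> : \sum_j a j * x j ^+ 2 + 2 * t * (\sum_j a j * x j) + t ^+ 2 * \sum_j a j =
  \sum_j a j * (x j + t) ^+ 2.
  by rewrite !mulr_sumr -!big_split; apply: eq_bigr => j _; rewrite /=; ring.
by apply: sumr_ge0 => j _; rewrite mulr_ge0 ?sqr_ge0.
Qed.

Lemma pair_dist_lip b c z : `|pair_dist b z - pair_dist c z| <=
  \sum_j `|(c - b) 0 j| * `|X j z.1 - X j z.2|.
Proof.
rewrite /pair_dist -sumrB; apply: le_trans (ler_norm_sum _ _ _) _.
apply: ler_sum => j _; apply: le_trans (ler_dist_dist _ _) _.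
rewrite -normrM !mxE -normrN -mulrBr -mulrBr -mulrBl -mulNr opprB.
by [].
Qed.

Lemma pair_distB b c z : orthant b -> orthant c ->
  pair_dist c z - pair_dist b z = \sum_j (c - b) 0 j * `|X j z.1 - X j z.2|.
Proof.
move=> b0 c0; rewrite /pair_dist -sumrB; apply: eq_bigr => j _.
by rewrite -!mulrBr !normrM !mxE (ger0_norm (b0 j)) (ger0_norm (c0 j)) mulrBl.
Qed.

(** Minus the partial derivative of [energy r] at [b]. *)
Definition slope_energy r b j : R := \int[PP]_z (r z.1 * r z.2 *
  (`|X j z.1 - X j z.2| * laplace_slope mu Mmu (pair_dist b z))).

Lemma measurable_pair (r s : T -> R) : measurable_fun setT r -> measurable_fun setT s ->
  measurable_fun setT (fun z : T * T => r z.1 * s z.2).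
Proof.
move=> mr ms; apply: measurable_funM.
- exact: (measurableT_comp mr measurable_fst).
- exact: (measurableT_comp ms measurable_snd).
Qed.

Lemma measurable_X_diff j : measurable_fun setT (fun z : T * T => `|X j z.1 - X j z.2|).
Proof.
apply: measurableT_comp => //; apply: measurable_funB.
- exact: (measurableT_comp (mX j) measurable_fst).
- exact: (measurableT_comp (mX j) measurable_snd).
Qed.

Lemma slope_pair_meas b :
  measurable_fun setT (fun z => laplace_slope mu Mmu (pair_dist b z)).
Proof. by have [] := psd_kernel_slope b. Qed.

Lemma laplace_pair_meas b : measurable_fun setT (fun z => laplace mu (pair_dist b z)).
Proof. by have [] := psd_kernel_laplace b. Qed.

Section Expansion.
Variable r : T -> R.
Hypotheses (mr : measurable_fun setT r) (ir2 : integrableR P (fun w => r w ^+ 2))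
  (rB : \int[P]_w r w ^+ 2 <= BY).

Let ir : integrableR P r. Proof. exact: intR_sq. Qed.

Lemma slope_energy_meas b j : measurable_fun setT (fun z : T * T => r z.1 * r z.2 *
  (`|X j z.1 - X j z.2| * laplace_slope mu Mmu (pair_dist b z))).
Proof.
apply: measurable_funM; first exact: measurable_pair.
by apply: measurable_funM; [exact: measurable_X_diff|exact: slope_pair_meas].
Qed.

Lemma slope_energy_int b j : integrableR PP (fun z : T * T => r z.1 * r z.2 *
  (`|X j z.1 - X j z.2| * laplace_slope mu Mmu (pair_dist b z))).
Proof.
apply: (@pair_dom_int _ _ _ P _ (fun x => Mmu * mass * (`|r x| * envelope j x))
  (fun y => `|r y| * envelope j y) (slope_energy_meas b j)).
- exact/intRZ/weight_int.
- exact: weight_int.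
- move=> x y; rewrite /= !normrM normr_id.
  have h1 := X_diff_le j x y; have h2 := slope_pair_bound b (x, y).
  have -> : Mmu * mass * (`|r x| * envelope j x) * (`|r y| * envelope j y) =
    `|r x| * `|r y| * ((envelope j x * envelope j y) * (Mmu * mass)) by ring.
  by rewrite ler_wpM2l ?mulr_ge0// ler_pM.
Qed.

Lemma energy_int b :
  integrableR PP (fun z : T * T => r z.1 * r z.2 * laplace mu (pair_dist b z)).
Proof.
apply: intR_quadratic ir ir; first exact: laplace_pair_meas.
exact: laplace_pair_bound.
Qed.

(** The second-order remainder of the kernel is quadratic in the change of
    distance; [weighted_sq_le] spreads that square over the coordinates, each of
    which is controlled by its envelope. *)
Lemma energy_taylor b c : orthant b -> orthant c ->
  `|energy r c - energy r b + \sum_j (c - b) 0 j * slope_energy r b j| <=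
  2 * Mmu ^+ 2 * mass * weight_bound ^+ 2 * l1norm (c - b) ^+ 2.
Proof.
move=> b0 c0.
pose a j := `|(c - b) 0 j|.
pose W j (z : T * T) := (`|r z.1| * envelope j z.1) * (`|r z.2| * envelope j z.2).
have iW j : integrableR PP (W j) /\
    \int[PP]_z W j z = (\int[P]_w (`|r w| * envelope j w)) ^+ 2.
  by rewrite expr2; apply: Rint_pair_prod; exact: weight_int.
pose dom z := \sum_j (2 * Mmu ^+ 2 * mass * l1norm (c - b) * a j) * W j z.
have idom : integrableR PP dom.
  by apply: intR_sum => j _; apply: intRZ; have [] := iW j.
pose S z := \sum_j (c - b) 0 j * (r z.1 * r z.2 *
  (`|X j z.1 - X j z.2| * laplace_slope mu Mmu (pair_dist b z))).
have iS : integrableR PP S by apply: intR_sum => j _; exact/intRZ/slope_energy_int.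
have [ib ic] := (energy_int b, energy_int c).
have -> : energy r c - energy r b + \sum_j (c - b) 0 j * slope_energy r b j =
   \int[PP]_z (r z.1 * r z.2 * laplace mu (pair_dist c z) -
      r z.1 * r z.2 * laplace mu (pair_dist b z) + S z).
  rewrite (RintD (intRB ic ib) iS) (RintB ic ib); congr (_ + _).
  rewrite Rint_sum => [|j]; last exact/intRZ/slope_energy_int.
  by apply: eq_bigr => j _; rewrite RintZ//; exact: slope_energy_int.
apply: (@le_trans _ _ (\int[PP]_z dom z)); last first.
  rewrite Rint_sum => [|j]; last by apply: intRZ; have [] := iW j.
  rewrite (_ : 2 * _ * _ * _ * _ = \sum_j 2 * Mmu ^+ 2 * mass * l1norm (c - b) *
      a j * weight_bound ^+ 2); last first.
    rewrite -mulr_suml -mulr_sumr (_ : \sum_j a j = l1norm (c - b))//; ring.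
  apply: ler_sum => j _; have [iWj EWj] := iW j; rewrite (RintZ _ iWj) EWj.
  have k0 : 0 <= \int[P]_w (`|r w| * envelope j w).
    by apply: Rint_ge0 => w; rewrite mulr_ge0 ?envelope_ge0.
  have k1 := weight_Rint_le mr ir2 j rB.
  rewrite ler_wpM2l//; last by rewrite ler_pXn2r ?nnegrE// (le_trans k0).
  apply: mulr_ge0 (normr_ge0 _).
  apply: mulr_ge0 (l1norm_ge0 _).
  exact: mulr_ge0 (mulr_ge0 (ler0n _ 2) (sqr_ge0 _)) (mass_ge0 mu).
apply: Rint_norm_le => //; first exact: (intRD (intRB ic ib) iS).
move=> z; have N0 := pair_dist_ge0 b z; have N1 := pair_dist_ge0 c z.
have -> : S z = r z.1 * r z.2 * (laplace_slope mu Mmu (pair_dist b z) *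
    (pair_dist c z - pair_dist b z)).
  by rewrite (pair_distB _ b0 c0) !mulr_sumr; apply: eq_bigr => j _; ring.
rewrite -mulrBr -mulrDr normrM.
have := laplace_taylor hk N1 N0.
have : (pair_dist c z - pair_dist b z) ^+ 2 <=
    l1norm (c - b) * \sum_j a j * (2 * (envelope j z.1 * envelope j z.2)).
  rewrite (pair_distB _ b0 c0).
  apply: (@le_trans _ _ ((\sum_j a j * `|X j z.1 - X j z.2|) ^+ 2)).
    rewrite -real_normK ?num_real// ler_pXn2r ?nnegrE ?sumr_ge0//; last first.
      by move=> j _; exact: mulr_ge0 (normr_ge0 _) (normr_ge0 _).
    apply: le_trans (ler_norm_sum _ _ _) _; apply: ler_sum => j _.
    by rewrite normrM normr_id.
  apply: le_trans (weighted_sq_le _ _) _ => [j|]; first exact: normr_ge0.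
  rewrite ler_wpM2l ?l1norm_ge0//; apply: ler_sum => j _.
  by rewrite ler_wpM2l ?normr_ge0// X_diff_sq_le.
move: (`|_ - _ + _|) ((_ - _) ^+ 2) => t s h1 h2.
apply: (@le_trans _ _ (`|r z.1 * r z.2| * (Mmu ^+ 2 * mass * (l1norm (c - b) *
   \sum_j a j * (2 * (envelope j z.1 * envelope j z.2)))))).
  rewrite ler_wpM2l//; apply: le_trans h2 _.
  by rewrite ler_wpM2l// mulr_ge0 ?sqr_ge0 ?(mass_ge0 mu).
rewrite /dom; move: (l1norm (c - b)) => n.
rewrite !mulr_sumr; apply: ler_sum => j _; rewrite /W normrM le_eqVlt.
by apply/orP; left; apply/eqP; ring.
Qed.

End Expansion.

Let Mmass_ge0 : 0 <= Mmu * mass.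
Proof. exact: mulr_ge0 (ltW (Mmu_gt0 hk)) (mass_ge0 mu). Qed.

Section Gradient.
Variables (b : 'rV[R]_p) (f : 'rV[R]_p -> R).
Hypotheses (fitf : is_fit b f) (b0 : orthant b) (p0 : (0 < p)%N).
Local Notation r := (residual b f).

Let Hf : H f. Proof. by case: fitf. Qed.
Let ir : integrableR P r. Proof. exact: residual_int. Qed.
Let ir2 : integrableR P (fun w => r w ^+ 2). Proof. exact: residual_sq_int. Qed.
Let mr : measurable_fun setT r. Proof. exact: residual_meas. Qed.
Let rB : \int[P]_w r w ^+ 2 <= BY.
Proof. exact: le_trans (residual_sq_le fitf) EY2. Qed.

Lemma embedding_gap_sq c m : embeds c r m ->
  \int[P]_w (lambda * f (scaled b w) - m (scaled c w)) ^+ 2 <=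
  (Mmu * mass * weight_bound) ^+ 2 * envelope_bound * l1norm (c - b) ^+ 2.
Proof.
move=> em; have [Hm _] := em.
pose a j := `|(c - b) 0 j|.
pose K := Mmu * mass * weight_bound.
have w0 : 0 <= weight_bound.
  apply: le_trans (weight_Rint_le mr ir2 (Ordinal p0) rB).
  by apply: Rint_ge0 => w; rewrite mulr_ge0 ?envelope_ge0.
have K0 : 0 <= K := mulr_ge0 Mmass_ge0 w0.
have mK w e : integrableR P (fun w' => r w' * laplace mu (pair_dist e (w, w'))).
  apply: (intR_ext (fun w => mulrC _ _)).
  apply: (intR_bounded_mul _ _ ir (C := mass)).
    exact: (measurable_slice1 w (laplace_pair_meas e)).
  by move=> w'; exact: laplace_pair_bound.
have key w : `|lambda * f (scaled b w) - m (scaled c w)| <= K * \sum_j a j * envelope j w.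
  rewrite (embeds_scaled em) [lambda * _](embeds_scaled (fit_embeds fitf)).
  rewrite -(RintB (mK w b) (mK w c)).
  have iD : integrableR P (fun w' =>
      \sum_j (Mmu * mass * a j * envelope j w) * (`|r w'| * envelope j w')).
    by apply: intR_sum => j _; exact/intRZ/weight_int.
  apply: (@le_trans _ _ (\int[P]_w' \sum_j (Mmu * mass * a j * envelope j w) *
      (`|r w'| * envelope j w'))).
    apply: Rint_norm_le => //; first exact: (intRB (mK w b) (mK w c)).
    move=> w'; rewrite -mulrBr normrM.
    have := laplace_lip hk (pair_dist_ge0 b (w, w')) (pair_dist_ge0 c (w, w')).
    move: (`|_ - laplace mu _|) => t ht.
    apply: (@le_trans _ _ (`|r w'| * (Mmu * mass *
        \sum_j a j * (envelope j w * envelope j w')))); last first.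
      rewrite !mulr_sumr; apply: ler_sum => j _; rewrite le_eqVlt.
      by apply/orP; left; apply/eqP; ring.
    rewrite ler_wpM2l//; apply: le_trans ht _.
    rewrite (ler_wpM2l Mmass_ge0)//.
    apply: le_trans (pair_dist_lip _ _ _) _; apply: ler_sum => j _.
    by rewrite ler_wpM2l// X_diff_le.
  rewrite Rint_sum => [|j]; last exact/intRZ/weight_int.
  rewrite mulr_sumr; apply: ler_sum => j _; rewrite RintZ; last exact: weight_int.
  have -> : K * (a j * envelope j w) = Mmu * mass * a j * envelope j w * weight_bound.
    by rewrite /K; ring.
  rewrite ler_wpM2l ?weight_Rint_le//.
  exact: mulr_ge0 (mulr_ge0 Mmass_ge0 (normr_ge0 _)) (envelope_ge0 _ _).
have iE : integrableR P (fun w => K ^+ 2 * l1norm (c - b) * \sum_j a j * envelope j w ^+ 2).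
  by apply: intRZ; apply: intR_sum => j _; exact/intRZ/envelope_sq_int.
apply: (@le_trans _ _ (\int[P]_w (K ^+ 2 * l1norm (c - b) * \sum_j a j * envelope j w ^+ 2))).
  apply: Rint_le => //.
    apply: intR_sqB; [|exact: measurable_scaled| |exact: intR_scaled_sq].
      by apply: measurable_funM => //; exact: measurable_scaled.
    by apply: intR_ext (intRZ (lambda ^+ 2) (intR_scaled_sq b Hf)) => w; rewrite exprMn.
  move=> w; rewrite -real_normK ?num_real//.
  apply: (@le_trans _ _ ((K * \sum_j a j * envelope j w) ^+ 2)).
    rewrite ler_pXn2r ?nnegrE// mulr_ge0// sumr_ge0// => j _.
    exact: mulr_ge0 (normr_ge0 _) (envelope_ge0 _ _).
  rewrite exprMn -mulrA ler_wpM2l ?sqr_ge0//; apply: weighted_sq_le => j.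
  exact: normr_ge0.
rewrite RintZ; last by apply: intR_sum => j _; exact/intRZ/envelope_sq_int.
rewrite Rint_sum => [|j]; last exact/intRZ/envelope_sq_int.
rewrite -/K expr2 [l1norm _ ^+ 2]expr2.
apply: (@le_trans _ _ (K * K * l1norm (c - b) * (l1norm (c - b) * envelope_bound))); last first.
  by rewrite le_eqVlt; apply/orP; left; apply/eqP; ring.
apply: (ler_wpM2l (mulr_ge0 (mulr_ge0 K0 K0) (l1norm_ge0 _))).
rewrite (_ : l1norm (c - b) = \sum_j a j)// mulr_suml; apply: ler_sum => j _.
rewrite (RintZ _ (envelope_sq_int j)).
exact: (ler_wpM2l (normr_ge0 _) (envelope_sq_Rint j)).
Qed.

Definition gradient : 'rV[R]_p := \row_j (slope_energy r b j / (2 * lambda)).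

(** The first term is the curvature of the energy, the second one the gap between
    the two sides of the dual bound. *)
Definition curvature : R := Mmu ^+ 2 * mass * weight_bound ^+ 2 / lambda +
  (Mmu * mass * weight_bound) ^+ 2 * envelope_bound / 2 / lambda ^+ 2.

Lemma objective_expansion c : orthant c ->
  `|objective P X Y H ip lambda c - objective P X Y H ip lambda b - dot gradient (c - b)|
  <= curvature * l1norm (c - b) ^+ 2.
Proof.
move=> c0; have [m em] := embedding_exists c ir.
have := energy_taylor mr ir2 rB b0 c0.
have := objective_lower fitf c; have := objective_upper fitf em.
have := embedding_gap_sq em.
have -> : dot gradient (c - b) =
    (\sum_j (c - b) 0 j * slope_energy r b j) / (2 * lambda).
  by rewrite mulr_suml; apply: eq_bigr => j _; rewrite !mxE; ring.
have E0 := mulr_ge0 (sqr_ge0 (Mmu * mass * weight_bound)) (envelope_bound_ge0 p0).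
rewrite -[2 * Mmu ^+ 2 * mass]mulrA -[2 * (Mmu ^+ 2 * mass) * _]mulrA.
exact: sandwich_expansion lambda0 E0.
Qed.

End Gradient.

(** The penalty is linear on the orthant. *)
Lemma objective_gamma_expansion (gamma : R) b f c : (0 < p)%N ->
  is_fit b f -> orthant b -> orthant c ->
  `|objective_gamma P X Y H ip lambda gamma c -
    objective_gamma P X Y H ip lambda gamma b -
    dot (gradient b f + const_mx gamma) (c - b)| <= curvature * l1norm (c - b) ^+ 2.
Proof.
move=> p0 fitf b0 c0; have := objective_expansion fitf b0 p0 c0.
congr (`|_| <= _); rewrite /objective_gamma dotDl.
have -> : dot (const_mx gamma) (c - b) = gamma * (l1norm c - l1norm b).
  rewrite /l1norm -sumrB mulr_sumr; apply: eq_bigr => j _.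
  by rewrite !mxE !ger0_norm.
ring.
Qed.

Lemma gradient_objective_gamma (gamma : R) b f l : is_fit b f -> orthant b ->
  partial_orthant (objective_gamma P X Y H ip lambda gamma) b l =
  gradient b f 0 l + gamma.
Proof.
move=> fitf b0; have p0 : (0 < p)%N := leq_ltn_trans (leq0n l) (ltn_ord l).
rewrite (@partial_orthant_expansion _ _ _ _ (gradient b f + const_mx gamma) curvature)//.
  by rewrite !mxE.
by move=> c c0; exact: objective_gamma_expansion.
Qed.

Lemma curvature_ge0 : (0 < p)%N -> 0 <= curvature.
Proof.
move=> p0; rewrite /curvature; apply: addr_ge0.
  apply: mulr_ge0; last by rewrite invr_ge0 ltW.
  exact: mulr_ge0 (mulr_ge0 (sqr_ge0 _) (mass_ge0 mu)) (sqr_ge0 _).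
apply: mulr_ge0; last by rewrite invr_ge0 sqr_ge0.
by apply: mulr_ge0 => //; exact: mulr_ge0 (sqr_ge0 _) (envelope_bound_ge0 p0).
Qed.

(** The factor [p] converts the squared l1 norm of the expansion to the squared
    Euclidean norm that governs the descent. *)
Theorem stationary_cluster (M gamma alpha : R) (b : nat -> 'rV[R]_p) beta f :
  (0 < p)%N -> 0 < M -> 0 <= gamma -> 0 < alpha -> 2 * (alpha * (curvature * p%:R)) <= 1 ->
  projected_gradient_descent (objective_gamma P X Y H ip lambda gamma)
    (l1_ball_orthant M) alpha b ->
  cluster (b @ \oo) beta -> is_fit beta f ->
  l1_ball_orthant M beta /\
  forall c, l1_ball_orthant M c ->
    0 <= dot (gradient beta f + const_mx gamma) (c - beta).
Proof.
move=> p0 M0 g0 a0 aL [b0 bS] cb fitf.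
set F := objective_gamma P X Y H ip lambda gamma in bS.
have F0 c : l1_ball_orthant M c -> 0 <= F c.
  by move=> _; rewrite addr_ge0 ?objective_ge0// mulr_ge0// l1norm_ge0.
have gradE c e : orthant c -> is_fit c e -> grad_orthant F c = gradient c e + const_mx gamma.
  by move=> c0 fe; apply/rowP => j; rewrite !mxE (gradient_objective_gamma _ _ fe)// !mxE.
have FG c e : l1_ball_orthant M c -> l1_ball_orthant M e ->
    `|F e - F c - dot (grad_orthant F c) (e - c)| <=
    curvature * p%:R * dot (e - c) (e - c).
  move=> [c0 _] [e0 _]; have [g fg] := fit_exists c; rewrite (gradE c g)//.
  apply: (@le_trans _ _ (curvature * l1norm (e - c) ^+ 2)); last first.
    by rewrite -mulrA; apply: (ler_wpM2l (curvature_ge0 p0)); exact: l1norm_sq_le.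
  exact: objective_gamma_expansion.
have K0 : 0 <= curvature * p%:R by apply: mulr_ge0 (curvature_ge0 p0) (ler0n _ _).
have Bb : l1_ball_orthant M beta by exact: (cluster_in_ball M0 b0 bS cb).
split=> // c Bc; rewrite -(gradE beta f)//; last by have [] := Bb.
exact: (cluster_stationary M0 K0 a0 aL F0 FG b0 bS cb Bc).
Qed.

End Objective.

(** * Independence of one signal coordinate from the others *)

Section Independence.
Context (R : realType) d (T : measurableType d) (P : probability T R) (p : nat)
  (X : 'I_p -> T -> R).
Hypothesis mX : forall j, measurable_fun setT (X j).

Implicit Types (A S : {set 'I_p}).

Definition coord_events (A : {set 'I_p}) : set (set T) :=
  \bigcup_(j in [set` A]) preimage_set_system setT (X j) measurable.

Lemma sigma_coords_gen A j (C : set R) : j \in A -> measurable C ->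
  sigma_coords X A (X j @^-1` C).
Proof.
move=> jA mC; apply: sub_sigma_algebra; exists j => //=; exists C => //.
by rewrite setTI.
Qed.

Lemma sigma_coords_measurable A : sigma_coords X A `<=` measurable.
Proof.
apply: smallest_sub; first exact: sigma_algebra_measurable.
move=> _ [j _ [C mC <-]]; rewrite setTI -[X in measurable X]setTI.
exact: mX.
Qed.

Lemma sigma_coordsI A : setI_closed (sigma_coords X A).
Proof.
move=> U V mU mV.
exact: (@measurableI _ (g_sigma_algebraType (coord_events A)) U V mU mV).
Qed.

Lemma sigma_coordsT A : sigma_coords X A setT.
Proof. exact: (@measurableT _ (g_sigma_algebraType (coord_events A))). Qed.

(** The intersections of a product of coordinate events inside [S], unconstrained
    at [l], with an event of the coordinates outside [S] form a pi-system that
    generates the events not involving [l]; on it the two independence assumptions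
    give the product rule. *)
Lemma indep_coord (S : {set 'I_p}) (l : 'I_p) : l \in S ->
  mutually_independent P X S ->
  indep_systems P (sigma_coords X S) (sigma_coords X (~: S)%SET) ->
  forall (C : set R) B, measurable C -> sigma_coords X (~: [set l])%SET B ->
  (P (X l @^-1` C `&` B) = P (X l @^-1` C) * P B)%E.
Proof.
move=> lS mutS indS C B mC sB.
have mXC j (D : set R) : measurable D -> measurable (X j @^-1` D).
  by move=> mD; rewrite -[X in measurable X]setTI; exact: mX.
pose box (D : 'I_p -> set R) := \bigcap_(j in [set` S]) X j @^-1` D j.
pose G : set (set T) := [set U | exists D V, [/\ forall j, measurable (D j),
  D l = setT, sigma_coords X (~: S)%SET V & U = box D `&` V]].
have boxS D : (forall j, measurable (D j)) -> sigma_coords X S (box D).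
  move=> mD.
  apply: (@fin_bigcap_measurable _ (g_sigma_algebraType (coord_events S)) _ [set` S]).
    exact: finite_finset.
  by move=> j jS; exact: sigma_coords_gen.
have boxT : box (fun=> setT) = setT by apply/seteqP; split => // w _ j _.
have GB : sigma_coords X (~: [set l])%SET `<=` <<s G >>.
  apply: smallest_sub; first exact: smallest_sigma_algebra.
  move=> _ [j /= jl [D mD <-]]; rewrite setTI; apply: sub_sigma_algebra.
  have {}jl : j != l by move: jl; rewrite !inE.
  have [jS|jS] := boolP (j \in S).
    exists (fun i => if i == j then D else setT), setT; split.
    - by move=> i; case: ifP.
    - by rewrite eq_sym (negbTE jl).
    - exact: sigma_coordsT.
    - rewrite setIT; apply/seteqP; split => [w Dw i _ /=|w /(_ j jS)/=].
        by case: eqP => // ->.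
      by rewrite eqxx.
  exists (fun=> setT), (X j @^-1` D); split => //.
    by apply: sigma_coords_gen => //; rewrite inE.
  by rewrite boxT setTI.
have prodS D : (forall j, measurable (D j)) -> D l = setT ->
    (P (X l @^-1` C `&` box D) = P (X l @^-1` C) * P (box D))%E.
  move=> mD Dl; pose E j := if j == l then C else D j.
  have mE j : measurable (E j) by rewrite /E; case: ifP.
  have -> : X l @^-1` C `&` box D = box E.
    apply/seteqP; split => [w [Cw Dw] j jS|w Ew]; rewrite /E.
      by case: eqP => [->//|_]; exact: Dw.
    split; first by have := Ew l lS; rewrite /E /= eqxx.
    move=> j jS; have := Ew j jS; rewrite /E /=; case: eqP => // -> _.
    by rewrite Dl.
  have El : E l = C by rewrite /E eqxx.
  have -> : P (box E) = (\prod_(j in S) P (X j @^-1` E j))%E := mutS E mE.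
  have -> : P (box D) = (\prod_(j in S) P (X j @^-1` D j))%E := mutS D mD.
  rewrite (bigD1 l)//= [in RHS](bigD1 l)//= El Dl preimage_setT.
  rewrite probability_setT mul1e; congr (_ * _)%E.
  by apply: eq_bigr => j /andP[_ /negbTE jl]; rewrite /E jl.
have PC := mXC l _ mC.
pose m1 : {measure set T -> \bar R} := mrestr P PC.
have PCfin : (P (X l @^-1` C) \is a fin_num)%E by exact: fin_num_measure.
have PC0 : 0 <= fine (P (X l @^-1` C)) by rewrite fine_ge0.
pose m2 : {measure set T -> \bar R} := mscale (NngNum PC0) P.
have key : forall U, <<s G >> U -> m1 U = m2 U.
  apply: (@g_sigma_algebra_measure_unique _ _ _ G _ (fun=> setT) _ _ m1 m2).
  - move=> _ [D [V [mD _ sV ->]]]; apply: measurableI.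
      exact: (sigma_coords_measurable (boxS _ mD)).
    exact: (sigma_coords_measurable sV).
  - move=> _; exists (fun=> setT), setT; split => //; last by rewrite boxT setTI.
    exact: sigma_coordsT.
  - by apply/seteqP; split => // w _; exists 0%N.
  - move=> _ _ [D [V [mD Dl sV ->]]] [D' [V' [mD' Dl' sV' ->]]].
    exists (fun j => D j `&` D' j), (V `&` V'); split.
    + by move=> j; exact: measurableI.
    + by rewrite Dl Dl' setTI.
    + exact: sigma_coordsI.
    + rewrite setIACA; congr (_ `&` _); apply/seteqP; split.
        by move=> w [Dw Dw'] j jS; split; [exact: Dw|exact: Dw'].
      by move=> w Dw; split => j jS; have [] := Dw j jS.
  - move=> _ [D [V [mD Dl sV ->]]]; rewrite /m1 /m2 /= /mrestr /mscale /=.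
    rewrite setIC setIA indS//; last first.
      by apply: sigma_coordsI; [exact: sigma_coords_gen|exact: boxS].
    by rewrite (indS _ _ (boxS _ mD) sV) prodS// muleA fineK.
  - have -> : m1 setT = P (X l @^-1` C) by rewrite /m1 /= /mrestr setTI.
    by rewrite -ge0_fin_numE.
have := key B (GB _ sB); rewrite /m1 /m2 /= /mrestr /mscale /= setIC => ->.
by rewrite fineK.
Qed.

Definition coord_meas A (v : T -> R) : Prop :=
  @measurable_fun _ _ (g_sigma_algebraType (coord_events A)) R setT v.

Lemma coord_meas_preimage A v (C : set R) : coord_meas A v -> measurable C ->
  sigma_coords X A (v @^-1` C).
Proof. by move=> mv mC; have := mv measurableT C mC; rewrite setTI. Qed.

Lemma coord_meas_measurable A v : coord_meas A v -> measurable_fun setT v.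
Proof.
move=> mv _ C mC; rewrite setTI; apply: sigma_coords_measurable.
exact: coord_meas_preimage mv mC.
Qed.

Lemma coord_measX A j : j \in A -> coord_meas A (X j).
Proof. by move=> jA _ C mC; rewrite setTI; exact: sigma_coords_gen. Qed.

Lemma coord_meas_sub A S v : A \subset S -> coord_meas A v -> coord_meas S v.
Proof.
move=> AS mv _ C mC; rewrite setTI.
have := coord_meas_preimage mv mC; apply: smallest_sub.
  exact: smallest_sigma_algebra.
move=> _ [j jA [D mD <-]]; rewrite setTI; apply: sigma_coords_gen => //.
exact: (fintype.subsetP AS _ jA).
Qed.

Lemma coord_meas_l1_continuous A q (F : 'rV[R]_q -> R) (z : 'I_q -> T -> R) :
  l1_continuous F -> (forall j, coord_meas A (z j)) ->
  coord_meas A (fun w => F (\row_j z j w)).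
Proof.
exact: (@measurable_l1_continuous_comp _ (g_sigma_algebraType (coord_events A))).
Qed.

(** The defining property of a variable with zero conditional mean given all
    coordinates, in terms of real-valued integrals. *)
Definition coord_noise (xi : T -> R) : Prop := integrableR P xi /\
  forall B, sigma_coords X [set: 'I_p]%SET B -> \int[P]_w (xi w * \1_B w) = 0.

Lemma coord_noise_mul xi v (C : R) : coord_noise xi -> coord_meas [set: 'I_p]%SET v ->
  (forall w, `|v w| <= C) -> \int[P]_w (xi w * v w) = 0.
Proof.
move=> [ixi xi0] mv vC; apply: (Rint_orthogonal (coord_meas_measurable mv) ixi).
  apply: (intR_ext (fun w => mulrC _ _)).
  exact: (intR_bounded_mul (coord_meas_measurable mv) vC ixi).
by move=> D mD; apply: xi0; exact: coord_meas_preimage mv mD.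
Qed.

Section Factorisation.
Variable l : 'I_p.
Hypothesis indl : forall (C : set R) B, measurable C ->
  sigma_coords X (~: [set l])%SET B ->
  (P (X l @^-1` C `&` B) = P (X l @^-1` C) * P B)%E.

Let mXC (C : set R) : measurable C -> measurable (X l @^-1` C).
Proof. by move=> mC; rewrite -[X in measurable X]setTI; exact: mX. Qed.

Lemma Rint_indic (B : set T) : measurable B -> \int[P]_w \1_B w = fine (P B).
Proof. by move=> mB; rewrite /Rintegral integral_indic// setIT. Qed.

Lemma indic_int (B : set T) : measurable B -> integrableR P (\1_B : T -> R).
Proof.
move=> mB; apply: (@intR_bounded _ _ _ P 1); first exact: measurable_indic.
by move=> w; rewrite indicE; case: (_ \in _); rewrite ?normr1 ?normr0.
Qed.

Lemma indic_mul_int (B : set T) g : measurable B -> integrableR P g ->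
  integrableR P (fun w => \1_B w * g w).
Proof.
move=> mB ig; apply: (intR_bounded_mul (C := 1) _ _ ig).
  exact: measurable_indic.
by move=> w; rewrite indicE; case: (_ \in _); rewrite ?normr1 ?normr0.
Qed.

Lemma Rint_indep_indic (C : set R) g : measurable C ->
  coord_meas (~: [set l])%SET g -> integrableR P g ->
  \int[P]_w (\1_(X l @^-1` C) w * g w) = fine (P (X l @^-1` C)) * \int[P]_w g w.
Proof.
move=> mC mg ig; set A := X l @^-1` C; set a := fine (P A).
have mA : measurable A := mXC mC.
have i1 : integrableR P (fun w => \1_A w - a).
  by apply: intRB; [exact: indic_int|exact: intR_cst].
have iAg := indic_mul_int mA ig.
have : \int[P]_w ((\1_A w - a) * g w) = 0.
  apply: (Rint_orthogonal (coord_meas_measurable mg) i1).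
    by apply: intR_ext (intRB iAg (intRZ a ig)) => w; ring.
  move=> D mD; have sD := coord_meas_preimage mg mD.
  have mgD : measurable (g @^-1` D) := sigma_coords_measurable sD.
  transitivity (\int[P]_w (\1_(A `&` g @^-1` D) w - a * \1_(g @^-1` D) w)).
    by apply: eq_Rintegral => w _; rewrite indicI /=; ring.
  rewrite RintB; [|exact/indic_int/measurableI|exact/intRZ/indic_int].
  rewrite RintZ; last exact: indic_int.
  rewrite !Rint_indic//; last exact: measurableI.
  by rewrite indl// fineM ?fin_num_measure// subrr.
move=> E; transitivity (\int[P]_w (\1_A w * g w - a * g w) + a * \int[P]_w g w).
  by rewrite (RintB iAg (intRZ a ig)) RintZ// subrK.
rewrite -[RHS]add0r -E; congr (_ + _); apply: eq_Rintegral => w _; ring.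
Qed.

(** The part of the residual that does not come from [l] has this shape.  It is in
    general not independent of [X l], because the noise may depend on it, but it
    is independent in mean. *)
Definition splits (zeta : T -> R) : Prop := measurable_fun setT zeta /\
  exists g xi, [/\ coord_meas (~: [set l])%SET g, integrableR P g,
    coord_noise xi & {ae P, forall w, zeta w = g w + xi w}].

Lemma splits_int zeta : splits zeta -> integrableR P zeta.
Proof.
move=> [mz [g [xi [mg ig [ixi _] zE]]]].
have iD := intRD ig ixi; apply/integrableP; split; first exact/measurable_EFinP.
have [mD] := integrableP _ _ _ iD; congr (_ < _)%E.
apply: ae_eq_integral => //.
- by apply: measurableT_comp => //; exact/measurable_EFinP.
- by apply: measurableT_comp => //; exact/measurable_EFinP.
- by apply: filterS zE => w /= zw _; rewrite zw.
Qed.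

(** For an event [u (X l) \in D], the noise averages out against [v] times the
    indicator, and the rest is independent of [X l]; [Rint_orthogonal] passes from
    indicators to [u]. *)
Lemma Rint_factor zeta (u : R -> R) v (C : R) : splits zeta ->
  measurable_fun setT u -> integrableR P (u \o X l) ->
  integrableR P (fun w => zeta w * u (X l w)) ->
  coord_meas (~: [set l])%SET v -> (forall w, `|v w| <= C) ->
  \int[P]_w (zeta w * u (X l w) * v w) =
  \int[P]_w u (X l w) * \int[P]_w (zeta w * v w).
Proof.
move=> sz mu iu izu mv vC; have iz := splits_int sz.
have [mz [g [xi [mg ig nxi zE]]]] := sz; have [ixi _] := nxi.
have mvT := coord_meas_measurable mv; have mgT := coord_meas_measurable mg.
have izv : integrableR P (fun w => zeta w * v w).
  by apply: (intR_ext (fun w => mulrC _ _)); exact: (intR_bounded_mul mvT vC iz).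
have igv : integrableR P (fun w => g w * v w).
  by apply: (intR_ext (fun w => mulrC _ _)); exact: (intR_bounded_mul mvT vC ig).
have mgv : coord_meas (~: [set l])%SET (fun w => g w * v w).
  exact: (@measurable_funM _ (g_sigma_algebraType (coord_events (~: [set l])))).
have sub : (~: [set l])%SET \subset [set: 'I_p]%SET by apply/fintype.subsetP => j _; rewrite inE.
have ind D : measurable D -> \int[P]_w (\1_(X l @^-1` D) w * (zeta w * v w)) =
    \int[P]_w (\1_(X l @^-1` D) w * (g w * v w)).
  move=> mD; have mA := mXC mD.
  have mI : measurable_fun setT (\1_(X l @^-1` D) : T -> R) by exact: measurable_indic.
  transitivity (\int[P]_w (\1_(X l @^-1` D) w * (g w * v w) +
     xi w * (\1_(X l @^-1` D) w * v w))).
    apply: Rint_ae_eq.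
    - by apply: measurable_funM => //; exact: measurable_funM.
    - apply: measurable_funD; first by apply: measurable_funM => //; exact: measurable_funM.
      apply: measurable_funM; first exact: intR_meas ixi.
      exact: measurable_funM.
    - by apply: filterS zE => w ->; ring.
  have mIv : coord_meas [set: 'I_p]%SET (fun w => \1_(X l @^-1` D) w * v w).
    apply: (@measurable_funM _ (g_sigma_algebraType (coord_events [set: 'I_p]))).
      apply: measurable_indic.
      exact: (sigma_coords_gen (A := [set: 'I_p]%SET) (finset.in_setT l) mD).
    exact: coord_meas_sub sub mv.
  have vC' w : `|\1_(X l @^-1` D) w * v w| <= C.
    rewrite indicE; case: (_ \in _); rewrite ?mul1r ?mul0r ?normr0//.
    exact: le_trans (normr_ge0 (v w)) (vC w).
  rewrite RintD; first by rewrite (coord_noise_mul nxi mIv vC') addr0.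
  - exact: indic_mul_int.
  - apply: (intR_ext (fun w => mulrC _ _)).
    exact: (intR_bounded_mul (coord_meas_measurable mIv) vC' ixi).
have Ev : \int[P]_w (zeta w * v w) = \int[P]_w (g w * v w).
  have := ind _ measurableT; rewrite preimage_setT => E.
  rewrite -[LHS]/(\int[P]_w (zeta w * v w)).
  transitivity (\int[P]_w (\1_[set: T] w * (zeta w * v w))).
    by apply: eq_Rintegral => w _; rewrite indicT mul1r.
  by rewrite E; apply: eq_Rintegral => w _; rewrite indicT mul1r.
set z := \int[P]_w (zeta w * v w).
have i1 : integrableR P (fun w => zeta w * v w - z) by apply: intRB => //; exact: intR_cst.
have izuv : integrableR P (fun w => zeta w * u (X l w) * v w).
  by apply: (intR_ext (fun w => mulrC _ _)); exact: (intR_bounded_mul mvT vC izu).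
have muX : measurable_fun setT (fun w => u (X l w)) by exact: measurableT_comp.
have : \int[P]_w ((zeta w * v w - z) * u (X l w)) = 0.
  apply: (Rint_orthogonal muX i1).
    by apply: intR_ext (intRB izuv (intRZ z iu)) => w; rewrite /=; ring.
  move=> D mD; have muD : measurable (u @^-1` D).
    by rewrite -[X in measurable X]setTI; exact: mu.
  have -> : (fun w => u (X l w)) @^-1` D = X l @^-1` (u @^-1` D) by [].
  have mA := mXC muD.
  transitivity (\int[P]_w (\1_(X l @^-1` (u @^-1` D)) w * (zeta w * v w) -
      z * \1_(X l @^-1` (u @^-1` D)) w)).
    by apply: eq_Rintegral => w _; ring.
  rewrite RintB; [|exact: indic_mul_int|exact/intRZ/indic_int].
  rewrite ind// (Rint_indep_indic muD mgv igv) (RintZ _ (indic_int mA)) Rint_indic//.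
  by rewrite -Ev -/z mulrC subrr.
move=> E; transitivity (\int[P]_w (zeta w * u (X l w) * v w - z * u (X l w)) +
    z * \int[P]_w u (X l w)).
  by rewrite (RintB izuv (intRZ z iu)) (RintZ _ iu) subrK.
rewrite [RHS]mulrC -[RHS]add0r -E; congr (_ + _); apply: eq_Rintegral => w _; ring.
Qed.

Lemma splits1 : splits (fun=> 1).
Proof.
split; first exact: measurable_cst.
exists (fun=> 1), (fun=> 0); split.
- exact: (@measurable_cst _ _ (g_sigma_algebraType (coord_events (~: [set l])))).
- exact: intR_cst.
- split; first exact: intR_cst.
  by move=> B _; apply: Rint_eq0 => w; rewrite mul0r.
- by apply: aeW => w; rewrite addr0.
Qed.

Lemma coord_meas_scale (b : 'rV[R]_p) : b 0 l = 0 ->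
  forall j, coord_meas (~: [set l])%SET (fun w => b 0 j * X j w).
Proof.
move=> bl j.
have [->|jl] := eqVneq j l.
  under eq_fun do rewrite bl mul0r.
  exact: (@measurable_cst _ _ (g_sigma_algebraType (coord_events (~: [set l])))).
have mj : coord_meas (~: [set l])%SET (X j) by apply: coord_measX; rewrite !inE.
exact: (@measurable_funM _ (g_sigma_algebraType (coord_events (~: [set l])))).
Qed.

Section Separation.
Variables (b : 'rV[R]_p) (phi : R -> R) (C K : R).
Hypotheses (bl : b 0 l = 0) (K0 : 0 <= K).
Hypotheses (phiC : forall u, 0 <= u -> `|phi u| <= C)
  (phiK : forall u v, 0 <= u -> 0 <= v -> `|phi u - phi v| <= K * `|u - v|)
  (mphi : measurable_fun setT (fun z => phi (pair_dist X b z))).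
Local Notation kphi := (fun z => phi (pair_dist X b z)).
Local Notation PP := (square_prob P).
Local Notation q := (envelope X l).

Let phiz z : `|kphi z| <= C. Proof. exact/phiC/pair_dist_ge0. Qed.

Let C0 : 0 <= C. Proof. exact: le_trans (normr_ge0 _) (phiC (lexx 0)). Qed.

Let mbX := coord_meas_scale bl.

Lemma l1_dist_lip n (x y a : 'rV[R]_n) :
  `|\sum_j `|x 0 j - a 0 j| - \sum_j `|y 0 j - a 0 j| | <= l1norm (x - y).
Proof.
rewrite -sumrB; apply: le_trans (ler_norm_sum _ _ _) _; apply: ler_sum => j _.
apply: le_trans (ler_dist_dist _ _) _; rewrite opprB addrA subrK !mxE.
exact: lexx.
Qed.

(** Averages of the kernel over one copy do not involve the coordinate [l] of the
    other copy, because the scale of that coordinate is zero. *)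
Lemma coord_meas_average zeta : integrableR P zeta ->
  coord_meas (~: [set l])%SET (fun w => \int[P]_w' (zeta w' * kphi (w, w'))).
Proof.
move=> iz.
pose a w' : 'rV[R]_p := \row_j (b 0 j * X j w').
pose N (x : 'rV[R]_p) w' := \sum_j `|x 0 j - a w' 0 j|.
have N0 x w' : 0 <= N x w' by apply: sumr_ge0.
have mN x : measurable_fun setT (N x).
  apply: measurable_sum => j; apply: measurableT_comp => //.
  apply: measurable_funB => //; under eq_fun do rewrite mxE.
  exact: measurable_funM.
have mphi0 : measurable_fun setT (fun u : R => phi `|u|).
  apply: continuous_measurable_fun => u; apply/cvgrPdist_lt => e e0; near=> v.
  apply: le_lt_trans (phiK (normr_ge0 _) (normr_ge0 _)) _.
  apply: (@le_lt_trans _ _ ((K + 1) * `|u - v|)).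
    apply: ler_pM => //; first by rewrite lerDl.
    exact: ler_dist_dist.
  rewrite mulrC -ltr_pdivlMr ?ltr_wpDl//.
  near: v; apply: cvgr_dist_lt; last by rewrite divr_gt0 ?ltr_wpDl.
  exact: cvg_id.
have ip x : integrableR P (fun w' => zeta w' * phi (N x w')).
  apply: (intR_ext (fun w => mulrC _ _)); apply: (intR_bounded_mul (C := C) _ _ iz).
    under eq_fun do rewrite -(ger0_norm (N0 x _)).
    exact: (measurableT_comp mphi0).
  by move=> w; exact: phiC.
pose F x := \int[P]_w' (zeta w' * phi (N x w')).
have -> : (fun w => \int[P]_w' (zeta w' * kphi (w, w'))) =
    (fun w => F (\row_j (b 0 j * X j w))).
  apply/funext => w; apply: eq_Rintegral => w' _; congr (_ * phi _).
  by apply: eq_bigr => j _; rewrite !mxE.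
apply: coord_meas_l1_continuous mbX.
move=> x e e0.
pose A := K * \int[P]_w `|zeta w| + 1.
have A0 : 0 < A by rewrite ltr_wpDl// mulr_ge0// Rint_ge0.
exists (e / A) => [|y yx]; first by rewrite divr_gt0.
rewrite /F -RintB//.
apply: (@le_lt_trans _ _ (A * l1norm (y - x))); last by rewrite mulrC -ltr_pdivlMr.
apply: (@le_trans _ _ (\int[P]_w' (K * l1norm (y - x) * `|zeta w'|))).
  apply: Rint_norm_le; [exact: intRB|exact/intRZ/intR_norm|].
  move=> w'; rewrite -mulrBr normrM mulrC ler_wpM2r//.
  apply: le_trans (phiK (N0 _ _) (N0 _ _)) _; rewrite ler_wpM2l//.
  exact: l1_dist_lip.
rewrite RintZ; last exact: intR_norm.
by rewrite mulrAC /A ler_wpM2r ?l1norm_ge0// lerDl.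
Unshelve. all: by end_near. Qed.

Lemma average_bound zeta w : integrableR P zeta ->
  `|\int[P]_w' (zeta w' * kphi (w, w'))| <= C * \int[P]_w' `|zeta w'|.
Proof.
move=> iz; rewrite -RintZ; last exact: intR_norm.
apply: Rint_norm_le; [|exact/intRZ/intR_norm|].
  apply: (intR_ext (fun w => mulrC _ _)); apply: (intR_bounded_mul (C := C) _ _ iz) => //.
  exact: (measurable_slice1 w mphi).
by move=> w'; rewrite normrM mulrC ler_wpM2r.
Qed.

Lemma coord_meas_kernel w : coord_meas (~: [set l])%SET (fun w' => kphi (w, w')).
Proof.
have := @coord_meas_l1_continuous (~: [set l])%SET p
  (fun x => phi (\sum_j `|b 0 j * X j w - x 0 j|)) _ _ mbX.
have -> : (fun w' => phi (\sum_j `|b 0 j * X j w -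
    (\row_j0 (b 0 j0 * X j0 w') : 'rV_p) 0 j|)) = (fun w' => kphi (w, w')).
  by apply/funext => w'; congr phi; apply: eq_bigr => j _; rewrite mxE.
apply => x e e0.
exists (e / (K + 1)) => [|y yx]; first by rewrite divr_gt0// ltr_wpDl.
apply: le_lt_trans (phiK (sumr_ge0 _ _) (sumr_ge0 _ _)) _ => //.
apply: (@le_lt_trans _ _ ((K + 1) * l1norm (y - x))); last first.
  by rewrite mulrC -ltr_pdivlMr// ltr_wpDl.
apply: ler_pM => //; first by rewrite lerDl.
have := l1_dist_lip y x (\row_j (b 0 j * X j w)).
congr (`|_ - _| <= _); apply: eq_bigr => j _; by rewrite !mxE distrC.
Qed.

Lemma Rint_kernel_centered (e : R -> R) r : measurable_fun setT e ->
  integrableR P (e \o X l) -> \int[P]_w e (X l w) = 0 -> integrableR P r ->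
  \int[PP]_z (e (X l z.1) * r z.2 * kphi z) = 0.
Proof.
move=> me ie e0 ir.
have meX : measurable_fun setT (fun w => e (X l w)) by exact: measurableT_comp.
rewrite (@pair_dom_iter_swap _ _ _ P _ (fun w => C * `|e (X l w)|) (fun w => `|r w|)).
- apply: Rint_eq0 => w'.
  transitivity (r w' * \int[P]_w (1 * e (X l w) * kphi (w', w))).
    rewrite -RintZ; first by apply: eq_Rintegral => w _; rewrite -(pair_distC X b (w, w')) /=; ring.
    apply: (intR_ext (fun w => mulrC _ _)).
    apply: (intR_bounded_mul (C := C)) => //; first exact: (measurable_slice1 w' mphi).
    by apply: intR_ext ie => w /=; rewrite mul1r.
  rewrite (Rint_factor (C := C) splits1 me ie _ (coord_meas_kernel w'))//.
    by rewrite e0 mul0r mulr0.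
  by apply: intR_ext ie => w /=; rewrite mul1r.
- exact: (measurable_funM (measurable_pair meX (intR_meas ir)) mphi).
- exact/intRZ/(intR_norm ie).
- exact: intR_norm.
- move=> x y /=; rewrite !normrM [leRHS](_ : _ = `|e (X l x)| * `|r y| * C); last by ring.
  by rewrite ler_wpM2l ?mulr_ge0.
Qed.

(** Integrating over the second copy first, [Rint_factor] replaces the functions of
    its coordinate [l] by their mean; the mean is a function of the coordinate [l]
    of the first copy, to which [Rint_factor] applies once more. *)
Lemma Rint_separate zeta1 zeta2 (e1 e2 : R -> R) : splits zeta1 -> splits zeta2 ->
  measurable_fun setT e1 -> measurable_fun setT e2 ->
  integrableR P (fun w => `|e1 (X l w)| * q w) ->
  integrableR P (fun w => `|e2 (X l w)| * q w) ->
  integrableR P (fun w => `|zeta1 w * e1 (X l w)| * q w) ->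
  integrableR P (fun w => `|zeta2 w * e2 (X l w)| * q w) ->
  \int[PP]_z ((zeta1 z.1 * e1 (X l z.1)) * (zeta2 z.2 * e2 (X l z.2)) *
     (`|X l z.1 - X l z.2| * kphi z)) =
  \int[PP]_z (e1 (X l z.1) * e2 (X l z.2) * `|X l z.1 - X l z.2|) *
  \int[PP]_z (zeta1 z.1 * zeta2 z.2 * kphi z).
Proof.
move=> s1 s2 me1 me2 i1 i2 j1 j2.
have [[mz1 _] [mz2 _]] := (s1, s2).
have [iz1 iz2] := (splits_int s1, splits_int s2).
have q0 w : 0 <= q w := envelope_ge0 X l w.
have q1 w : 1 <= q w := envelope_ge1 X l w.
have mq : measurable_fun setT q := envelope_meas mX l.
have meX1 : measurable_fun setT (fun w => e1 (X l w)) by exact: measurableT_comp.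
have meX2 : measurable_fun setT (fun w => e2 (X l w)) by exact: measurableT_comp.
have Dq x y : `|X l x - X l y| <= q x * q y := X_diff_le X l x y.
have ie2 : integrableR P (fun w => e2 (X l w)).
  by apply: intR_le i2 => // w; rewrite ler_peMr.
have ie2x (x : R) : integrableR P (fun w => e2 (X l w) * `|x - X l w|).
  apply: (@intR_le _ _ _ _ _ (fun w => (1 + x ^+ 2) * (`|e2 (X l w)| * q w))).
  - apply: measurable_funM => //; apply: measurableT_comp => //.
    exact: measurable_funB.
  - move=> w; rewrite normrM normr_id mulrCA ler_wpM2l// /envelope.
    move: (X l w) => t.
    have := sqr_ge0 (`|x| - 1); have := sqr_ge0 (`|t| - 1).
    rewrite !sqrrB1 !real_normK ?num_real//.
    have := ler_normB x t; have := mulr_ge0 (sqr_ge0 x) (sqr_ge0 t); nra.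
  - exact: intRZ.
(* the mean over the coordinate [l] of the second copy *)
pose E2 x := \int[P]_w (e2 (X l w) * `|x - X l w|).
have E2lip x y : `|E2 x - E2 y| <= (\int[P]_w `|e2 (X l w)|) * `|x - y|.
  rewrite /E2 -RintB// mulrC -RintZ; last exact: intR_norm.
  apply: Rint_norm_le; [exact: intRB|exact/intRZ/intR_norm|].
  move=> w; rewrite -mulrBr normrM mulrC ler_wpM2r//.
  by apply: le_trans (ler_dist_dist _ _) _; rewrite opprB addrA subrK.
have mE2 : measurable_fun setT E2.
  apply: continuous_measurable_fun => u; apply/cvgrPdist_lt => e e0; near=> v.
  have A0 : 0 <= \int[P]_w `|e2 (X l w)| by apply: Rint_ge0.
  apply: le_lt_trans (E2lip u v) _.
  apply: (@le_lt_trans _ _ ((\int[P]_w `|e2 (X l w)| + 1) * `|u - v|)).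
    by rewrite ler_wpM2r// lerDl.
  rewrite mulrC -ltr_pdivlMr ?ltr_wpDl//.
  near: v; apply: cvgr_dist_lt; last by rewrite divr_gt0 ?ltr_wpDl// Rint_ge0.
  exact: cvg_id.
have E2q w : `|E2 (X l w)| <= (\int[P]_w' (`|e2 (X l w')| * q w')) * q w.
  rewrite mulrC -RintZ//; apply: Rint_norm_le => //; first exact: intRZ.
  by move=> w'; rewrite normrM normr_id mulrCA ler_wpM2l.
have mE2X : measurable_fun setT (fun w => E2 (X l w)) by exact: measurableT_comp.
set A2 := \int[P]_w' (`|e2 (X l w')| * q w') in E2q.
have iu : integrableR P ((fun x => e1 x * E2 x) \o X l).
  apply: (@intR_le _ _ _ _ _ (fun w => A2 * (`|e1 (X l w)| * q w))).
  - exact: measurable_funM.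
  - by move=> w /=; rewrite normrM mulrCA ler_wpM2l.
  - exact: intRZ.
have izu : integrableR P (fun w => zeta1 w * (e1 (X l w) * E2 (X l w))).
  apply: (@intR_le _ _ _ _ _ (fun w => A2 * (`|zeta1 w * e1 (X l w)| * q w))).
  - by apply: measurable_funM => //; exact: measurable_funM.
  - by move=> w /=; rewrite mulrA [X in X <= _]normrM mulrCA ler_wpM2l.
  - exact: intRZ.
have mF : measurable_fun setT (fun z : T * T => (zeta1 z.1 * e1 (X l z.1)) *
    (zeta2 z.2 * e2 (X l z.2)) * (`|X l z.1 - X l z.2| * kphi z)).
  exact: (measurable_funM (measurable_pair (measurable_funM mz1 meX1)
    (measurable_funM mz2 meX2)) (measurable_funM (measurable_X_diff mX l) mphi)).
rewrite (@pair_dom_iter _ _ _ P _ (fun w => C * (`|zeta1 w * e1 (X l w)| * q w))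
  (fun w => `|zeta2 w * e2 (X l w)| * q w) mF (intRZ C j1) j2); last first.
  move=> x y /=; rewrite normrM [X in X * _]normrM [X in _ * X]normrM normr_id.
  rewrite [leRHS](_ : _ = `|zeta1 x * e1 (X l x)| * `|zeta2 y * e2 (X l y)| *
    (q x * q y * C)); last by ring.
  by rewrite ler_wpM2l ?mulr_ge0// ler_pM.
have mG : measurable_fun setT
    (fun z : T * T => e1 (X l z.1) * e2 (X l z.2) * `|X l z.1 - X l z.2|).
  exact: (measurable_funM (measurable_pair meX1 meX2) (measurable_X_diff mX l)).
rewrite (@pair_dom_iter _ _ _ P _ (fun w => `|e1 (X l w)| * q w)
  (fun w => `|e2 (X l w)| * q w) mG i1 i2); last first.
  move=> x y /=; rewrite normrM normrM normr_id.
  rewrite [leRHS](_ : _ = `|e1 (X l x)| * `|e2 (X l y)| * (q x * q y)); last by ring.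
  by rewrite ler_wpM2l ?mulr_ge0.
have mK : measurable_fun setT (fun z : T * T => zeta1 z.1 * zeta2 z.2 * kphi z).
  exact: (measurable_funM (measurable_pair mz1 mz2) mphi).
rewrite (@pair_dom_iter _ _ _ P _ (fun w => C * `|zeta1 w|)
  (fun w => `|zeta2 w|) mK (intRZ C (intR_norm iz1)) (intR_norm iz2)); last first.
  move=> x y /=; rewrite !normrM [leRHS](_ : _ = `|zeta1 x| * `|zeta2 y| * C); last by ring.
  by rewrite ler_wpM2l ?mulr_ge0.
pose V w := \int[P]_w' (zeta2 w' * kphi (w, w')).
have izk w : integrableR P (fun w' => zeta2 w' * kphi (w, w')).
  apply: (intR_ext (fun w => mulrC _ _)); apply: (intR_bounded_mul (C := C) _ _ iz2) => //.
  exact: (measurable_slice1 w mphi).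
transitivity (\int[P]_w (zeta1 w * (e1 (X l w) * E2 (X l w)) * V w)).
  apply: eq_Rintegral => w _ /=.
  have me2w : measurable_fun setT (fun x => e2 x * `|X l w - x|).
    apply: measurable_funM => //; apply: measurableT_comp => //.
    exact: measurable_funB.
  have iz2w : integrableR P (fun w' => zeta2 w' * (e2 (X l w') * `|X l w - X l w'|)).
    apply: (@intR_le _ _ _ _ _ (fun w' => q w * (`|zeta2 w' * e2 (X l w')| * q w'))).
    - apply: measurable_funM => //; apply: measurable_funM => //.
      by apply: measurableT_comp => //; exact: measurable_funB.
    - by move=> w'; rewrite mulrA normrM normr_id mulrCA ler_wpM2l.
    - exact: intRZ.
  have := Rint_factor s2 me2w (ie2x (X l w)) iz2w (coord_meas_kernel w) (fun w' => phiz (w, w')).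
  rewrite -/(E2 (X l w)) -/(V w) => Ef.
  transitivity (zeta1 w * e1 (X l w) * (E2 (X l w) * V w)); last by ring.
  rewrite -Ef -RintZ; first by apply: eq_Rintegral => w' _; ring.
  apply: (intR_ext (fun w => mulrC _ _)); apply: (intR_bounded_mul (C := C) _ _ iz2w) => //.
  exact: (measurable_slice1 w mphi).
rewrite (Rint_factor s1 (measurable_funM me1 mE2) iu izu (coord_meas_average iz2)
  (fun w => average_bound w iz2)).
congr (_ * _); apply: eq_Rintegral => w _ /=.
- rewrite /E2 -RintZ//; apply: eq_Rintegral => w' _; ring.
- by rewrite -RintZ//; apply: eq_Rintegral => w' _; ring.
Unshelve. all: by end_near. Qed.

End Separation.

End Factorisation.

End Independence.

(** * Moments of the signal *)

Section SignalCoordinate.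
Context (R : realType) d (T : measurableType d) (P : probability T R) (p : nat)
  (X : 'I_p -> T -> R).
Hypothesis mX : forall j, measurable_fun setT (X j).
Local Notation PP := (square_prob P).

Lemma distance_form_int (e : T -> R) l : measurable_fun setT e ->
  integrableR P (fun w => `|e w| * envelope X l w) ->
  integrableR PP (fun z : T * T => e z.1 * e z.2 * `|X l z.1 - X l z.2|) /\
  `|\int[PP]_z (e z.1 * e z.2 * `|X l z.1 - X l z.2|)| <=
  (\int[P]_w (`|e w| * envelope X l w)) ^+ 2.
Proof.
move=> me iq.
have mF : measurable_fun setT (fun z : T * T => e z.1 * e z.2 * `|X l z.1 - X l z.2|).
  exact: (measurable_funM (measurable_pair me me) (measurable_X_diff mX l)).
have Fb (x y : T) : `|e (x, y).1 * e (x, y).2 * `|X l (x, y).1 - X l (x, y).2| | <=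
    (`|e x| * envelope X l x) * (`|e y| * envelope X l y).
  by rewrite /= !normrM normr_id mulrACA ler_wpM2l ?mulr_ge0 ?X_diff_le.
by split; [exact: (pair_dom_int mF iq iq Fb)|rewrite expr2; exact: (pair_dom_le mF iq iq Fb)].
Qed.

(** The distance is a conditionally negative kernel: as [t] tends to zero,
    [(1 - expR (- t * u)) / t] tends to [u], and centred functions do not see the
    constant. *)
Lemma centered_distance_form_le0 (e : T -> R) l : measurable_fun setT e ->
  integrableR P e -> integrableR P (fun w => `|e w| * envelope X l w) ->
  \int[P]_w e w = 0 ->
  \int[PP]_z (e z.1 * e z.2 * `|X l z.1 - X l z.2|) <= 0.
Proof.
move=> me ie iq e0.
set s := \int[PP]_z _; set A := \int[P]_w (`|e w| * envelope X l w).
have A0 : 0 <= A by apply: Rint_ge0 => w; rewrite mulr_ge0 ?envelope_ge0.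
have mee : measurable_fun setT (fun z : T * T => e z.1 * e z.2) by exact: measurable_pair.
have mD := measurable_X_diff mX l.
have [is_ _] := distance_form_int me iq.
have [iee Eee] := Rint_pair_prod ie ie; rewrite e0 mul0r in Eee.
have small t : 0 < t -> s <= t * (2 * A ^+ 2).
  move=> t0.
  have [mk [C kC] kpos] := @psd_kernel_exp R d T P (fun w => t * X l w) (fun=> 1)
    (measurable_funM (@measurable_cst _ _ _ _ _ t) (mX l)) (psd_kernel1 P) (fun=> ler01).
  have := kpos e ie; set Q := \int[PP]_z _ => Q0.
  pose G (z : T * T) := e z.1 * e z.2 *
    (expR (- `|t * X l z.1 - t * X l z.2|) * 1 - 1 + t * `|X l z.1 - X l z.2|).
  have mG : measurable_fun setT G.
    apply: (measurable_funM mee); apply: measurable_funD; last exact: measurable_funM.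
    exact: measurable_funB.
  have Gb x y : `|G (x, y)| <= (2 * t ^+ 2 * (`|e x| * envelope X l x)) *
      (`|e y| * envelope X l y).
    rewrite /G /= mulr1 normrM normrM.
    have Dt : `|t * X l x - t * X l y| = t * `|X l x - X l y|.
      by rewrite -mulrBr normrM gtr0_norm.
    have := @expRN_taylor2 R (t * `|X l x - X l y|) 0
      (mulr_ge0 (ltW t0) (normr_ge0 _)) (lexx 0).
    rewrite !subr0 oppr0 expR0 mul1r -Dt => h.
    rewrite [leRHS](_ : _ = `|e x| * `|e y| * (t ^+ 2 *
      (2 * (envelope X l x * envelope X l y)))); last by ring.
    rewrite ler_wpM2l ?mulr_ge0// (le_trans h)// Dt exprMn ler_wpM2l ?sqr_ge0//.
    exact: X_diff_sq_le.
  have iG := @pair_dom_int _ _ _ P G _ _ mG (intRZ (2 * t ^+ 2) iq) iq Gb.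
  have := @pair_dom_le _ _ _ P G _ _ mG (intRZ (2 * t ^+ 2) iq) iq Gb.
  rewrite (RintZ _ iq) -/A => GA.
  have : \int[PP]_z G z = Q + t * s.
    rewrite /Q -(RintZ t is_) -RintD; [|exact: (intR_quadratic mk kC ie ie)|exact: intRZ].
    transitivity (\int[PP]_z ((G z + e z.1 * e z.2) - e z.1 * e z.2)).
      by apply: eq_Rintegral => z _; ring.
    rewrite (RintB (intRD iG iee) iee) Eee subr0.
    by apply: eq_Rintegral => z _; rewrite /G; ring.
  move=> GE; rewrite GE in GA; have := le_trans (ler_norm _) GA => h.
  rewrite -(ler_pM2l t0); nra.
rewrite leNgt; apply/negP => s0.
pose t := s / (2 * A ^+ 2 + 1) / 2.
have K0 : 0 < 2 * A ^+ 2 + 1 by rewrite ltr_wpDl// mulr_ge0// sqr_ge0.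
have t0 : 0 < t by rewrite /t !divr_gt0.
have := small t t0.
have E : t * (2 * A ^+ 2 + 1) = s / 2 by rewrite /t mulrAC divfK// gt_eqF.
have := mulr_gt0 t0 K0; move: E; rewrite mulrDr mulr1; lra.
Qed.

Section SecondMoment.
Variable l : 'I_p.
Hypothesis indl : forall (C : set R) B, measurable C ->
  sigma_coords X (~: [set l])%SET B ->
  (P (X l @^-1` C `&` B) = P (X l @^-1` C) * P B)%E.

(** The projection of [Y] on functions of [X l] has the smaller norm.  Square
    integrability of the signal is part of the claim, so the signal is first
    truncated: the truncations are orthogonal to the rest and increase to the
    signal. *)
Lemma signal_second_moment (e : R -> R) (Y : T -> R) : measurable_fun setT e ->
  integrableR P (e \o X l) -> \int[P]_w e (X l w) = 0 ->
  measurable_fun setT Y -> integrableR P (fun w => Y w ^+ 2) ->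
  \int[P]_w Y w = 0 -> splits P X l (fun w => Y w - e (X l w)) ->
  integrableR P (fun w => e (X l w) ^+ 2) /\
  \int[P]_w e (X l w) ^+ 2 <= \int[P]_w Y w ^+ 2.
Proof.
move=> me ie e0 mY iY2 Y0 sz.
have iY := intR_sq mY iY2.
pose cut n x := e x * \1_[set x | `|e x| <= n%:R] x.
have meX : measurable_fun setT (fun w => e (X l w)) by exact: measurableT_comp.
have mc n : measurable_fun setT (cut n).
  apply: measurable_funM => //; apply: measurable_indic.
  rewrite -[X in measurable X]setTI.
  rewrite [X in _ `&` X](_ : _ = (fun x => `|e x|) @^-1` `]-oo, n%:R]); last first.
    by apply/seteqP; split => x /=; rewrite in_itv.
  exact: (measurableT_comp (@normr_measurable R setT) me) (measurable_itv _).
have cE n x : cut n x = if `|e x| <= n%:R then e x else 0.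
  rewrite /cut indicE; case: ifP => h; first by rewrite mem_set ?mulr1.
  by rewrite memNset ?mulr0//= h.
have cn n x : `|cut n x| <= n%:R by rewrite cE; case: ifP => // _; rewrite normr0.
have mcX n : measurable_fun setT (fun w => cut n (X l w)) by exact: measurableT_comp.
have icn n : integrableR P (cut n \o X l) by exact: (intR_bounded P (mcX n) (fun w => cn n (X l w))).
have ic2 n : integrableR P (fun w => cut n (X l w) ^+ 2).
  apply: (@intR_bounded _ _ _ P (n%:R ^+ 2)); first exact: measurable_funX.
  by move=> w; rewrite normrX ler_pXn2r// ?nnegrE.
have iz := splits_int sz.
have izc n : integrableR P (fun w => (Y w - e (X l w)) * cut n (X l w)).
  by apply: (intR_ext (fun w => mulrC _ _)); exact: (intR_bounded_mul (mcX n) _ iz).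
have bnd n : \int[P]_w cut n (X l w) ^+ 2 <= \int[P]_w Y w ^+ 2.
  have c1 : coord_meas X (~: [set l])%SET (fun=> 1).
    exact: (@measurable_cst _ _ (g_sigma_algebraType (coord_events X (~: [set l])))).
  have n1 (w : T) : `|1 : R| <= 1 by rewrite normr1.
  have := Rint_factor mX indl sz (mc n) (icn n) (izc n) c1 n1.
  have -> : \int[P]_w ((Y w - e (X l w)) * 1) = 0.
    transitivity (\int[P]_w (Y w - e (X l w))); first by apply: eq_Rintegral => w _; rewrite mulr1.
    by rewrite (RintB iY ie) Y0 e0 subrr.
  rewrite mulr0 => E.
  have : \int[P]_w (2 * ((Y w - e (X l w)) * cut n (X l w) * 1) +
      cut n (X l w) ^+ 2) <= \int[P]_w Y w ^+ 2.
    have i1 : integrableR P (fun w => 2 * ((Y w - e (X l w)) * cut n (X l w) * 1)).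
      by apply: intRZ; apply: intR_ext (izc n) => w; rewrite mulr1.
    apply: Rint_le => //; first exact: intRD.
    move=> w; rewrite cE; case: ifP => _; last by rewrite !(mulr0, mul0r) expr2 mul0r addr0 sqr_ge0.
    rewrite -subr_ge0 [X in 0 <= X](_ : _ = (Y w - e (X l w)) ^+ 2) ?sqr_ge0//; ring.
  rewrite RintD//; last by apply: intRZ; apply: intR_ext (izc n) => w; rewrite mulr1.
  rewrite RintZ; last by apply: intR_ext (izc n) => w; rewrite mulr1.
  by rewrite E mulr0 add0r.
pose g n w : \bar R := (cut n (X l w) ^+ 2)%:E.
have mg n : measurable_fun setT (g n) by apply/measurable_EFinP; exact: measurable_funX.
have g0 n w : setT w -> (0 <= g n w)%E by move=> _; rewrite lee_fin sqr_ge0.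
have gnd w : setT w -> {homo g^~ w : n m / (n <= m)%N >-> (n <= m)%E}.
  move=> _ n m nm; rewrite lee_fin !cE; case: ifP => h.
    by rewrite (le_trans h)// ler_nat.
  by rewrite expr2 mul0r sqr_ge0.
have gl w : limn (g^~ w) = (e (X l w) ^+ 2)%:E.
  apply: cvg_lim => //; apply: cvg_near_cst; exists (Num.truncn `|e (X l w)|).+1 => // n /= hn.
  rewrite /g cE; case: ifP => // /negP; case.
  apply/ltW/(lt_le_trans (truncnS_gt _)); by rewrite ler_nat.
have mono := monotone_convergence P measurableT mg g0 gnd.
have le : (\int[P]_w (e (X l w) ^+ 2)%:E <= (\int[P]_w Y w ^+ 2)%:E)%E.
  have -> : (\int[P]_w (e (X l w) ^+ 2)%:E = \int[P]_w limn (g^~ w))%E.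
    by apply: eq_integral => w _; rewrite gl.
  rewrite mono; apply: lime_le.
    apply: ereal_nondecreasing_is_cvgn => n m nm.
    by apply: ge0_le_integral => // w _; [exact: g0|exact: gnd].
  by apply: nearW => n; rewrite /g -EFin_Rint// lee_fin.
have ie2 : integrableR P (fun w => e (X l w) ^+ 2).
  apply: intR_ge0P; [exact: measurable_funX|by move=> w; exact: sqr_ge0|].
  exact: le_lt_trans le (ltry _).
by split => //; move: le; rewrite -EFin_Rint// lee_fin.
Qed.

End SecondMoment.

End SignalCoordinate.

(** * Bounds on the slopes of the energy *)

Section SlopeBounds.
Context (R : realType) (mu : {finite_measure set (measurableTypeR R) -> \bar R})
  (Mmu : R) (hk : l1_kernel_measure mu Mmu).
Context d (T : measurableType d) (P : probability T R) (p : nat)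
  (X : 'I_p -> T -> R).
Hypothesis mX : forall j, measurable_fun setT (X j).
Variables (A4 BY : R).
Hypotheses (iX4 : forall j, integrableR P (fun w => X j w ^+ 4))
  (EX4 : forall j, \int[P]_w X j w ^+ 4 <= A4).
Local Notation PP := (square_prob P).
Local Notation mass := (mass mu).
Local Notation slope := (laplace_slope mu Mmu).
Local Notation Q2 := (envelope_bound A4).
Local Notation kap := (weight_bound A4 BY).

Lemma envelope_Rint_le j : \int[P]_w envelope X j w <= Q2.
Proof.
apply: le_trans (envelope_sq_Rint mX iX4 EX4 j).
apply: Rint_le; [exact: envelope_int|exact: envelope_sq_int|].
by move=> w; rewrite expr2 ler_peMl ?envelope_ge0 ?envelope_ge1.
Qed.

Lemma envelope_bound_ge1 (j : 'I_p) : 1 <= Q2.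
Proof.
apply: le_trans (envelope_Rint_le j); rewrite -(Rint_cst P 1).
apply: Rint_le; [exact: intR_cst|exact: envelope_int|].
by move=> w; exact: envelope_ge1.
Qed.

Lemma mean_X_diff j : integrableR PP (fun z : T * T => `|X j z.1 - X j z.2|) /\
  \int[PP]_z `|X j z.1 - X j z.2| <= Q2 ^+ 2.
Proof.
have mD := measurable_X_diff mX j; have iq := envelope_int mX iX4 j.
have Dq (x y : T) : `| `|X j (x, y).1 - X j (x, y).2| | <= envelope X j x * envelope X j y.
  by rewrite normr_id /= X_diff_le.
have q0 : 0 <= \int[P]_w envelope X j w by apply: Rint_ge0 => w; exact: envelope_ge0.
split; first exact: (pair_dom_int mD iq iq Dq).
apply: le_trans (ler_norm _) _; apply: le_trans (pair_dom_le mD iq iq Dq) _.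
by rewrite expr2 ler_pM ?envelope_Rint_le.
Qed.

(** The slope kernel keeps a mean bounded away from zero on the ball: by
    monotonicity it lies above the line [slope a * (1 - u / a)], and [a] is
    twice a bound on the mean distance. *)
Lemma slope_mean_ge b (M : R) : orthant b -> l1norm b <= M -> 0 < M -> (0 < p)%N ->
  slope (2 * (M * Q2 ^+ 2)) / 2 <= \int[PP]_z slope (pair_dist X b z).
Proof.
move=> b0 bM M0 p0; have Q1 := envelope_bound_ge1 (Ordinal p0).
set a := 2 * _.
have a0 : 0 < a := mulr_gt0 (ltr0n _ 2) (mulr_gt0 M0 (exprn_gt0 2 (lt_le_trans ltr01 Q1))).
have s0 := slope_gt0 hk (ltW a0).
have iN : integrableR PP (pair_dist X b).
  apply: intR_sum => j _; apply: intR_ext (intRZ (b 0 j) (mean_X_diff j).1) => z /=.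
  by rewrite -mulrBr normrM ger0_norm.
have EN : \int[PP]_z pair_dist X b z <= a / 2.
  have -> : a / 2 = M * Q2 ^+ 2 by rewrite /a mulrC mulKf ?pnatr_eq0.
  apply: (@le_trans _ _ (l1norm b * Q2 ^+ 2)); last by rewrite ler_wpM2r ?sqr_ge0.
  rewrite /l1norm mulr_suml /pair_dist Rint_sum; last first.
    move=> j; apply: intR_ext (intRZ (b 0 j) (mean_X_diff j).1) => z /=.
    by rewrite -mulrBr normrM ger0_norm.
  apply: ler_sum => j _; rewrite ger0_norm//.
  apply: (@le_trans _ _ (\int[PP]_z (b 0 j * `|X j z.1 - X j z.2|))).
    rewrite le_eqVlt; apply/orP; left; apply/eqP; apply: eq_Rintegral => z _.
    by rewrite -mulrBr normrM ger0_norm.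
  by rewrite (RintZ _ (mean_X_diff j).1) ler_wpM2l// (mean_X_diff j).2.
have is_ : integrableR PP (fun z => slope (pair_dist X b z)).
  exact: (intR_bounded PP (slope_pair_meas hk P mX b) (slope_pair_bound hk X b)).
apply: (@le_trans _ _ (\int[PP]_z (slope a - slope a / a * pair_dist X b z))).
  rewrite (RintB (intR_cst PP (slope a)) (intRZ (slope a / a) iN)) Rint_cst (RintZ _ iN).
  have : slope a / a * \int[PP]_z pair_dist X b z <= slope a / a * (a / 2).
    by rewrite ler_wpM2l// divr_ge0// ltW.
  rewrite mulrA divfK ?gt_eqF//; move: (slope a) (slope a / a * _) => x y; lra.
apply: (Rint_le (intRB (intR_cst PP (slope a)) (intRZ (slope a / a) iN)) is_).
move=> z; have N0 := pair_dist_ge0 X b z; move: (pair_dist X b z) N0 => u u0.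
have [ua|au] := leP u a.
  apply: le_trans (slope_decr hk u0 ua); rewrite gerBl.
  exact: mulr_ge0 (divr_ge0 (ltW s0) (ltW a0)) u0.
apply: le_trans (slope_ge0 hk u); rewrite subr_le0 mulrAC ler_pdivlMr//.
by rewrite ler_pM2l// ltW.
Qed.

(** The energy of a rescaled point is nonnegative, so the radial derivative of
    the energy is controlled by the energy itself: a nonnegative function with
    bounded curvature has slope of the order of the root of its value. *)
Lemma radial_slope_ge (r : T -> R) b (M delta : R) : measurable_fun setT r ->
  integrableR P (fun w => r w ^+ 2) -> \int[P]_w r w ^+ 2 <= BY ->
  orthant b -> l1norm b <= M -> 0 < delta -> delta <= 1 ->
  - (energy mu P X r b + 2 * Mmu ^+ 2 * mass * kap ^+ 2 * (delta * M) ^+ 2) <=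
  delta * \sum_j b 0 j * slope_energy mu Mmu P X r b j.
Proof.
move=> mr ir2 rB b0 bM d0 d1.
pose c := (1 - delta) *: b.
have cb j : (c - b) 0 j = - delta * b 0 j by rewrite !mxE; ring.
have c0 : orthant c by move=> j; rewrite mxE mulr_ge0// subr_ge0.
have nc : l1norm (c - b) = delta * l1norm b.
  rewrite /l1norm mulr_sumr; apply: eq_bigr => j _.
  by rewrite cb normrM normrN (gtr0_norm d0).
have := energy_taylor hk mX iX4 EX4 mr ir2 rB b0 c0.
have -> : \sum_j (c - b) 0 j * slope_energy mu Mmu P X r b j =
    - (delta * \sum_j b 0 j * slope_energy mu Mmu P X r b j).
  rewrite mulr_sumr -sumrN; apply: eq_bigr => j _; rewrite cb.
  by rewrite mulNr mulrA mulNr.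
have Ec := energy_ge0 hk mX c (intR_sq mr ir2).
have K0 : 0 <= 2 * Mmu ^+ 2 * mass * kap ^+ 2.
  exact: mulr_ge0 (mulr_ge0 (mulr_ge0 (ler0n R 2) (sqr_ge0 _)) (mass_ge0 mu)) (sqr_ge0 _).
rewrite nc; have : (delta * l1norm b) ^+ 2 <= (delta * M) ^+ 2.
  have n0 : 0 <= delta * l1norm b := mulr_ge0 (ltW d0) (l1norm_ge0 b).
  have nM : delta * l1norm b <= delta * M by rewrite ler_wpM2l// ltW.
  by rewrite ler_pXn2r// nnegrE (le_trans n0 nM).
move/(ler_wpM2l K0) => h1 h2; have := le_trans (ler_norm _) (le_trans h2 h1).
move: Ec; move: (energy _ _ _ _ c) (energy _ _ _ _ b) (delta * \sum_j _) (_ * (delta * M) ^+ 2).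
by move=> x y z w; lra.
Qed.

Section ZeroCoordinate.
Variable l : 'I_p.
Hypothesis indl : forall (C : set R) B, measurable C ->
  sigma_coords X (~: [set l])%SET B ->
  (P (X l @^-1` C `&` B) = P (X l @^-1` C) * P B)%E.
Variables (b : 'rV[R]_p) (e : R -> R) (rho r : T -> R).
Hypotheses (bl : b 0 l = 0) (me : measurable_fun setT e)
  (ie2 : integrableR P (fun w => e (X l w) ^+ 2)) (e0 : \int[P]_w e (X l w) = 0)
  (eB : \int[P]_w e (X l w) ^+ 2 <= BY).
Hypotheses (mr : measurable_fun setT r) (ir2 : integrableR P (fun w => r w ^+ 2))
  (srho : splits P X l rho) (rE : forall w, r w = rho w + e (X l w)).

Let meX : measurable_fun setT (fun w => e (X l w)).
Proof. exact: measurableT_comp. Qed.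

Let ie : integrableR P (fun w => e (X l w)). Proof. exact: intR_sq meX ie2. Qed.

Let ir : integrableR P r. Proof. exact: intR_sq mr ir2. Qed.

Let mrho : measurable_fun setT rho. Proof. by case: srho. Qed.

Let irho2 : integrableR P (fun w => rho w ^+ 2).
Proof. by apply: intR_ext (intR_sqB mr meX ir2 ie2) => w; rewrite rE addrK. Qed.

Let irho : integrableR P rho. Proof. exact: intR_sq mrho irho2. Qed.

Local Notation psi z := (slope (pair_dist X b z)).
Local Notation ker z := (laplace mu (pair_dist X b z)).

Let mpsi := slope_pair_meas hk P mX b.
Let mker := laplace_pair_meas hk P mX b.
Let psib z : `|psi z| <= Mmu * mass := slope_pair_bound hk X b z.
Let kerb z : `|ker z| <= mass := laplace_pair_bound hk X b z.

Let swap_form (K : T * T -> R) C (f g : T -> R) : measurable_fun setT K ->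
  (forall z, `|K z| <= C) -> (forall z, K (z.2, z.1) = K z) ->
  integrableR P f -> integrableR P g ->
  \int[PP]_z (f z.1 * g z.2 * K z) = \int[PP]_z (g z.1 * f z.2 * K z).
Proof.
move=> mK KC Ksym if_ ig.
rewrite -(@Rint_pair_swap _ _ _ P (fun z => f z.1 * g z.2 * K z)
  (fun x => C * `|f x|) (fun y => `|g y|)).
- by apply: eq_Rintegral => z _; rewrite /= Ksym (mulrC (f z.2)).
- exact: (measurable_funM (measurable_pair (intR_meas if_) (intR_meas ig)) mK).
- exact/intRZ/intR_norm.
- exact: intR_norm.
- move=> x y /=; rewrite !normrM [leRHS](_ : _ = `|f x| * `|g y| * C); last by ring.
  by rewrite ler_wpM2l ?mulr_ge0.
Qed.

(** The part of the residual carried by the coordinate [l] is orthogonal to the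
    rest, because the kernel does not see that coordinate. *)
Lemma energy_other : \int[PP]_z (rho z.1 * rho z.2 * ker z) = energy mu P X r b.
Proof.
have mM : 0 <= Mmu * mass by rewrite mulr_ge0 ?mass_ge0// ltW ?(Mmu_gt0 hk).
have hb u : 0 <= u -> `|laplace mu u| <= mass.
  by move=> u0; rewrite ger0_norm ?(laplace_ge0 hk) ?(laplace_le hk).
have Z g : integrableR P g -> \int[PP]_z (e (X l z.1) * g z.2 * ker z) = 0.
  exact: (Rint_kernel_centered mX indl bl mM hb (laplace_lip hk) mker me ie e0).
have i1 := intR_quadratic mker kerb irho irho.
have i2 := intR_quadratic mker kerb ie ir.
have i3 := intR_quadratic mker kerb irho ie.
have z3 : \int[PP]_z (rho z.1 * e (X l z.2) * ker z) = 0.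
  rewrite (swap_form mker kerb (fun z => congr1 _ (pair_distC X b z)) irho ie).
  exact: Z.
transitivity (\int[PP]_z (rho z.1 * rho z.2 * ker z) +
    \int[PP]_z (e (X l z.1) * r z.2 * ker z) + \int[PP]_z (rho z.1 * e (X l z.2) * ker z)).
  by rewrite (Z _ ir) z3 !addr0.
rewrite -(RintD i1 i2) -(RintD (intRD i1 i2) i3) /energy.
by apply: eq_Rintegral => z _; rewrite !rE; ring.
Qed.

(** Expanding the residual into the signal and the rest, each of the four terms
    factors into a mean over the coordinate [l] and a mean over the others.
    The signal term is negative; the other terms are small because the energy
    dominates the slope form of the rest. *)
Lemma slope_energy_zero_coord :
  slope_energy mu Mmu P X r b l <=
  \int[PP]_z (e (X l z.1) * e (X l z.2) * `|X l z.1 - X l z.2|) *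
    (\int[PP]_z psi z) +
  2 * kap * Q2 * Mmu * Num.sqrt (mass * energy mu P X r b) +
  Q2 ^+ 2 * Mmu * energy mu P X r b.
Proof.
have M0 : 0 < Mmu := Mmu_gt0 hk.
have mM : 0 <= Mmu ^+ 2 * mass by rewrite mulr_ge0 ?mass_ge0 ?sqr_ge0.
have pb u : 0 <= u -> `|slope u| <= Mmu * mass.
  by move=> u0; rewrite ger0_norm ?(slope_ge0 hk) ?(slope_le hk).
have iq := envelope_int mX iX4 l.
have iqe := weight_int mX iX4 meX ie2 l.
have iqr := weight_int mX iX4 mrho irho2 l.
have iq1 : integrableR P (fun w => `|1| * envelope X l w).
  by apply: intR_ext iq => w; rewrite normr1 mul1r.
have iqe1 : integrableR P (fun w => `|1 * e (X l w)| * envelope X l w).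
  by apply: intR_ext iqe => w; rewrite mul1r.
have iqr1 : integrableR P (fun w => `|rho w * 1| * envelope X l w).
  by apply: intR_ext iqr => w; rewrite mulr1.
have m1 : measurable_fun setT (fun _ : R => 1 : R) by exact: measurable_cst.
have s1 := splits1 P X l.
have sep := Rint_separate mX indl bl mM pb (slope_lip hk) mpsi.
have See := sep _ _ _ _ s1 s1 me me iqe iqe iqe1 iqe1.
have Ser := sep _ _ _ (fun=> 1) s1 srho me m1 iqe iq1 iqe1 iqr1.
have Sre := sep _ _ (fun=> 1) _ srho s1 m1 me iq1 iqe iqr1 iqe1.
have Srr := sep _ _ (fun=> 1) (fun=> 1) srho srho m1 m1 iq1 iq1 iqr1 iqr1.
have mD := measurable_X_diff mX l.
have iF (f g : T -> R) : measurable_fun setT f -> measurable_fun setT g ->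
    integrableR P (fun w => `|f w| * envelope X l w) ->
    integrableR P (fun w => `|g w| * envelope X l w) ->
    integrableR PP (fun z : T * T => f z.1 * g z.2 * (`|X l z.1 - X l z.2| * psi z)).
  move=> mf mg if_ ig.
  apply: (@pair_dom_int _ _ _ P _ _ _ (measurable_funM (measurable_pair mf mg)
    (measurable_funM mD mpsi)) (intRZ (Mmu * mass) if_) ig) => x y /=.
  rewrite normrM [X in X * _]normrM [X in _ * X]normrM normr_id.
  rewrite [leRHS](_ : _ = `|f x| * `|g y| *
    (envelope X l x * envelope X l y * (Mmu * mass))); last by ring.
  by rewrite ler_wpM2l ?mulr_ge0// ler_pM// X_diff_le.
have me1 : measurable_fun setT (fun w => 1 * e (X l w)) by exact: measurable_funM.
have mr1 : measurable_fun setT (fun w => rho w * 1) by exact: measurable_funM.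
have iee := iF _ _ me1 me1 iqe1 iqe1.
have ier := iF _ _ me1 mr1 iqe1 iqr1.
have ire := iF _ _ mr1 me1 iqr1 iqe1.
have irr := iF _ _ mr1 mr1 iqr1 iqr1.
have dec : slope_energy mu Mmu P X r b l =
    \int[PP]_z ((1 * e (X l z.1)) * (1 * e (X l z.2)) * (`|X l z.1 - X l z.2| * psi z)) +
    \int[PP]_z ((1 * e (X l z.1)) * (rho z.2 * 1) * (`|X l z.1 - X l z.2| * psi z)) +
    \int[PP]_z ((rho z.1 * 1) * (1 * e (X l z.2)) * (`|X l z.1 - X l z.2| * psi z)) +
    \int[PP]_z ((rho z.1 * 1) * (rho z.2 * 1) * (`|X l z.1 - X l z.2| * psi z)).
  rewrite -(RintD iee ier) -(RintD (intRD iee ier) ire).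
  rewrite -(RintD (intRD (intRD iee ier) ire) irr) /slope_energy.
  by apply: eq_Rintegral => z _; rewrite !rE; ring.
set A := \int[PP]_z psi z.
pose B := \int[PP]_z (rho z.1 * psi z).
pose C := \int[PP]_z (rho z.1 * rho z.2 * psi z).
pose s := \int[PP]_z (e (X l z.1) * e (X l z.2) * `|X l z.1 - X l z.2|).
pose U1 := \int[PP]_z (e (X l z.1) * 1 * `|X l z.1 - X l z.2|).
pose U2 := \int[PP]_z (1 * e (X l z.2) * `|X l z.1 - X l z.2|).
pose V := \int[PP]_z (1 * 1 * `|X l z.1 - X l z.2|).
have psisym z : psi (z.2, z.1) = psi z by rewrite pair_distC.
have i1 : integrableR P (fun _ : T => 1 : R) by exact: intR_cst.
have dec' : slope_energy mu Mmu P X r b l = s * A + U1 * B + U2 * B + V * C.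
  rewrite dec See Ser Sre Srr; congr (_ + _ + _ + _); congr (_ * _).
  - by apply: eq_Rintegral => z _; rewrite mul1r mul1r.
  - rewrite (swap_form mpsi psib psisym i1 irho).
    by apply: eq_Rintegral => z _; rewrite mulr1.
  - by apply: eq_Rintegral => z _; rewrite mulr1.
set En := energy mu P X r b.
have En0 : 0 <= En := energy_ge0 hk mX b ir.
have CEn : C <= Mmu * En.
  have [_ _ /(_ rho irho)] := psd_kernel_slope_dom hk P mX b.
  rewrite /En -energy_other /C.
  have ik := intR_quadratic mker kerb irho irho.
  have ip := intR_quadratic mpsi psib irho irho.
  rewrite -(RintZ Mmu ik) -subr_ge0 -(RintB (intRZ Mmu ik) ip).
  by congr (_ <= _); apply: eq_Rintegral => z _; ring.
have [_ _ /(_ rho irho) C0] := psd_kernel_slope hk P mX b.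
have A0 : 0 <= A by apply: Rint_ge0 => z; exact: slope_ge0.
have Ale : A <= Mmu * mass.
  rewrite -(Rint_cst PP (Mmu * mass)); apply: Rint_le.
  - exact: (intR_bounded PP mpsi psib).
  - exact: intR_cst.
  - by move=> z; exact: le_trans (ler_norm _) (psib z).
have Bsq : B ^+ 2 <= A * C := psd_kernel_CS (psd_kernel_slope hk P mX b) psisym irho.
have Bb : `|B| <= Mmu * Num.sqrt (mass * En).
  have -> : Mmu * Num.sqrt (mass * En) = Num.sqrt (Mmu ^+ 2 * (mass * En)).
    by rewrite (sqrtrM _ (sqr_ge0 Mmu)) sqrtr_sqr gtr0_norm.
  rewrite -sqrtr_sqr ler_wsqrtr// (le_trans Bsq)//.
  rewrite [leRHS](_ : _ = Mmu * mass * (Mmu * En)); last by ring.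
  by rewrite ler_pM.
have qQ := envelope_Rint_le l.
have q0 : 0 <= \int[P]_w envelope X l w by apply: Rint_ge0 => w; exact: envelope_ge0.
have ek := weight_Rint_le mX iX4 EX4 meX ie2 l eB.
have ek0 : 0 <= \int[P]_w (`|e (X l w)| * envelope X l w).
  by apply: Rint_ge0 => w; rewrite mulr_ge0 ?envelope_ge0.
have U1b : `|U1| <= kap * Q2.
  apply: le_trans (ler_pM ek0 q0 ek qQ); apply: (pair_dom_le _ iqe iq).
    exact: (measurable_funM (measurable_pair meX (intR_meas i1)) mD).
  by move=> x y /=; rewrite mulr1 normrM normr_id -mulrA ler_wpM2l// X_diff_le.
have U2b : `|U2| <= kap * Q2.
  rewrite mulrC; apply: le_trans (ler_pM q0 ek0 qQ ek); apply: (pair_dom_le _ iq iqe).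
    exact: (measurable_funM (measurable_pair (intR_meas i1) meX) mD).
  move=> x y /=; rewrite mul1r normrM normr_id mulrCA ler_wpM2l// X_diff_le//.
have V0 : 0 <= V by apply: Rint_ge0 => z; rewrite !mul1r.
have Vb : V <= Q2 ^+ 2.
  by apply: le_trans (mean_X_diff l).2; rewrite /V; under eq_Rintegral do rewrite !mul1r.
have kQ : 0 <= kap * Q2 := le_trans (normr_ge0 _) U1b.
rewrite dec' -addrA -addrA -addrA lerD2l addrA.
have cross U : `|U| <= kap * Q2 -> U * B <= kap * Q2 * (Mmu * Num.sqrt (mass * En)).
  move=> Ub; apply: le_trans (ler_norm _) _; rewrite normrM.
  exact: ler_pM.
have VC : V * C <= Q2 ^+ 2 * (Mmu * En) by exact: ler_pM.
have := lerD (lerD (cross _ U1b) (cross _ U2b)) VC.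
by congr (_ <= _); ring.
Qed.

End ZeroCoordinate.

End SlopeBounds.

(** * Recovery of a signal coordinate *)

Section ModelAssumptions.
Context (R : realType) d (T : measurableType d) (P : probability T R) (p : nat)
  (X : 'I_p -> T -> R).
Hypothesis mX : forall j, measurable_fun setT (X j).

Lemma Rint_indic_restrict (f : T -> R) (B : set T) :
  \int[P]_w (f w * \1_B w) = fine (\int[P]_(w in B) (f w)%:E)%E.
Proof.
rewrite -[RHS]/(\int[P]_(w in B) f w) [RHS]Rintegral_mkcond.
apply: eq_Rintegral => w _; rewrite patchE indicE.
by case: (w \in B); rewrite ?mulr1 ?mulr0.
Qed.

Lemma condexp0_noise xi :
  is_condexp P (sigma_coords X [set: 'I_p]%SET) xi (fun _ => 0) ->
  coord_noise P X xi.
Proof.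
move=> [ixi _ _ xi0]; split=> // B sB.
by rewrite Rint_indic_restrict -(xi0 _ sB) integral0.
Qed.

Lemma expectation0 (f : T -> R) : ('E_P[f] = 0)%E -> \int[P]_w f w = 0.
Proof. by rewrite unlock /Rintegral => ->. Qed.

Lemma expectation_le (f : T -> R) (C : R) : measurable_fun setT f ->
  (forall w, 0 <= f w) -> ('E_P[f] <= C%:E)%E ->
  integrableR P f /\ \int[P]_w f w <= C.
Proof.
rewrite unlock => mf f0 fC.
have if_ : integrableR P f by apply: intR_ge0P => //; exact: le_lt_trans fC (ltry _).
by split => //; rewrite -lee_fin EFin_Rint.
Qed.

(** The additive main effects of the other coordinates and a function of the other
    coordinates, such as a fit with zero scale at [l], make up the [l]-free part. *)
Lemma splits_residual (S : {set 'I_p}) (l : 'I_p) (Y xi h : T -> R)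
    (fstar : ({j | j \in S} -> R) -> R) (f : 'I_p -> R -> R) : l \in S ->
  {ae P, forall w, Y w = fstar (subcovariates X (S := S) w) + xi w} ->
  coord_noise P X xi -> additive_main_effect P X fstar f ->
  measurable_fun setT Y -> coord_meas X (~: [set l])%SET h -> integrableR P h ->
  splits P X l (fun w => Y w - h w - f l (X l w)).
Proof.
move=> lS modE noise [addE fm fi _ _] mY mh ih.
have mf j : j \in S -> measurable_fun setT (fun w => f j (X j w)).
  by move=> jS; exact: measurableT_comp (fm j jS) (mX j).
split.
  apply: measurable_funB; last exact: mf.
  exact: measurable_funB mY (coord_meas_measurable mX mh).
exists (fun w => \sum_(j in S | j != l) f j (X j w) - h w), xi; split => //.
- apply: (@measurable_funB _ (g_sigma_algebraType (coord_events X (~: [set l])))) => //.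
  under eq_fun do rewrite -big_filter.
  have : all (fun j => (j \in S) && (j != l)) [seq j <- index_enum 'I_p | (j \in S) && (j != l)].
    exact: filter_all.
  elim: [seq _ <- _ | _] => [_|j s IH /= /andP[/andP[jS jl] /IH ms]].
    under eq_fun do rewrite big_nil.
    exact: (@measurable_cst _ _ (g_sigma_algebraType (coord_events X (~: [set l])))).
  under eq_fun do rewrite big_cons.
  apply: (@measurable_funD _ (g_sigma_algebraType (coord_events X (~: [set l])))) => //.
  have mj : coord_meas X (~: [set l])%SET (X j) by apply: coord_measX; rewrite !inE.
  exact: (measurableT_comp (fm j jS) mj).
- by apply: intRB => //; apply: intR_sum => j /andP[jS _]; exact: fi.
- apply: filterS2 modE addE => w -> ->; rewrite (bigD1 l)//=; ring.
Qed.

End ModelAssumptions.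

(** The competition at a stationary point with zero [l]-th coordinate: the slope
    [s] of the energy along [l] is driven down by the signal [E], while
    stationarity keeps it above the radial slope [rad] up to the penalty.  Here [L]
    is the square root of the ridge parameter. *)
Lemma signal_too_large (R : realFieldType) (M c E A L gamma C1 C2 B s rad Cbar : R) :
  0 < M -> 0 < c -> 0 <= E -> c <= A -> 0 < L -> 0 <= gamma ->
  0 <= C1 -> 0 <= C2 -> 0 <= B ->
  s <= - E * A + C1 * L + C2 * L ^+ 2 -> - (L * B) <= rad ->
  rad <= M * s + 2 * L ^+ 2 * (M * gamma) ->
  M * C1 + B + M * C2 + 2 * M + 1 <= M * c * Cbar ->
  Cbar * (L * (1 + L) + L ^+ 2 * gamma) <= E -> False.
Proof.
move=> M0 c0 E0 cA L0 g0 C10 C20 B0 hs hrad hst hC hE.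
set u := L * (1 + L) + L ^+ 2 * gamma in hE.
have L2 : 0 < L ^+ 2 by rewrite exprn_gt0.
have Lg : 0 <= L ^+ 2 * gamma by rewrite mulr_ge0// ltW.
have u0 : 0 < u by rewrite /u; nra.
have k1 : M * (E * c) <= M * (E * A) by rewrite ler_pM2l// ler_wpM2l.
have k2 : M * s <= M * (- E * A + C1 * L + C2 * L ^+ 2) by rewrite ler_pM2l.
have k3 : (M * C1 + B + M * C2 + 2 * M + 1) * u <= M * c * E.
  apply: (@le_trans _ _ (M * c * Cbar * u)); first by rewrite ler_wpM2r// ltW.
  by rewrite -[leLHS]mulrA ler_wpM2l// mulr_ge0// ltW.
have r1 : 0 <= M * C1 * (L ^+ 2 + L ^+ 2 * gamma).
  by apply: mulr_ge0; [apply: mulr_ge0 => //; exact: ltW|apply: addr_ge0 => //; exact: ltW].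
have r2 : 0 <= B * (L ^+ 2 + L ^+ 2 * gamma).
  by apply: mulr_ge0 => //; apply: addr_ge0 => //; exact: ltW.
have r3 : 0 <= M * C2 * (L + L ^+ 2 * gamma).
  by apply: mulr_ge0; [apply: mulr_ge0 => //; exact: ltW|apply: addr_ge0 => //; exact: ltW].
have r4 : 0 <= 2 * M * (L + L ^+ 2).
  by apply: mulr_ge0; [apply: mulr_ge0 => //; exact: ltW|apply: addr_ge0; exact: ltW].
have id : (M * C1 + B + M * C2 + 2 * M + 1) * u =
    M * (C1 * L) + L * B + M * (C2 * L ^+ 2) + 2 * L ^+ 2 * (M * gamma) + u +
    (M * C1 * (L ^+ 2 + L ^+ 2 * gamma) + B * (L ^+ 2 + L ^+ 2 * gamma) +
     M * C2 * (L + L ^+ 2 * gamma) + 2 * M * (L + L ^+ 2)).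
  by rewrite /u; ring.
have k2' : M * (- E * A + C1 * L + C2 * L ^+ 2) =
  - (M * (E * A)) + M * (C1 * L) + M * (C2 * L ^+ 2) by ring.
have k3' : M * c * E = M * (E * c) by ring.
rewrite k2' in k2; rewrite k3' id in k3; lra.
Qed.

Theorem theorem2 (R : realType)
    (mu : {finite_measure set (measurableTypeR R) -> \bar R})
    (M MX MY Mmu : R) :
  l1_kernel_measure mu Mmu ->
  0 < M ->
  exists Cbar : R, 0 < Cbar /\
    forall (p : nat) (d : measure_display) (T : measurableType d)
      (P : probability T R) (X : 'I_p -> {RV P >-> R}) (Y xi : {RV P >-> R})
      (S : {set 'I_p}) (fstar : ({j | j \in S} -> R) -> R)
      (f : 'I_p -> R -> R) (l : 'I_p)
      (H : set ('rV[R]_p -> R))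
      (ip : ('rV[R]_p -> R) -> ('rV[R]_p -> R) -> R)
      (lambda gamma alpha : R) (b : nat -> 'rV[R]_p) (beta : 'rV[R]_p),
    regression_model P X Y xi fstar ->
    is_rkhs (@l1_kernel R mu p) H ip ->
    0 < lambda ->
    0 <= gamma ->
    (forall j : 'I_p, ('E_P[fun w => (X j w ^+ 4)%R] <= (MX ^+ 4)%:E)%E) ->
    ('E_P[fun w => (Y w ^+ 2)%R] <= (MY ^+ 2)%:E)%E ->
    additive_main_effect P X fstar f ->
    l \in S ->
    ~ {ae P, forall w, f l (X l w) = 0} ->
    ((Cbar * (Num.sqrt lambda * (1 + Num.sqrt lambda) + lambda * gamma))%:E
      <= signal_size P X f l)%E ->
    0 < alpha ->
    alpha <= lambda ^+ 2 / (Cbar * p%:R) ->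
    projected_gradient_descent (objective_gamma P X Y H ip lambda gamma)
      (l1_ball_orthant M) alpha b ->
    cluster (b @ \oo) beta ->
    l \in vsupp beta.
Proof.
move=> hk M0.
(* [c] bounds from below the factor of the signal in the slope along [l], [C1] and
   [C2] bound the other parts of that slope, [B] the radial slope; [Ka] and [Kb]
   are the two parts of the curvature.  The three terms of [Cbar] serve the final
   comparison, the reduction to [lambda <= 1] and the step size. *)
pose A4 := MX ^+ 4; pose BY := MY ^+ 2.
pose Q2 := envelope_bound A4; pose kap := weight_bound A4 BY; pose m := mass mu.
pose c := laplace_slope mu Mmu (2 * (M * Q2 ^+ 2)) / 2.
pose C1 := 2 * kap * Q2 * Mmu * Num.sqrt (m * BY); pose C2 := Q2 ^+ 2 * Mmu * BY.
pose B := BY + 2 * Mmu ^+ 2 * m * kap ^+ 2 * M ^+ 2.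
pose Ka := Mmu ^+ 2 * m * kap ^+ 2; pose Kb := (Mmu * m * kap) ^+ 2 * Q2 / 2.
pose Cs := M * C1 + B + M * C2 + 2 * M + 1.
pose Cbar := Cs / (M * c) + kap ^+ 2 + 2 * (Ka + Kb).
have BY0 : 0 <= BY := sqr_ge0 MY.
have Mmu0 : 0 < Mmu := Mmu_gt0 hk.
have m0 : 0 <= m := mass_ge0 mu.
have A40 : 0 <= A4 by rewrite /A4 (exprM MX 2 2) sqr_ge0.
have Q20 : 0 <= Q2.
  by apply: addr_ge0 => //; exact: mulr_ge0.
have kap0 : 0 <= kap by apply: divr_ge0 => //; exact: addr_ge0.
have c0 : 0 < c.
  apply: divr_gt0 => //; apply: (slope_gt0 hk).
  by apply: mulr_ge0 => //; exact: mulr_ge0 (ltW M0) (sqr_ge0 _).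
have C10 : 0 <= C1.
  apply: mulr_ge0 (sqrtr_ge0 _); apply: mulr_ge0 (ltW Mmu0).
  by apply: mulr_ge0 Q20; exact: mulr_ge0.
have C20 : 0 <= C2 := mulr_ge0 (mulr_ge0 (sqr_ge0 _) (ltW Mmu0)) BY0.
have Ka0 : 0 <= Ka := mulr_ge0 (mulr_ge0 (sqr_ge0 _) m0) (sqr_ge0 _).
have B0 : 0 <= B.
  apply: addr_ge0 => //; apply: mulr_ge0 (sqr_ge0 _); apply: mulr_ge0 (sqr_ge0 _).
  by apply: mulr_ge0 m0; exact: mulr_ge0 (ler0n _ 2) (sqr_ge0 _).
have Kb0 : 0 <= Kb := divr_ge0 (mulr_ge0 (sqr_ge0 _) Q20) (ler0n _ 2).
have Cs0 : 0 < Cs.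
  apply: ltr_wpDl ltr01; apply: addr_ge0; last exact: mulr_ge0 (ler0n _ 2) (ltW M0).
  apply: addr_ge0; last exact: mulr_ge0 (ltW M0) C20.
  by apply: addr_ge0 => //; exact: mulr_ge0 (ltW M0) C10.
have q0 : 0 < Cs / (M * c) := divr_gt0 Cs0 (mulr_gt0 M0 c0).
have k20 : 0 <= kap ^+ 2 := sqr_ge0 kap.
have KK0 : 0 <= 2 * (Ka + Kb) := mulr_ge0 (ler0n _ 2) (addr_ge0 Ka0 Kb0).
have Cbar0 : 0 < Cbar := ltr_wpDr KK0 (ltr_wpDr k20 q0).
have CbarC : Cs <= M * c * Cbar.
  rewrite /Cbar -addrA mulrDr mulrC divfK; last by rewrite gt_eqF// mulr_gt0.
  by rewrite lerDl mulr_ge0//; [exact: ltW (mulr_gt0 M0 c0)|exact: addr_ge0].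
have Cbark : kap ^+ 2 <= Cbar.
  by rewrite /Cbar; move: q0 KK0; move: (Cs / _) (kap ^+ 2) (2 * _) => x y z; lra.
have CbarK : 2 * (Ka + Kb) <= Cbar.
  by rewrite /Cbar; move: q0 k20; move: (Cs / _) (kap ^+ 2) (2 * _) => x y z; lra.
exists Cbar; split=> // p d T P X Y xi S fstar f l H ip la ga al b beta.
move=> model rk la0 ga0 X4 Y2 add lS _ sig al0 ale pgd clu.
have p0 : (0 < p)%N := leq_ltn_trans (leq0n l) (ltn_ord l).
have mX j : measurable_fun setT (X j) := measurable_funPT (X j).
have mY : measurable_fun setT Y := measurable_funPT Y.
have iX4 j := (expectation_le (measurable_funX 4 (mX j))
  (fun w => exprn_even_ge0 (X j w) (isT : ~~ odd 4)) (X4 j)).1.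
have EX4 j := (expectation_le (measurable_funX 4 (mX j))
  (fun w => exprn_even_ge0 (X j w) (isT : ~~ odd 4)) (X4 j)).2.
have [iY2 EY2] := expectation_le (measurable_funX 2 mY) (fun w => sqr_ge0 (Y w)) Y2.
have [Yc modE noise [[[_ indS] _] _]] := model.
have [addE fm fi fc mutS] := add.
have indl := indep_coord mX lS mutS indS.
have nxi := condexp0_noise noise.
have e0 := expectation0 (fc l lS).
have s0 : splits P X l (fun w => Y w - f l (X l w)).
  have : splits P X l (fun w => Y w - 0 - f l (X l w)).
    apply: (splits_residual mX lS modE nxi add mY); last exact: intR_cst.
    exact: (@measurable_cst _ _ (g_sigma_algebraType (coord_events X (~: [set l])))).
  by congr splits; apply/funext => w; rewrite subr0.
have [ie2 eY] := signal_second_moment mX indl (fm l lS) (fi l lS) e0 mY iY2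
  (expectation0 Yc) s0.
have eB := le_trans eY EY2.
have meX : measurable_fun setT (fun w => f l (X l w)) := measurableT_comp (fm l lS) (mX l).
have iqe := weight_int mX iX4 meX ie2 l.
have ek := weight_Rint_le mX iX4 EX4 meX ie2 l eB.
have [is_ sb] := distance_form_int mX meX iqe.
have sle0 := centered_distance_form_le0 mX meX (intR_sq meX ie2) iqe e0.
set s := (X in X <= 0) in sle0.
have sigE : signal_size P X f l = (- s)%:E.
  rewrite /signal_size unlock -(ler0_norm sle0).
  by transitivity (`|s%:E|)%E => //; rewrite /s (EFin_Rint is_).
set L := Num.sqrt la in sig.
have L0 : 0 < L by rewrite sqrtr_gt0.
have laE : la = L ^+ 2 by rewrite sqr_sqrtr// ltW.
have {sigE}sig : Cbar * (L * (1 + L) + L ^+ 2 * ga) <= - s.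
  by rewrite -laE -lee_fin -sigE.
have ek0 : 0 <= \int[P]_w (`|f l (X l w)| * envelope (fun j => X j) l w).
  by apply: Rint_ge0 => w; rewrite mulr_ge0 ?envelope_ge0.
have skap : - s <= kap ^+ 2.
  apply: le_trans (ler_norm _) _; rewrite normrN; apply: le_trans sb _.
  by rewrite ler_pXn2r ?nnegrE.
(* the signal size is bounded, so the threshold forces [lambda <= 1] *)
have L1 : L <= 1.
  have u1 : L * (1 + L) + L ^+ 2 * ga <= 1.
    rewrite -(ler_pM2l Cbar0) mulr1.
    exact: le_trans sig (le_trans skap Cbark).
  apply: le_trans u1; rewrite mulrDr mulr1 -addrA lerDl addr_ge0//.
    exact: mulr_ge0 (ltW L0) (ltW L0).
  exact: mulr_ge0 (sqr_ge0 L) ga0.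
have la1 : la <= 1 by rewrite laE expr_le1// ltW.
have step : 2 * (al * (curvature mu Mmu la A4 BY * p%:R)) <= 1.
  have pR : (0 : R) < p%:R by rewrite ltr0n.
  have alp : al * p%:R <= la ^+ 2 / Cbar.
    rewrite -ler_pdivlMr//; apply: le_trans ale _.
    by rewrite invfM mulrA.
  have cu0 : 0 <= Ka / la + Kb / la ^+ 2.
    apply: addr_ge0; apply: divr_ge0 => //; first exact: ltW.
    exact: sqr_ge0.
  have -> : curvature mu Mmu la A4 BY = Ka / la + Kb / la ^+ 2 by [].
  rewrite [leLHS](_ : _ = 2 * (al * p%:R * (Ka / la + Kb / la ^+ 2))); last by ring.
  apply: (@le_trans _ _ (2 * (la ^+ 2 / Cbar * (Ka / la + Kb / la ^+ 2)))).
    by rewrite ler_pM2l// ler_wpM2r.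
  have -> : 2 * (la ^+ 2 / Cbar * (Ka / la + Kb / la ^+ 2)) = 2 * (Ka * la + Kb) / Cbar.
    by field; rewrite !gt_eqF.
  rewrite ler_pdivrMr// mul1r; apply: le_trans CbarK.
  by rewrite ler_pM2l// lerD2r ler_piMr.
have [fit fitf] := fit_exists hk mX mY iY2 rk la0 beta.
have [[b0 bM] stat] := stationary_cluster hk mX mY iY2 rk la0 iX4 EX4 EY2 p0 M0 ga0
  al0 step pgd clu fitf.
apply: contraT; rewrite inE negbK => /eqP bl; exfalso.
have Hf : H fit by case: fitf.
pose r := residual (fun j => X j) Y beta fit.
have mr : measurable_fun setT r := residual_meas hk mX mY rk beta Hf.
have ir2 : integrableR P (fun w => r w ^+ 2) := residual_sq_int hk mX mY iY2 rk beta Hf.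
have rB : \int[P]_w r w ^+ 2 <= BY.
  exact: le_trans (residual_sq_le hk mX mY iY2 rk la0 fitf) EY2.
set En := energy mu P (fun j => X j) r beta.
have En0 : 0 <= En := energy_ge0 hk mX beta (intR_sq mr ir2).
have EnB : En <= la * BY.
  apply: le_trans (fit_energy_le hk mX mY iY2 rk la0 fitf) _.
  by rewrite ler_pM2l.
pose rho w := Y w - fit (scaled (fun j => X j) beta w) - f l (X l w).
have srho : splits P X l rho.
  apply: (splits_residual mX lS modE nxi add mY).
    have := coord_meas_l1_continuous (rkhs_l1_continuous hk rk Hf) (coord_meas_scale (X := fun j => X j) bl).
    congr coord_meas; apply/funext => w; congr fit.
    by apply/rowP => j; rewrite !mxE.
  exact: (intR_scaled hk P mX rk beta Hf).
have rE w : r w = rho w + f l (X l w) by rewrite /rho subrK.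
have hs := slope_energy_zero_coord hk mX iX4 EX4 indl bl (fm l lS) ie2 e0 eB mr ir2 srho rE.
have cA := slope_mean_ge hk mX iX4 EX4 b0 bM M0 p0.
have hr := radial_slope_ge hk mX iX4 EX4 mr ir2 rB b0 bM L0 L1.
(* stationarity against the vertex [M e_l] of the ball *)
pose sl j := slope_energy mu Mmu P (fun j => X j) r beta j.
pose rad := \sum_j beta 0 j * sl j.
have hst : rad <= M * sl l + 2 * L ^+ 2 * (M * ga).
  have ball : l1_ball_orthant M (M *: delta_mx 0 l : 'rV[R]_p).
    have E j : (M *: delta_mx 0 l : 'rV[R]_p) 0 j = if j == l then M else 0.
      by rewrite !mxE eqxx /=; case: eqP; rewrite ?mulr1 ?mulr0.
    split=> [j|]; first by rewrite E; case: ifP => // _; exact: ltW.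
    rewrite /l1norm (bigD1 l)//= E eqxx big1 ?addr0 ?gtr0_norm// => j /negbTE jl.
    by rewrite E jl normr0.
  have := stat _ ball; rewrite /dot.
  have -> : \sum_j (gradient mu Mmu P (fun j => X j) Y la beta fit + const_mx ga) 0 j *
      (M *: delta_mx 0 l - beta) 0 j =
      (M * sl l - rad) / (2 * la) + ga * (M - \sum_j beta 0 j).
    transitivity (\sum_j ((sl j / (2 * la) + ga) * (M * (j == l)%:R)) -
        \sum_j (beta 0 j * sl j / (2 * la) + ga * beta 0 j)).
      rewrite -sumrB; apply: eq_bigr => j _; rewrite !mxE eqxx /= -/r -/(sl j); ring.
    rewrite (bigD1 l)//= eqxx big1 ?addr0 => [|j /negbTE ->]; last by rewrite !mulr0.
    rewrite big_split /= -mulr_suml -mulr_sumr -/rad; ring.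
  have sb0 : 0 <= ga * \sum_j beta 0 j by apply: mulr_ge0 => //; apply: sumr_ge0.
  rewrite mulrBr => h.
  have : 0 <= (M * sl l - rad) / (2 * la) + M * ga.
    by apply: le_trans h _; rewrite lerD2l mulrC gerBl.
  have la20 : 0 < 2 * la by rewrite mulr_gt0.
  rewrite -(pmulr_rge0 _ la20) mulrDr mulrC divfK ?gt_eqF// => h2.
  by rewrite -laE -subr_ge0 addrAC.
have hrad : - (L * B) <= rad.
  rewrite -(ler_pM2l L0); apply: le_trans hr.
  rewrite mulrN lerN2 [leRHS](_ : _ = L ^+ 2 * BY + 2 * Mmu ^+ 2 * m * kap ^+ 2 * (L * M) ^+ 2).
    by rewrite lerD2r -laE.
  by rewrite /B; ring.
have sqEn : Num.sqrt (m * En) <= L * Num.sqrt (m * BY).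
  by rewrite /L -(sqrtrM _ (ltW la0)) ler_wsqrtr// mulrCA ler_wpM2l.
have hsl : sl l <= - - s * (\int[square_prob P]_z
    laplace_slope mu Mmu (pair_dist (fun j => X j) beta z)) + C1 * L + C2 * L ^+ 2.
  apply: le_trans hs _; rewrite opprK -!addrA lerD2l; apply: lerD.
    have -> : C1 * L = 2 * kap * Q2 * Mmu * (L * Num.sqrt (m * BY)) by rewrite /C1; ring.
    apply: ler_wpM2l sqEn.
    by apply: mulr_ge0 (ltW Mmu0); apply: mulr_ge0 Q20; exact: mulr_ge0.
  have -> : C2 * L ^+ 2 = Q2 ^+ 2 * Mmu * (la * BY) by rewrite /C2 -laE; ring.
  by apply: ler_wpM2l EnB; exact: mulr_ge0 (sqr_ge0 _) (ltW Mmu0).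
have s0' : 0 <= - s by rewrite oppr_ge0.
exact: (signal_too_large M0 c0 s0' cA L0 ga0 C10 C20 B0 hsl hrad hst CbarC sig).
Qed.
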